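(* Suppose $K\subset\mathbb{N}$ and $A\ge0$. Then the operator $$\Psi_{K,I}=\mathcal{Z}_{K,I}-A\,\mathrm{Id}$$ on $L^2(I)$ is compact for all bounded and symmetric intervals $I\subset\mathbb{R}$ if and only if $$\lim_{x\to\infty}\frac{\pi_K(x)}{x}=A.$$
   Context: $\mathbb{N}=\{1,2,3,\dots\}$. A bounded symmetric interval is $I=(-T,T)$ with $0<T<\infty$. For $K\subset\mathbb{N}$, $\pi_K(x)=\#\{n\in K: n\le x\}$ and $\zeta_K(s)=\sum_{n\in K}n^{-s}$, absolutely convergent for $\operatorname{Re}s>1$. The operator $\mathcal{Z}_{K,I}:L^2(I)\to L^2(I)$ is defined by $$\mathcal{Z}_{K,I}g(t)=\lim_{\delta\to0^+}\frac{\chi_I(t)}{\pi}\int_I g(\tau)\operatorname{Re}\zeta_K(1+\delta+\mathrm{i}(t-\tau))\,\mathrm{d}\tau,$$ with the limit taken in $L^2(I)$ (this is a bounded operator on $L^2(I)$); $\chi_I$ is the characteristic function of $I$ and $\mathrm{Id}$ the identity operator on $L^2(I)$. *)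

(* Defs.v *)
From HB Require Import structures.
From mathcomp Require Import all_boot all_order all_algebra.
From mathcomp Require Import finmap generic_quotient ring_quotient complex.
From mathcomp Require Import all_classical all_reals all_analysis.
From mathcomp Require Import measurable_realfun.

Set Implicit Arguments.
Unset Strict Implicit.
Unset Printing Implicit Defensive.

Import Order.TTheory GRing.Theory Num.Theory.
Import numFieldNormedType.Exports.
Import ComplexField.

Local Open Scope classical_set_scope.
Local Open Scope ring_scope.
Local Open Scope complex_scope.
Local Open Scope quotient_scope.

Local Notation Re := (@complex.Re _).
Local Notation Im := (@complex.Im _).
Local Notation normc := (@Normc.normc _).

Section complex_extra.
Variable R : realType.
Implicit Types x y : R[i].

Lemma ReD x y : Re (x + y) = Re x + Re y. Proof. by case: x y => ? ? []. Qed.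
Lemma ImD x y : Im (x + y) = Im x + Im y. Proof. by case: x y => ? ? []. Qed.
Lemma ReM x y : Re (x * y) = Re x * Re y - Im x * Im y.
Proof. by case: x y => ? ? []. Qed.
Lemma ImM x y : Im (x * y) = Re x * Im y + Im x * Re y.
Proof. by case: x y => ? ? []. Qed.
Lemma normc_ge0 x : 0 <= normc x.
Proof. by case: x => a b; exact: sqrtr_ge0. Qed.

End complex_extra.

Section cL2.
Context d (T : measurableType d) (R : realType).
Variable mu : {measure set T -> \bar R}.
Local Notation N2 f := (Lnorm mu 2%:E (EFin \o f)).

Definition cL2_set : set (T -> R[i]) :=
  [set f : T -> R[i] | [/\ measurable_fun setT (Re \o f),
               measurable_fun setT (Im \o f) &
               finite_norm mu 2%:E (normc \o f)]].

Definition cL2_pred : {pred T -> R[i]} := mem cL2_set.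

Lemma measurable_normc (f : T -> R[i]) :
  measurable_fun setT (Re \o f) -> measurable_fun setT (Im \o f) ->
  measurable_fun setT (normc \o f).
Proof.
move=> mr mi.
have -> : normc \o f =
          Num.sqrt \o (fun x => (Re (f x)) ^+ 2 + (Im (f x)) ^+ 2).
  by apply/funext => x /=; case: (f x).
apply: measurableT_comp; first by apply: continuous_measurable_fun; exact: sqrt_continuous.
by apply: measurable_funD; apply: measurable_funX.
Qed.

Lemma le_Lnorm2 (f g : T -> R) :
  measurable_fun setT f -> measurable_fun setT g ->
  (forall x, `|f x| <= g x) -> (N2 f <= N2 g)%E.
Proof.
move=> mf mg fg; rewrite unlock /Lnorm.
have mp (h : T -> R) : measurable_fun setT h ->
    measurable_fun setT (fun x => (`|(EFin \o h) x| `^ 2)%E).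
  move=> mh; rewrite (_ : (fun _ => _) = EFin \o (fun x => `|h x| `^ 2))//.
  apply/measurable_EFinP.
  apply: (@measurableT_comp _ _ _ _ _ _ (@powR R ^~ 2)).
    exact: measurable_powR.
  exact: measurableT_comp.
apply: gt0_ler_poweR.
- by rewrite invr_ge0.
- by rewrite in_itv/= leey andbT integral_ge0.
- by rewrite in_itv/= leey andbT integral_ge0.
apply: ge0_le_integral => //; [|exact: mp|exact: mp|].
  by move=> x _; exact: poweR_ge0.
move=> x _ /=; rewrite lee_fin ge0_ler_powR ?nnegrE//.
by rewrite (le_trans (fg x))// ler_norm.
Qed.

Lemma cL2_lin (a : R[i]) f g : cL2_set f -> cL2_set g ->
  [/\ measurable_fun setT (Re \o (a *: f + g)),
      measurable_fun setT (Im \o (a *: f + g)) &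
      (N2 (normc \o (a *: f + g)%R) <=
       (normc a)%:E * N2 (normc \o f) + N2 (normc \o g))%E].
Proof.
move=> [rf imf nf] [rg ig ng].
have mr : measurable_fun setT (Re \o (a *: f + g)).
  rewrite (_ : Re \o _ = fun x => Re a * (Re \o f) x - Im a * (Im \o f) x
                                  + (Re \o g) x); last first.
    by apply/funext => x /=; rewrite ReD ReM.
  by apply: measurable_funD => //; apply: measurable_funB; apply: measurable_funM.
have mi : measurable_fun setT (Im \o (a *: f + g)).
  rewrite (_ : Im \o _ = fun x => Re a * (Im \o f) x + Im a * (Re \o f) x
                                  + (Im \o g) x); last first.
    by apply/funext => x /=; rewrite ImD ImM.
  by apply: measurable_funD => //; apply: measurable_funD; apply: measurable_funM.
split => //.
have mf := measurable_normc rf imf.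
have mg := measurable_normc rg ig.
have p1 : (1 <= 2%:E :> \bar R)%E by rewrite lee_fin ler1n.
have fL : normc \o f \in Lfun mu 2%:E by rewrite !inE; apply/andP; rewrite !inE.
have := LnormZ (Lfun_Sub p1 fL) (normc a).
rewrite ger0_norm ?normc_ge0//= => <-.
have maf : measurable_fun setT (normc a \*: (normc \o f)).
  exact: measurable_funM.
apply: le_trans; last exact: (@minkowski_EFin _ _ _ mu _ _ 2 maf mg).
apply: le_Lnorm2 => //.
- exact: measurable_normc.
- exact: measurable_funD.
move=> x /=; rewrite ger0_norm ?normc_ge0//.
rewrite -[leLHS]/(normc (a * f x + g x)).
rewrite -[leRHS]/(normc a * normc (f x) + normc (g x)) -Normc.normcM.
exact: le_normcD.
Qed.

Lemma cL2_submod_closed : submod_closed cL2_pred.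
Proof.
split.
  rewrite inE; split; try exact: measurable_cst.
  rewrite /finite_norm (_ : _ \o _ = cst 0%E) ?Lnorm0//.
  by apply/funext => x /=; rewrite expr0n/= addr0 sqrtr0.
move=> a f g; rewrite !inE => Lf Lg; have [mr mi le_fg] := cL2_lin a Lf Lg.
case: Lf Lg => _ _ nf [_ _ ng]; split => //; apply: le_lt_trans le_fg _.
by rewrite lte_add_pinfty// lte_mul_pinfty// ?lee_fin ?normc_ge0.
Qed.

HB.instance Definition _ :=
  GRing.isSubmodClosed.Build _ _ cL2_pred cL2_submod_closed.

Definition cL2fun := {f : T -> R[i] | f \in cL2_pred}.
HB.instance Definition _ := SubType.on cL2fun.
HB.instance Definition _ := Choice.on cL2fun.
HB.instance Definition _ := [SubChoice_isSubLmodule of cL2fun by <:].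

Definition cL2_null_pred : {pred cL2fun} :=
  mem [set f : cL2fun | {ae mu, forall x, val f x = 0}].

Lemma cL2_null_submod_closed : submod_closed cL2_null_pred.
Proof.
split; first by rewrite inE; exact: nearW.
move=> a f g; rewrite !inE; apply: filterS2 => x fx gx.
by rewrite linearP -[LHS]/(a * val f x + val g x) fx gx mulr0 addr0.
Qed.

HB.instance Definition _ :=
  GRing.isSubmodClosed.Build _ _ cL2_null_pred cL2_null_submod_closed.

Definition cL2 := Quotient.quot cL2_null_pred.
HB.instance Definition _ := Choice.on cL2.
HB.instance Definition _ := GRing.Zmodule.on cL2.

Definition cL2_pi (f : cL2fun) : cL2 := \pi_cL2 f.

Lemma cL2_piP (f g : cL2fun) :
  cL2_pi f = cL2_pi g <-> {ae mu, forall x, val f x = val g x}.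
Proof.
split=> [/eqP|fg]; last apply/eqP; rewrite -Quotient.idealrBE.
  rewrite inE; apply: filterS => x.
  by rewrite linearB => /eqP; rewrite -[X in X == _]/(val f x - val g x) subr_eq0 => /eqP.
rewrite inE; apply: filterS fg => x fg.
by rewrite linearB -[LHS]/(val f x - val g x) fg subrr.
Qed.

Lemma cL2_piD (f g : cL2fun) : cL2_pi (f + g) = cL2_pi f + cL2_pi g.
Proof. by rewrite /cL2_pi !piE. Qed.

Definition cL2_scale (a : R[i]) (u : cL2) : cL2 := cL2_pi (a *: repr u).

Lemma cL2_piK (u : cL2) : cL2_pi (repr u) = u.
Proof. exact: reprK. Qed.

Lemma repr_cL2_pi (f : cL2fun) :
  {ae mu, forall x, val (repr (cL2_pi f)) x = val f x}.
Proof. by apply/cL2_piP; rewrite cL2_piK. Qed.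

Lemma cL2_piZ a (f : cL2fun) : cL2_scale a (cL2_pi f) = cL2_pi (a *: f).
Proof.
apply/cL2_piP; apply: filterS (repr_cL2_pi f) => x fx.
rewrite !linearZ -[LHS]/(a * val (repr (cL2_pi f)) x).
by rewrite -[RHS]/(a * val f x) fx.
Qed.

Fact cL2_scalerA a b u : cL2_scale a (cL2_scale b u) = cL2_scale (a * b) u.
Proof. by rewrite -[u]cL2_piK !cL2_piZ scalerA. Qed.

Fact cL2_scale1r : left_id 1 cL2_scale.
Proof. by move=> u; rewrite -[u]cL2_piK !cL2_piZ scale1r. Qed.

Fact cL2_scalerDr : right_distributive cL2_scale +%R.
Proof.
move=> a u v; rewrite -[u]cL2_piK -[v]cL2_piK.
by rewrite -cL2_piD !cL2_piZ -cL2_piD scalerDr.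
Qed.

Fact cL2_scalerDl u : {morph cL2_scale^~ u : a b / a + b}.
Proof.
by move=> a b; rewrite -[u]cL2_piK !cL2_piZ -cL2_piD scalerDl.
Qed.

HB.instance Definition _ := GRing.Zmodule_isLmodule.Build R[i] cL2
  cL2_scalerA cL2_scale1r cL2_scalerDr cL2_scalerDl.

Definition cL2fun_norm (f : cL2fun) : R := fine (N2 (normc \o val f)).

Lemma cL2fun_norm_fin (f : cL2fun) :
  ((cL2fun_norm f)%:E = N2 (normc \o val f))%E.
Proof.
rewrite fineK// ge0_fin_numE ?Lnorm_ge0//.
by case: f => f /=; rewrite inE => -[].
Qed.

Lemma cL2fun_normP (f : cL2fun) (a : R[i]) (g : cL2fun) :
  cL2fun_norm (a *: f + g) <= normc a * cL2fun_norm f + cL2fun_norm g.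
Proof.
rewrite -lee_fin EFinD EFinM !cL2fun_norm_fin.
have Lf := valP f; have Lg := valP g; rewrite !inE in Lf Lg.
by have [_ _ +] := cL2_lin a Lf Lg; rewrite linearP.
Qed.

Lemma cL2fun_norm_ae (f g : cL2fun) :
  {ae mu, forall x, val f x = val g x} -> cL2fun_norm f = cL2fun_norm g.
Proof.
move=> fg; congr fine; rewrite unlock /Lnorm; congr (_ `^ _)%E.
have mp (h : cL2fun) :
    measurable_fun setT (fun x => (`|(EFin \o (normc \o val h)) x| `^ 2)%E).
  have [mr mi _] : cL2_set (val h) by have := valP h; rewrite inE.
  rewrite (_ : (fun _ => _) = EFin \o (fun x => `|normc (val h x)| `^ 2))//.
  apply/measurable_EFinP.
  apply: (@measurableT_comp _ _ _ _ _ _ (@powR R ^~ 2)).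
    exact: measurable_powR.
  by apply: measurableT_comp => //; exact: measurable_normc.
apply: ge0_ae_eq_integral => //.
- by move=> x _; exact: poweR_ge0.
- by move=> x _; exact: poweR_ge0.
by apply: filterS fg => x /= -> _.
Qed.

Definition cL2_norm (u : cL2) : R[i] := (cL2fun_norm (repr u))%:C.

Lemma cL2_norm_pi (f : cL2fun) : cL2_norm (cL2_pi f) = (cL2fun_norm f)%:C.
Proof. by congr _%:C; apply: cL2fun_norm_ae; exact: repr_cL2_pi. Qed.

Lemma cL2fun_norm_eq0 (f : cL2fun) :
  cL2fun_norm f = 0 -> {ae mu, forall x, val f x = 0}.
Proof.
move=> f0; have := cL2fun_norm_fin f; rewrite f0 => /esym.
have [mr mi _] : cL2_set (val f) by have := valP f; rewrite inE.
move/Lnorm_eq0_eq0 => H.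
have : ae_eq mu setT (EFin \o (normc \o val f)) (cst 0%E).
  by apply: H => //; apply/measurable_EFinP; exact: measurable_normc.
by apply: filterS => x /(_ I) /= [] /Normc.eq0_normc.
Qed.

Fact cL2_ler_normD u v : cL2_norm (u + v) <= cL2_norm u + cL2_norm v.
Proof.
rewrite -[u]cL2_piK -[v]cL2_piK -cL2_piD !cL2_norm_pi -rmorphD lecR.
by have := cL2fun_normP (repr u) 1 (repr v); rewrite scale1r Normc.normc1 mul1r.
Qed.

Lemma cL2fun_norm0 : cL2fun_norm 0 = 0.
Proof.
rewrite /cL2fun_norm (_ : _ \o _ = cst 0%E) ?Lnorm0//.
by apply/funext => x /=; rewrite expr0n/= addr0 sqrtr0.
Qed.

Lemma cL2fun_normZ_le a (f : cL2fun) :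
  cL2fun_norm (a *: f) <= normc a * cL2fun_norm f.
Proof.
by have := cL2fun_normP f a 0; rewrite addr0 cL2fun_norm0 addr0.
Qed.

Fact cL2_normrZ (a : R[i]) u : cL2_norm (a *: u) = `|a| * cL2_norm u.
Proof.
rewrite -[u]cL2_piK [_ *: _]cL2_piZ !cL2_norm_pi.
set f := repr u.
have -> : `|a| = (normc a)%:C by [].
rewrite -rmorphM; congr _%:C; apply/le_anti; rewrite cL2fun_normZ_le/=.
have [->|a0] := eqVneq a 0.
  by rewrite scale0r cL2fun_norm0 Normc.normc0 mul0r.
have na0 : 0 < normc a.
  by rewrite lt_neqAle normc_ge0 andbT eq_sym; apply: contra a0 => /eqP/Normc.eq0_normc ->.
rewrite -ler_pdivlMl// -Normc.normcV.
by have := cL2fun_normZ_le a^-1 (a *: f); rewrite scalerA mulVf// scale1r.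
Qed.

Fact cL2_normr0_eq0 u : cL2_norm u = 0 -> u = 0.
Proof.
rewrite -[u]cL2_piK cL2_norm_pi => -[] /cL2fun_norm_eq0 u0.
have -> : (0 : cL2) = cL2_pi 0 by rewrite /cL2_pi !piE.
by apply/cL2_piP; apply: filterS u0.
Qed.

HB.instance Definition _ := Lmodule_isNormed.Build R[i] cL2
  cL2_ler_normD cL2_normrZ cL2_normr0_eq0.

(* The class of [f], with value [0] when [f] is not square-integrable. *)
Definition cL2_class (f : T -> R[i]) : cL2 := cL2_pi (insubd 0 f).

End cL2.

Definition compact_operator (F : numFieldType) (V W : normedModType F)
    (f : V -> W) : Prop :=
  linear f /\ forall B : set V, bounded_set B -> precompact (f @` B).

Section zeta_operator.
Variable R : realType.
Implicit Types (K : set nat) (A T : R).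

Definition set_count K (x : R) : nat :=
  #|` fset_set (K `&` [set n | n%:R <= x])|%fset.

Definition cexp (z : R[i]) : R[i] :=
  (expR (Re z))%:C * (cos (Im z) +i* sin (Im z)).

Definition nat_cpow (n : nat) (z : R[i]) : R[i] := cexp (z * (ln n%:R)%:C).

(* [R[i]^o] is [R[i]] with the topology given by the modulus. *)
Definition zeta_set K (s : R[i]) : R[i] :=
  limn (fun N => \sum_(1 <= n < N | n \in K) nat_cpow n (- s) : R[i]^o).

Definition cintegral d (X : measurableType d)
    (mu : {measure set X -> \bar R}) (D : set X) (f : X -> R[i]) : R[i] :=
  (\int[mu]_(x in D) Re (f x)) +i* (\int[mu]_(x in D) Im (f x)).

Definition sym_itv T : set R := [set` `]- T, T[].

Lemma measurable_sym_itv T : measurable (sym_itv T).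
Proof. exact: measurable_itv. Qed.

(* [L^2(I)] is encoded by functions on the whole line, identified when they
   agree almost everywhere on [I]; their values outside [I] are irrelevant. *)
Local Notation muI T := (mrestr (@lebesgue_measure R) (measurable_sym_itv T)).
Local Notation L2I T := (cL2 (muI T)).

Definition Zreg_fun K T (delta : R) (g : R -> R[i]) (t : R) : R[i] :=
  (\1_(sym_itv T) t / pi)%:C *
  cintegral (@lebesgue_measure R) (sym_itv T)
    (fun tau => g tau * (Re (zeta_set K ((1 + delta) +i* (t - tau))))%:C).

Definition Zop K T (g : L2I T) : L2I T :=
  lim (cL2_class (muI T) (Zreg_fun K T delta (\val (repr g)))
         @[delta --> 0^'+]).

Definition Psi_op K A T (g : L2I T) : L2I T := Zop K g - A%:C *: g.

End zeta_operator.

Arguments Zop {R} K T g.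
Arguments Psi_op {R} K A T g.

(* Submission.v *)
Require Import Defs.
From mathcomp Require Import all_boot all_order all_algebra complex.
From mathcomp Require Import all_classical all_reals all_analysis.
From mathcomp Require Import ring lra measurable_realfun.
Import Order.TTheory GRing.Theory Num.Theory.
Import numFieldNormedType.Exports.

(** The argument replaces the operator by a quadratic form in the variable
    [y = ln x], where the density of [K] becomes
    [dens K y = set_count K (expR y) / expR y] and [dev = dens K - A] has to be
    compared with [0].

    By Abel summation, the real part of the zeta function at [1 + d + i v] is a
    Laplace transform of [dens K] with the symbol
    [(1 + d) * cos (v * y) + v * sin (v * y)] ([Re_zeta]). When [d] tends to [0],
    the operators with these kernels converge strongly ([weak_limit],
    [symbol_limit]). The constant [A] contributes [A] times the identity, by
    Parseval's identity on the half line ([parseval]), plus a rank one form.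
    Hence [Psi_op K A T] has an explicit weak form ([Psi_weak]): a rank one
    part, plus an integral over [y >= 0] of [dev y] against products of
    the cosine and sine transforms of [g t] and [t * g t]. It is linear and
    symmetric.

    If [dev] tends to [0], this form is dominated by the energy of [u] weighted
    by [dev] ([Psi_apriori]). High frequencies contribute little, since there
    [dev] is small and the energy is bounded (Bessel's inequality). Low
    frequencies are governed by finitely many samples, since transforms of
    functions on a bounded interval are Lipschitz. So bounded sets
    have precompact images ([Psi_compact]).

    Conversely, let the operators be compact. Characters of frequency [w] tend
    weakly to [0], by the Riemann-Lebesgue lemma, so their images tend
    strongly to [0] and the quadratic form at these characters tends to [0]
    ([Psi_ev_cvg0]). This form is essentially the convolution of [dev] with
    [fej - fej'], where [fej] is the Fejer kernel of the interval. Averaging in [w]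
    with the weight [expR] removes the derivative ([averaging]), so the Fejer
    averages of [dev] tend to [0] for every [T] ([dev_fej_cvg0]). Since counting
    functions are nondecreasing, [dev] cannot decrease faster than linearly
    ([dev_slow]), and for [T] large the Fejer kernel is concentrated enough to
    conclude that [dev] tends to [0] ([dev_cvg0]). *)

Set Implicit Arguments.
Unset Strict Implicit.
Unset Printing Implicit Defensive.

Local Open Scope classical_set_scope.
Local Open Scope ring_scope.

(** * Integrability, and Fubini for bounded kernels *)

Section intg.
Context d (T : measurableType d) (R : realType).
Variable mu : {measure set T -> \bar R}.
Implicit Types (D : set T) (f g : T -> R).
Local Notation intg D f := (mu.-integrable D (EFin \o f)).

Lemma intg_measurable D f : intg D f -> measurable_fun D f.
Proof. by move=> /measurable_int /measurable_EFinP. Qed.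

Lemma intg_le D f g : measurable D -> intg D g -> measurable_fun D f ->
  (forall x, D x -> `|f x| <= g x) -> intg D f.
Proof.
move=> mD intf mg gB.
apply: (@le_integrable _ _ _ mu D mD _ (EFin \o g)) => //.
  exact/measurable_EFinP.
by move=> x Dx /=; rewrite lee_fin (le_trans (gB _ Dx))// ler_norm.
Qed.

Lemma intgZ D f (k : R) : measurable D -> intg D f -> intg D (fun x => k * f x).
Proof.
by move=> mD intf; have := integrableZl mD k intf; apply: eq_integrable.
Qed.

Lemma intgD D f g : measurable D -> intg D f -> intg D g ->
  intg D (fun x => f x + g x).
Proof.
by move=> mD intf ig; have := integrableD mD intf ig; apply: eq_integrable.
Qed.

Lemma intgB D f g : measurable D -> intg D f -> intg D g ->
  intg D (fun x => f x - g x).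
Proof.
by move=> mD intf ig; have := integrableB mD intf ig; apply: eq_integrable.
Qed.

Lemma intgM_bounded D f g (B : R) : measurable D -> intg D f ->
  measurable_fun D g -> (forall x, D x -> `|g x| <= B) ->
  intg D (fun x => f x * g x).
Proof.
move=> mD intf mg gB; have mf := intg_measurable intf.
apply: (intg_le (g := fun x => B * `|f x|)) => //.
- by apply: intgZ => //; exact: integrable_norm.
- exact: measurable_funM.
- by move=> x Dx; rewrite normrM mulrC ler_wpM2r// gB.
Qed.

Lemma intg_mkcond D f : measurable D -> intg D f <-> intg setT (f \_ D).
Proof.
move=> mD; rewrite integrable_mkcond//.
by rewrite restrict_EFin.
Qed.

End intg.

Section swap0.
Context d1 d2 (T1 : measurableType d1) (T2 : measurableType d2) (R : realType).
Variable m1 : {sigma_finite_measure set T1 -> \bar R}.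
Variable m2 : {sigma_finite_measure set T2 -> \bar R}.
Local Notation intg1 D f := (m1.-integrable D (EFin \o f)).
Local Notation intg2 D f := (m2.-integrable D (EFin \o f)).

(** The kernel has to be bounded only where both factors are nonzero: the
    product is then dominated everywhere by a tensor product. *)
Lemma swapT0 (f : T1 -> R) (w : T2 -> R) (c : T1 -> T2 -> R) (B : R) :
  intg1 setT f -> intg2 setT w ->
  measurable_fun setT (fun p : T1 * T2 => c p.1 p.2) ->
  (forall x y, f x != 0 -> w y != 0 -> `|c x y| <= B) ->
  intg1 setT (fun x => f x * \int[m2]_y (w y * c x y)) /\
  \int[m1]_x (f x * \int[m2]_y (w y * c x y)) =
  \int[m2]_y (w y * \int[m1]_x (f x * c x y)).
Proof.
move=> intf intw mc cB.
have mf := intg_measurable intf; have mw := intg_measurable intw.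
pose F (p : T1 * T2) : \bar R := (f p.1 * w p.2 * c p.1 p.2)%:E.
have mF : measurable_fun setT F.
  apply/measurable_EFinP/measurable_funM => //; apply: measurable_funM.
    exact: measurableT_comp.
  exact: measurableT_comp.
have wcint x : f x != 0 -> intg2 setT (fun y => w y * c x y).
  move=> fx; apply: (intg_le (g := fun y => B * `|w y|)) => //.
  - by apply: intgZ => //; exact: integrable_norm.
  - apply: measurable_funM => //.
    exact: (@measurableT_comp _ _ _ _ _ _ (fun p : T1 * T2 => c p.1 p.2) _ (pair x)).
  - move=> y _; rewrite normrM mulrC; have [->|wy] := eqVneq (w y) 0.
      by rewrite normr0 !mulr0.
    by rewrite ler_wpM2r// cB.
have fcint y : w y != 0 -> intg1 setT (fun x => f x * c x y).
  move=> wy; apply: (intg_le (g := fun x => B * `|f x|)) => //.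
  - by apply: intgZ => //; exact: integrable_norm.
  - apply: measurable_funM => //.
    exact: (@measurableT_comp _ _ _ _ _ _ (fun p : T1 * T2 => c p.1 p.2) _ (pair ^~ y)).
  - move=> x _; rewrite normrM mulrC; have [->|fx] := eqVneq (f x) 0.
      by rewrite normr0 !mulr0.
    by rewrite ler_wpM2r// cB.
have FE x : (\int[m2]_y F (x, y))%E = (f x * \int[m2]_y (w y * c x y))%:E.
  have [fx|fx] := eqVneq (f x) 0.
    rewrite fx mul0r integral0_eq// => y _ /=.
    by rewrite /F /= fx !mul0r.
  rewrite -RintegralZl//; last exact: wcint.
  rewrite /Rintegral fineK; last first.
    apply: integrable_fin_num => //; apply: (@intgZ _ _ _ _ _ _ (f x)) => //.
    exact: wcint.
  by apply: eq_integral => y _; rewrite /F/= mulrA.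
have GE y : (\int[m1]_x F (x, y))%E = (w y * \int[m1]_x (f x * c x y))%:E.
  have [wy|wy] := eqVneq (w y) 0.
    rewrite wy mul0r integral0_eq// => x _ /=.
    by rewrite /F /= wy mulr0 mul0r.
  rewrite -RintegralZl//; last exact: fcint.
  rewrite /Rintegral fineK; last first.
    apply: integrable_fin_num => //; apply: (@intgZ _ _ _ _ _ _ (w y)) => //.
    exact: fcint.
  by apply: eq_integral => x _; rewrite /F/= mulrCA mulrA.
have iF : (m1 \x m2)%E.-integrable setT F.
  apply/integrable12ltyP => //.
  apply: (@le_lt_trans _ _ (\int[m1]_x ((`|B| * \int[m2]_y `|w y|) * `|f x|)%:E)%E).
    apply: ge0_le_integral => //.
    - by move=> x _; exact: integral_ge0.
    - apply: (measurable_fun_fubini_tonelli_F (abse \o F)) => //.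
      exact: measurableT_comp.
    - by move=> x /=.
    - by apply/measurable_EFinP/measurable_funM => //; exact: measurableT_comp.
    move=> x _.
    rewrite (_ : (_ * _)%:E = \int[m2]_y (`|B| * `|f x| * `|w y|)%:E)%E; last first.
      rewrite [RHS](_ : _ = (\int[m2]_y (`|B| * `|f x| * `|w y|))%:E).
        rewrite RintegralZl//; last exact: integrable_norm.
        by congr _%:E; ring.
      rewrite /Rintegral fineK//; apply: integrable_fin_num => //.
      by apply: (@intgZ _ _ _ _ _ _ (`|B| * `|f x|)) => //; exact: integrable_norm.
    apply: ge0_le_integral => //.
    - apply: measurableT_comp => //.
      exact: (@measurableT_comp _ _ _ _ _ _ F _ (pair x)).
    - apply/measurable_EFinP/measurable_funM => //; exact: measurableT_comp.
    move=> y _; rewrite /F/= lee_fin !normrM.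
    have [->|fx] := eqVneq (f x) 0; first by rewrite normr0 !(mul0r,mulr0).
    have [->|wy] := eqVneq (w y) 0; first by rewrite normr0 !(mul0r,mulr0).
    rewrite mulrC -mulrA ler_wpM2r// ?mulr_ge0//.
    by rewrite (le_trans (cB _ _ fx wy))// ler_norm.
  have : intg1 setT (fun x => (`|B| * \int[m2]_y `|w y|) * `|f x|).
    by apply: intgZ => //; exact: integrable_norm.
  move=> /integrableP[_]; apply: le_lt_trans.
  by under [leRHS]eq_integral do rewrite gee0_abs ?lee_fin ?mulr_ge0 ?Rintegral_ge0//.
split.
- have := integrable_fubini_F iF; apply: eq_integrable => // x _.
  exact: FE.
- have := Fubini iF.
  under eq_integral do rewrite FE.
  under [in RHS]eq_integral do rewrite GE.
  by rewrite /Rintegral => ->.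
Qed.

End swap0.

Section swap.
Context d1 d2 (T1 : measurableType d1) (T2 : measurableType d2) (R : realType).
Variable m1 : {sigma_finite_measure set T1 -> \bar R}.
Variable m2 : {sigma_finite_measure set T2 -> \bar R}.
Local Notation intg1 D f := (m1.-integrable D (EFin \o f)).
Local Notation intg2 D f := (m2.-integrable D (EFin \o f)).

(** The factors [f] and [w] carry the integrability and the kernel is only
    bounded, so that the product is dominated on the product space. *)
Lemma swap (D1 : set T1) (D2 : set T2) (f : T1 -> R) (w : T2 -> R) (c : T1 -> T2 -> R) (B : R) :
  measurable D1 -> measurable D2 -> intg1 D1 f -> intg2 D2 w ->
  measurable_fun setT (fun p : T1 * T2 => c p.1 p.2) ->
  (forall x y, D1 x -> D2 y -> `|c x y| <= B) ->
  [/\ intg1 D1 (fun x => f x * \int[m2]_(y in D2) (w y * c x y)),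
      intg2 D2 (fun y => w y * \int[m1]_(x in D1) (f x * c x y)) &
      \int[m1]_(x in D1) (f x * \int[m2]_(y in D2) (w y * c x y)) =
      \int[m2]_(y in D2) (w y * \int[m1]_(x in D1) (f x * c x y))].
Proof.
move=> mD1 mD2 /(intg_mkcond _ _ mD1) if1 /(intg_mkcond _ _ mD2) iw mc cB.
have patchM (X : Type) D (h k : X -> R) : ((fun x => h x * k x) \_ D) =
    (fun x => (h \_ D) x * k x).
  by apply/funext => x; rewrite !patchE; case: ifP => // _; rewrite mul0r.
have patch_n0 (X : Type) D (h : X -> R) x : (h \_ D) x != 0 -> D x.
  by rewrite patchE; case: ifPn => [/set_mem//|]; rewrite eqxx.
have [] := swapT0 if1 iw mc (B := B).
  by move=> x y hx hy; apply: cB; [exact: patch_n0 hx|exact: patch_n0 hy].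
have [] := @swapT0 _ _ _ _ _ m2 m1 _ _ (fun y x => c x y) B iw if1.
- exact: (measurableT_comp mc (@measurable_swap _ _ _ _)).
- by move=> y x hy hx; apply: cB; [exact: patch_n0 hx|exact: patch_n0 hy].
move=> + _.
have E1 : (fun x => \int[m2]_(y in D2) (w y * c x y)) =
    (fun x => \int[m2]_y ((w \_ D2) y * c x y)).
  by apply/funext => x; rewrite Rintegral_mkcond patchM.
have E2 : (fun y => \int[m1]_(x in D1) (f x * c x y)) =
    (fun y => \int[m1]_x ((f \_ D1) x * c x y)).
  by apply/funext => x; rewrite Rintegral_mkcond patchM.
move=> i2 i1 e; split.
- apply/(intg_mkcond _ _ mD1); rewrite patchM.
  by apply: eq_integrable i1 => // x _ /=; rewrite -(congr1 (@^~ x) E1).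
- apply/(intg_mkcond _ _ mD2); rewrite patchM.
  by apply: eq_integrable i2 => // x _ /=; rewrite -(congr1 (@^~ x) E2).
- rewrite Rintegral_mkcond patchM [RHS]Rintegral_mkcond patchM.
  transitivity (\int[m1]_x ((f \_ D1) x * \int[m2]_y ((w \_ D2) y * c x y))).
    by apply: eq_Rintegral => x _; rewrite -(congr1 (@^~ x) E1).
  by rewrite e; apply: eq_Rintegral => x _; rewrite -(congr1 (@^~ x) E2).
Qed.

End swap.

(** * Dominated convergence and the fundamental theorem of calculus *)

Notation intg D f := (lebesgue_measure.-integrable D (EFin \o f)).

Section dominated.
Context d (T : measurableType d) (R : realType).
Variable mu : {measure set T -> \bar R}.
Local Notation intg D f := (mu.-integrable D (EFin \o f)).

Lemma Rdominated_cvg (D : set T) (u : nat -> T -> R) (f g : T -> R) :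
  measurable D -> (forall n, measurable_fun D (u n)) ->
  (forall x, D x -> u n x @[n --> \oo] --> f x) -> intg D g ->
  (forall n x, D x -> `|u n x| <= g x) ->
  intg D f /\ \int[mu]_(x in D) u n x @[n --> \oo] --> \int[mu]_(x in D) f x.
Proof.
move=> mD mu_ uf intgg ug.
have mf : measurable_fun D f by exact: measurable_fun_cvg uf.
have [] := @dominated_convergence _ _ _ mu _ mD (fun n => EFin \o u n) (EFin \o f)
  (EFin \o g).
- by move=> n; exact/measurable_EFinP.
- exact/measurable_EFinP.
- by apply: aeW => x Dx; apply: cvg_EFin; [exact: nearW|exact: uf].
- exact: intgg.
- by apply: aeW => x n Dx /=; rewrite lee_fin ug.
move=> intf _ cv; split=> //.
apply: fine_cvg; rewrite fineK//.
exact: integrable_fin_num.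
Qed.
End dominated.

Section ftc.
Context (R : realType).
Notation mu := (@lebesgue_measure R).
Implicit Types (f F : R -> R).

Lemma continuous_is_derive F f : (forall x : R, is_derive x 1 F (f x)) -> continuous F.
Proof.
by move=> dF x; apply/differentiable_continuous/derivable1_diffP; have [] := dF x.
Qed.

Lemma Rintegral_FTC F f (a b : R) : a <= b ->
  (forall x : R, is_derive x 1 F (f x)) -> continuous f ->
  \int[mu]_(x in `[a, b]) f x = F b - F a.
Proof.
move=> ab dF cf; move: ab; rewrite le_eqVlt => /predU1P[->|ab].
  by rewrite subrr set_itv1 Rintegral_set1.
rewrite /Rintegral (@continuous_FTC2 _ f F)//.
- exact: continuous_subspaceT.
- split; first by move=> x _; have [] := dF x.
  + by apply: cvg_at_right_filter; exact: continuous_is_derive dF _.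
  + by apply: cvg_at_left_filter; exact: continuous_is_derive dF _.
- by move=> x _; rewrite derive1E; have [_ ->] := dF x.
Qed.

Lemma Rintegral_FTCy F f (a l : R) :
  (forall x : R, is_derive x 1 F (f x)) -> continuous f ->
  F x @[x --> +oo] --> l -> intg `[a, +oo[ f ->
  \int[mu]_(x in `[a, +oo[) f x = l - F a.
Proof.
move=> dF cf Fl intf.
have mf : measurable_fun setT f by exact: continuous_measurable_fun.
have mI : measurable (`[a, +oo[ : set R) by exact: measurable_itv.
pose fn (n : nat) := f \_ `[a, a + n%:R].
have [_ cv] : intg `[a, +oo[ f /\
    \int[mu]_(x in `[a, +oo[) fn n x @[n --> \oo] --> \int[mu]_(x in `[a, +oo[) f x.
  apply: (@Rdominated_cvg _ _ _ mu _ _ _ (fun x => `|f x|)) => //.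
  - move=> n; apply: measurable_funTS.
    by apply/(measurable_restrictT _ (measurable_itv _)); exact: measurable_funTS.
  - move=> x; rewrite /= in_itv/= andbT => ax; apply: cvg_near_cst.
    near=> n; rewrite /fn patchE mem_set//= in_itv/= ax/= -lerBlDl.
    by near: n; exact: nbhs_infty_ger.
  - exact: integrable_norm.
  - by move=> n x _; rewrite /fn patchE; case: ifP => //; rewrite normr0.
have E n : \int[mu]_(x in `[a, +oo[) fn n x = F (a + n%:R) - F a.
  rewrite -(@Rintegral_FTC F f) ?lerDl// -Rintegral_mkcondr; congr Rintegral.
  apply/seteqP; split => x /=; first by case.
  by rewrite !in_itv/= andbT => /andP[->].
rewrite -(cvg_lim (@Rhausdorff R) cv); apply/cvg_lim => //.
rewrite (_ : (fun n => _) = (fun n => F (a + n%:R) - F a)); last exact/funext.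
apply: cvgB; last exact: cvg_cst.
move/cvg_pinftyP : Fl; apply.
apply/cvgryPge => A; near=> n; rewrite -lerBlDl.
by near: n; exact: nbhs_infty_ger.
Unshelve. all: by end_near. Qed.

End ftc.

Section expN.
Context (R : realType).
Notation mu := (@lebesgue_measure R).

Lemma cvg_expRN (k : R) : 0 < k -> expR (- (k * x)) @[x --> +oo] --> (0 : R).
Proof.
move=> k0; apply: (cvg_comp (fun x => k * x) (fun x => expR (- x))).
  exact: gt0_cvgMry.
exact: cvgr_expR.
Qed.

Lemma expRN_integral (k a : R) : 0 < k ->
  intg `[a, +oo[ (fun y => expR (- (k * y))) /\
  \int[mu]_(y in `[a, +oo[) expR (- (k * y)) = expR (- (k * a)) / k.
Proof.
move=> k0.
have dF (x : R) : is_derive x 1 (fun x : R => - (expR (- (k * x)) / k)) (expR (- (k * x))).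
  by apply: is_derive_eq; rewrite /GRing.scale/=; field; rewrite gt_eqF.
have cf : continuous (fun x : R => expR (- (k * x))).
  have dE (x : R) : is_derive x 1 (fun x : R => expR (- (k * x))) (- k * expR (- (k * x))).
    by apply: is_derive_eq; rewrite /GRing.scale/=; ring.
  exact: continuous_is_derive dE.
have e : (\int[mu]_(y in `[a, +oo[) (expR (- (k * y)))%:E = 0%:E - (- (expR (- (k * a)) / k))%:E)%E.
  apply: (@ge0_continuous_FTC2y _ (fun y => expR (- (k * y)))
      (fun x => - (expR (- (k * x)) / k))).
  - by move=> x _; exact: expR_ge0.
  - exact: continuous_subspaceT.
  - rewrite -oppr0; apply: cvgN; rewrite -[X in _ --> X](mul0r k^-1).
    apply: cvgM; [exact: cvg_expRN|exact: cvg_cst].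
  - by move=> x _; have [] := dF x.
  - by apply: cvg_at_right_filter; exact: continuous_is_derive dF _.
  - by move=> x _; rewrite derive1E; have [_ ->] := dF x.
split; last by rewrite /Rintegral e -EFinB/= sub0r opprK.
apply/integrableP; split.
  by apply/measurable_EFinP/measurable_funTS; exact: continuous_measurable_fun.
under eq_integral do rewrite gee0_abs ?lee_fin ?expR_ge0//.
by rewrite e -EFinB ltry.
Qed.

End expN.

(** * Square-integrable functions on an interval and their transforms *)

Section trig.
Context (R : realType).
Implicit Types (x y : R) (F f : R -> R).

Lemma derive_lipschitz F f (B : R) : (forall x : R, is_derive x 1 F (f x)) ->
  (forall x, `|f x| <= B) -> forall x y, `|F x - F y| <= B * `|x - y|.
Proof.
move=> dF fB; have hw x y : x < y -> `|F x - F y| <= B * `|x - y|.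
  move=> xy; have [|c _ Fc] := MVT xy (fun x _ => dF x).
    exact/continuous_subspaceT/continuous_is_derive.
  by rewrite distrC Fc [in leRHS]distrC normrM ler_wpM2r.
move=> x y; have [xy|yx|->] := ltgtP x y; first exact: hw.
- by rewrite distrC [in leRHS]distrC; exact: hw.
- by rewrite !subrr normr0 mulr0.
Qed.

Lemma cos_lipschitz x y : `|cos x - cos y| <= `|x - y|.
Proof.
rewrite -[leRHS]mul1r; apply: (@derive_lipschitz _ (fun x => - sin x)) => {}x.
by rewrite normrN sin_max.
Qed.

Lemma sin_lipschitz x y : `|sin x - sin y| <= `|x - y|.
Proof.
rewrite -[leRHS]mul1r; apply: (@derive_lipschitz _ (@cos R)) => {}x.
by rewrite cos_max.
Qed.

Lemma measurable_cos : measurable_fun setT (@cos R).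
Proof. by apply: continuous_measurable_fun; exact: continuous_cos. Qed.

Lemma measurable_sin : measurable_fun setT (@sin R).
Proof. by apply: continuous_measurable_fun; exact: continuous_sin. Qed.

End trig.

Section L2.
Context (R : realType) (T : R).
Hypothesis T0 : 0 < T.
Notation mu := (@lebesgue_measure R).
Local Notation I := (sym_itv T).
Implicit Types (g h c : R -> R).

Lemma measurable_I : measurable (I : set (measurableTypeR R)).
Proof. exact: measurable_itv. Qed.
Hint Resolve measurable_I : core.

Lemma mu_I : mu I = (2 * T)%:E.
Proof.
rewrite lebesgue_measure_itv/= lte_fin gtrN// -EFinB.
by congr EFin; lra.
Qed.

Lemma in_I t : I t -> `|t| <= T.
Proof. by rewrite /sym_itv/= in_itv/= ler_norml => /andP[/ltW-> /ltW]. Qed.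

Lemma intg_cst (k : R) : intg I (fun=> k).
Proof.
apply/integrableP; split; first exact/measurable_EFinP/measurable_cst.
by under eq_integral do rewrite /=; rewrite integral_cst// [X in (_ * X)%E]mu_I ltry.
Qed.

Definition L2 g := measurable_fun setT g /\ intg I (fun t => g t ^+ 2).
Definition sqn g := \int[mu]_(t in I) g t ^+ 2.
Definition ip g h := \int[mu]_(t in I) (g t * h t).

Lemma L2_mul g h : L2 g -> L2 h -> intg I (fun t => g t * h t).
Proof.
move=> [mg ig] [mh ih].
apply: (@intg_le _ _ _ mu _ _ (fun t => g t ^+ 2 + h t ^+ 2)) => //.
- exact: intgD.
- by apply: measurable_funTS; exact: measurable_funM.
- move=> t _; rewrite normrM -(real_normK (num_real (g t))) -(real_normK (num_real (h t))).
  by have := sqr_ge0 (`|g t| - `|h t|); nra.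
Qed.

Lemma L2_cst k : L2 (fun=> k).
Proof. by split => //; exact: intg_cst. Qed.

Lemma L2_int g : L2 g -> intg I g.
Proof.
move=> Lg; have := L2_mul Lg (L2_cst 1); apply: eq_integrable => // t _ /=.
by rewrite mulr1.
Qed.

Lemma L2_bounded c g (B : R) : measurable_fun setT c ->
  (forall t, I t -> `|c t| <= B) -> L2 g -> L2 (fun t => c t * g t).
Proof.
move=> mc cB [mg ig]; split; first exact: measurable_funM.
under eq_fun do rewrite exprMn mulrC.
apply: (@intgM_bounded _ _ _ mu _ _ _ (B ^+ 2)) => //.
  by apply: measurable_funTS; exact: measurable_funX.
by move=> t It; rewrite normrX lerXn2r ?nnegrE ?cB// (le_trans _ (cB _ It)).
Qed.

Lemma L2D g h : L2 g -> L2 h -> L2 (fun t => g t + h t).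
Proof.
move=> Lg Lh; have igh := L2_mul Lg Lh; case: Lg Lh => [mg ig] [mh ih].
split; first exact: measurable_funD.
have := intgD measurable_I (intgD measurable_I ig (intgZ 2 measurable_I igh)) ih.
by apply: eq_integrable => // t _ /=; congr EFin; ring.
Qed.

Lemma L2Z k g : L2 g -> L2 (fun t => k * g t).
Proof. by apply: (@L2_bounded _ _ `|k|). Qed.

Lemma L2B g h : L2 g -> L2 h -> L2 (fun t => g t - h t).
Proof.
move=> Lg /(L2Z (-1)) Lh; have := L2D Lg Lh.
by congr L2; apply/funext => t; rewrite mulN1r.
Qed.

Definition mulX g := fun t => t * g t.

Lemma L2X g : L2 g -> L2 (mulX g).
Proof. by apply: L2_bounded in_I. Qed.

Lemma sqnX g : L2 g -> sqn (mulX g) <= T ^+ 2 * sqn g.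
Proof.
move=> Lg; rewrite -RintegralZl//; last by case: Lg.
apply: le_Rintegral => //; first by case: (L2X Lg).
  by apply: intgZ => //; case: Lg.
move=> t /in_I tT; rewrite exprMn ler_wpM2r ?sqr_ge0//.
by rewrite -(real_normK (num_real t)) lerXn2r ?nnegrE// ltW.
Qed.

Lemma sqn_ge0 g : 0 <= sqn g.
Proof. by apply: Rintegral_ge0 => t _; exact: sqr_ge0. Qed.

Definition ctr g y := \int[mu]_(t in I) (g t * cos (t * y)).
Definition str g y := \int[mu]_(t in I) (g t * sin (t * y)).

Lemma measurable_cosM y : measurable_fun setT (fun t : R => cos (t * y)).
Proof. by apply: (measurableT_comp (@measurable_cos R)); exact: measurable_funM. Qed.

Lemma measurable_sinM y : measurable_fun setT (fun t : R => sin (t * y)).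
Proof. by apply: (measurableT_comp (@measurable_sin R)); exact: measurable_funM. Qed.

Lemma intg_cosM g y : L2 g -> intg I (fun t => g t * cos (t * y)).
Proof.
move=> /L2_int ig; apply: (@intgM_bounded _ _ _ mu _ _ _ (1)) => //.
  by apply: measurable_funTS; exact: measurable_cosM.
by move=> t _; exact: cos_max.
Qed.

Lemma intg_sinM g y : L2 g -> intg I (fun t => g t * sin (t * y)).
Proof.
move=> /L2_int ig; apply: (@intgM_bounded _ _ _ mu _ _ _ (1)) => //.
  by apply: measurable_funTS; exact: measurable_sinM.
by move=> t _; exact: sin_max.
Qed.

Definition nrm1 g := \int[mu]_(t in I) `|g t|.

Lemma le_Rintegral_norm (D : set (measurableTypeR R)) (f g : R -> R) :
  measurable D -> intg D f -> intg D g ->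
  (forall x, D x -> `|f x| <= g x) ->
  `|\int[mu]_(x in D) f x| <= \int[mu]_(x in D) g x.
Proof.
move=> mD iff_ ig fg; apply: (le_trans (le_normr_Rintegral _ _)) => //.
by apply: le_Rintegral => //; exact: integrable_norm.
Qed.

(** Functions supported in a bounded interval have Lipschitz transforms; this is
    what makes finitely many samples of a transform informative. *)
Lemma ctr_lipschitz g x y : L2 g -> `|ctr g x - ctr g y| <= T * nrm1 g * `|x - y|.
Proof.
move=> Lg; rewrite -RintegralB//; [|exact: intg_cosM..].
rewrite mulrAC -RintegralZl//; last by apply: integrable_norm => //; exact: L2_int.
apply: le_Rintegral_norm => //.
- by apply: intgB => //; exact: intg_cosM.
- by apply: intgZ => //; apply: integrable_norm => //; exact: L2_int.
move=> t /in_I tT; rewrite -mulrBr normrM mulrC ler_wpM2r//.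
by rewrite (le_trans (cos_lipschitz _ _))// -mulrBr normrM ler_wpM2r.
Qed.

Lemma str_lipschitz g x y : L2 g -> `|str g x - str g y| <= T * nrm1 g * `|x - y|.
Proof.
move=> Lg; rewrite -RintegralB//; [|exact: intg_sinM..].
rewrite mulrAC -RintegralZl//; last by apply: integrable_norm => //; exact: L2_int.
apply: le_Rintegral_norm => //.
- by apply: intgB => //; exact: intg_sinM.
- by apply: intgZ => //; apply: integrable_norm => //; exact: L2_int.
move=> t /in_I tT; rewrite -mulrBr normrM mulrC ler_wpM2r//.
by rewrite (le_trans (sin_lipschitz _ _))// -mulrBr normrM ler_wpM2r.
Qed.

Lemma ctr_bounded g y : L2 g -> `|ctr g y| <= nrm1 g.
Proof.
move=> Lg; apply: le_Rintegral_norm => //; first exact: intg_cosM.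
  by apply: integrable_norm => //; exact: L2_int.
by move=> t _; rewrite normrM ler_piMr// cos_max.
Qed.

Lemma str_bounded g y : L2 g -> `|str g y| <= nrm1 g.
Proof.
move=> Lg; apply: le_Rintegral_norm => //; first exact: intg_sinM.
  by apply: integrable_norm => //; exact: L2_int.
by move=> t _; rewrite normrM ler_piMr// sin_max.
Qed.

End L2.

(** * Convolution with cosine and sine integrals *)

Lemma lipschitz_continuous (R : realType) (F : R -> R) (C : R) :
  (forall x y, `|F x - F y| <= C * `|x - y|) -> continuous F.
Proof.
move=> FC x; apply/cvgrPdist_lt => e e0; near=> y.
have C1 : 0 < `|C| + 1 by rewrite ltr_wpDl.
rewrite (le_lt_trans (FC x y))// (@le_lt_trans _ _ ((`|C| + 1) * `|x - y|))//.
  by rewrite ler_wpM2r// (le_trans (ler_norm _))// lerDl.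
rewrite mulrC -ltr_pdivlMr//.
by near: y; apply/nbhs_ballP; exists (e / (`|C| + 1)) => //=; rewrite divr_gt0.
Unshelve. all: by end_near. Qed.

Section form.
Context (R : realType) (T : R).
Hypothesis T0 : 0 < T.
Notation mu := (@lebesgue_measure R).
Local Notation I := (sym_itv T).
Local Notation H := (`[0, +oo[%classic : set (measurableTypeR R)).
Implicit Types (g h w u : R -> R).
Local Notation L2 := (L2 T).
Local Notation ctr := (ctr T).
Local Notation str := (str T).
Hint Extern 0 (measurable (sym_itv _)) => (apply: measurable_I) : core.

Lemma measurable_H : measurable H.
Proof. exact: measurable_itv. Qed.
Hint Resolve measurable_H : core.

Definition cosint u t := \int[mu]_(y in H) (u y * cos (t * y)).
Definition sinint u t := \int[mu]_(y in H) (u y * sin (t * y)).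

Lemma intg_cosH u t : intg H u -> intg H (fun y => u y * cos (t * y)).
Proof.
move=> iu; apply: (@intgM_bounded _ _ _ mu _ _ _ 1) => //.
  apply: measurable_funTS; apply: (measurableT_comp (@measurable_cos R)).
  exact: measurable_funM.
by move=> y _; exact: cos_max.
Qed.

Lemma intg_sinH u t : intg H u -> intg H (fun y => u y * sin (t * y)).
Proof.
move=> iu; apply: (@intgM_bounded _ _ _ mu _ _ _ 1) => //.
  apply: measurable_funTS; apply: (measurableT_comp (@measurable_sin R)).
  exact: measurable_funM.
by move=> y _; exact: sin_max.
Qed.

Lemma cosint_continuous u : intg H u -> continuous (cosint u).
Proof.
move=> iu t; apply/continuous_withinNx/cvgr_dnbhsP => s [_ st].
apply: (@Rdominated_cvg _ _ _ mu H _ _ (fun y => `|u y|) _ _ _ _ _).2 => //.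
- by move=> n; apply: (@intg_measurable _ _ _ mu); exact: intg_cosH.
- move=> y _; apply: cvgM; first exact: cvg_cst.
  apply: (continuous_cvg _ (@continuous_cos R _)).
  by apply: cvgM => //; exact: cvg_cst.
- exact: integrable_norm.
- by move=> n y _; rewrite normrM ler_piMr// cos_max.
Qed.

Lemma sinint_continuous u : intg H u -> continuous (sinint u).
Proof.
move=> iu t; apply/continuous_withinNx/cvgr_dnbhsP => s [_ st].
apply: (@Rdominated_cvg _ _ _ mu H _ _ (fun y => `|u y|) _ _ _ _ _).2 => //.
- by move=> n; apply: (@intg_measurable _ _ _ mu); exact: intg_sinH.
- move=> y _; apply: cvgM; first exact: cvg_cst.
  apply: (continuous_cvg _ (@continuous_sin R _)).
  by apply: cvgM => //; exact: cvg_cst.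
- exact: integrable_norm.
- by move=> n y _; rewrite normrM ler_piMr// sin_max.
Qed.

Lemma cosint_bounded u t : intg H u -> `|cosint u t| <= \int[mu]_(y in H) `|u y|.
Proof.
move=> iu; apply: le_Rintegral_norm => //; first exact: intg_cosH.
  exact: integrable_norm.
by move=> y _; rewrite normrM ler_piMr// cos_max.
Qed.

Lemma sinint_bounded u t : intg H u -> `|sinint u t| <= \int[mu]_(y in H) `|u y|.
Proof.
move=> iu; apply: le_Rintegral_norm => //; first exact: intg_sinH.
  exact: integrable_norm.
by move=> y _; rewrite normrM ler_piMr// sin_max.
Qed.

Lemma L2_cosint u : intg H u -> L2 (cosint u).
Proof.
move=> iu; have := L2_bounded _ (fun t _ => cosint_bounded t iu) (L2_cst T0 1).
have E : (fun t => cosint u t * 1) = cosint u by apply/funext => t; rewrite mulr1.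
rewrite E; apply.
by apply: continuous_measurable_fun; exact: cosint_continuous.
Qed.

Lemma L2_sinint u : intg H u -> L2 (sinint u).
Proof.
move=> iu; have := L2_bounded _ (fun t _ => sinint_bounded t iu) (L2_cst T0 1).
have E : (fun t => sinint u t * 1) = sinint u by apply/funext => t; rewrite mulr1.
rewrite E; apply.
by apply: continuous_measurable_fun; exact: sinint_continuous.
Qed.

Lemma measurable_shift_kernel (k : R -> R) (t : R) : measurable_fun setT k ->
  measurable_fun setT (fun p : measurableTypeR R * measurableTypeR R =>
    k ((t - p.1) * p.2)).
Proof.
move=> mk; apply: (measurableT_comp mk); apply: measurable_funM => //.
by apply: measurable_funB.
Qed.

Lemma measurable_kernel (k : R -> R) : measurable_fun setT k ->
  measurable_fun setT (fun p : measurableTypeR R * measurableTypeR R =>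
    k (p.1 * p.2)).
Proof. by move=> mk; apply: (measurableT_comp mk); exact: measurable_funM. Qed.

Lemma measurable_ctr g : L2 g -> measurable_fun setT (ctr g).
Proof.
move=> Lg; apply: continuous_measurable_fun.
by apply: lipschitz_continuous => x y; exact: ctr_lipschitz.
Qed.

Lemma measurable_str g : L2 g -> measurable_fun setT (str g).
Proof.
move=> Lg; apply: continuous_measurable_fun.
by apply: lipschitz_continuous => x y; exact: str_lipschitz.
Qed.

Lemma intg_ctrM w g : intg H w -> L2 g -> intg H (fun y => w y * ctr g y).
Proof.
move=> iw Lg; apply: (@intgM_bounded _ _ _ mu _ _ _ (nrm1 T g)) => //.
  by apply: measurable_funTS; exact: measurable_ctr.
by move=> y _; exact: ctr_bounded.
Qed.

Lemma intg_strM w g : intg H w -> L2 g -> intg H (fun y => w y * str g y).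
Proof.
move=> iw Lg; apply: (@intgM_bounded _ _ _ mu _ _ _ (nrm1 T g)) => //.
  by apply: measurable_funTS; exact: measurable_str.
by move=> y _; exact: str_bounded.
Qed.

Lemma ip_cosint g u : L2 g -> intg H u ->
  \int[mu]_(t in I) (g t * cosint u t) = \int[mu]_(y in H) (u y * ctr g y).
Proof.
move=> /(L2_int T0) ig iu.
by have [_ _ ->] := swap (measurable_I T) measurable_H ig iu
  (measurable_kernel (@measurable_cos R)) (fun x y _ _ => cos_max (x * y)).
Qed.

Lemma ip_sinint g u : L2 g -> intg H u ->
  \int[mu]_(t in I) (g t * sinint u t) = \int[mu]_(y in H) (u y * str g y).
Proof.
move=> /(L2_int T0) ig iu.
by have [_ _ ->] := swap (measurable_I T) measurable_H ig iu
  (measurable_kernel (@measurable_sin R)) (fun x y _ _ => sin_max (x * y)).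
Qed.

Lemma intg_cosZ g y k : L2 g -> intg I (fun t => g t * cos (t * y) * k).
Proof.
move=> Lg; have := intgZ k (measurable_I T) (intg_cosM T0 y Lg).
by apply: eq_integrable => // s _ /=; rewrite mulrC.
Qed.

Lemma intg_sinZ g y k : L2 g -> intg I (fun t => g t * sin (t * y) * k).
Proof.
move=> Lg; have := intgZ k (measurable_I T) (intg_sinM T0 y Lg).
by apply: eq_integrable => // s _ /=; rewrite mulrC.
Qed.

Lemma conv_cosint g w t : L2 g -> intg H w ->
  \int[mu]_(s in I) (g s * cosint w (t - s)) =
  cosint (fun y => w y * ctr g y) t + sinint (fun y => w y * str g y) t.
Proof.
move=> Lg iw; have ig := L2_int T0 Lg.
have [_ _ ->] := swap (measurable_I T) measurable_H ig iw
  (measurable_shift_kernel t (@measurable_cos R)) (fun s y _ _ => cos_max ((t - s) * y)).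
rewrite /cosint /sinint -RintegralD//; last 2 first.
- by apply: intg_cosH; exact: intg_ctrM.
- by apply: intg_sinH; exact: intg_strM.
apply: eq_Rintegral => y _.
rewrite -!mulrA -mulrDr; congr (_ * _).
rewrite -RintegralZr//; last exact: intg_cosM.
rewrite -RintegralZr//; last exact: intg_sinM.
rewrite -RintegralD//; [|exact: intg_cosZ|exact: intg_sinZ].
apply: eq_Rintegral => s _.
by rewrite mulrBl cosB; ring.
Qed.

Lemma conv_sinint g w t : L2 g -> intg H w ->
  \int[mu]_(s in I) (g s * sinint w (t - s)) =
  sinint (fun y => w y * ctr g y) t - cosint (fun y => w y * str g y) t.
Proof.
move=> Lg iw; have ig := L2_int T0 Lg.
have [_ _ ->] := swap (measurable_I T) measurable_H ig iw
  (measurable_shift_kernel t (@measurable_sin R)) (fun s y _ _ => sin_max ((t - s) * y)).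
rewrite /cosint /sinint -RintegralB//; last 2 first.
- by apply: intg_sinH; exact: intg_ctrM.
- by apply: intg_cosH; exact: intg_strM.
apply: eq_Rintegral => y _.
rewrite -!mulrA -mulrBr; congr (_ * _).
rewrite -RintegralZr//; last exact: intg_cosM.
rewrite -RintegralZr//; last exact: intg_sinM.
rewrite -RintegralB//; [|exact: intg_cosZ|exact: intg_sinZ].
apply: eq_Rintegral => s _.
by rewrite mulrBl sinB; ring.
Qed.

End form.

(** * The Poisson kernel and Bessel's inequality *)

Section poisson.
Context (R : realType) (T : R).
Hypothesis T0 : 0 < T.
Notation mu := (@lebesgue_measure R).
Local Notation I := (sym_itv T).
Local Notation H := (`[0, +oo[%classic : set (measurableTypeR R)).
Implicit Types (g h w u : R -> R).
Local Notation L2 := (L2 T).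
Local Notation ctr := (ctr T).
Local Notation str := (str T).
Hint Extern 0 (measurable (sym_itv _)) => (apply: measurable_I) : core.
Hint Extern 0 (measurable `[0, +oo[) => (apply: measurable_H) : core.

Lemma cvg_expRNM (d C : R) (k : R -> R) : 0 < d -> (forall x, `|k x| <= C) ->
  expR (- (d * x)) * k x @[x --> +oo] --> (0 : R).
Proof.
move=> d0 kC; apply/cvgr0Pnorm_lt => e e0.
have := @cvg_expRN R d d0; move=> /cvgr0Pnorm_lt => /(_ (e / (`|C| + 1))).
have C1 : 0 < `|C| + 1 by rewrite ltr_wpDl.
move=> /(_ (divr_gt0 e0 C1)); apply: filterS => x.
rewrite ltr_pdivlMr// normrM; apply: le_lt_trans.
by rewrite ler_wpM2l// (le_trans (kC x))// (le_trans (ler_norm _))// lerDl.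
Qed.

(** The Poisson kernel is the transform of the damping factor. *)
Lemma poissonE (d v : R) : 0 < d ->
  cosint (fun y => expR (- (d * y))) v = d / (d ^+ 2 + v ^+ 2).
Proof.
move=> d0; have dv0 : d ^+ 2 + v ^+ 2 != 0.
  by rewrite gt_eqF// ltr_wpDr ?sqr_ge0// exprn_gt0.
pose F y := expR (- (d * y)) * ((v * sin (v * y) - d * cos (v * y)) / (d ^+ 2 + v ^+ 2)).
have dF (x : R) : is_derive x 1 F (expR (- (d * x)) * cos (v * x)).
  by apply: is_derive_eq; rewrite /GRing.scale/=; field.
rewrite /cosint (@Rintegral_FTCy _ F _ 0 0 dF).
- by rewrite /F !mulr0 oppr0 expR0 cos0 sin0; field.
- have dE (x : R) : is_derive x 1 (fun x : R => expR (- (d * x)) * cos (v * x))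
      (- expR (- (d * x)) * (d * cos (v * x) + v * sin (v * x))).
    by apply: is_derive_eq; rewrite /GRing.scale/=; ring.
  exact: continuous_is_derive dE.
- apply: (@cvg_expRNM _ ((`|v| + `|d|) / (d ^+ 2 + v ^+ 2))) => // x.
  rewrite normrM [X in _ * X]ger0_norm ?invr_ge0 ?addr_ge0 ?sqr_ge0//.
  rewrite ler_wpM2r ?invr_ge0 ?addr_ge0 ?sqr_ge0//.
  rewrite (le_trans (ler_normB _ _))// !normrM lerD// ler_piMr//.
    exact: sin_max.
  exact: cos_max.
- by apply: intg_cosH; have [] := expRN_integral 0 d0.
Qed.

Lemma poisson_ge0 (d v : R) : 0 < d -> 0 <= d / (d ^+ 2 + v ^+ 2).
Proof. by move=> d0; rewrite divr_ge0 ?addr_ge0 ?sqr_ge0// ltW. Qed.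

Lemma poisson_le (d v : R) : 0 < d -> d / (d ^+ 2 + v ^+ 2) <= d^-1.
Proof.
move=> d0; rewrite ler_pdivrMr ?ltr_wpDr ?sqr_ge0 ?exprn_gt0//.
by rewrite mulrDr expr2 mulKf ?gt_eqF// lerDl mulr_ge0 ?sqr_ge0// invr_ge0 ltW.
Qed.

Lemma poisson_continuous (d : R) : 0 < d -> continuous (fun v : R => d / (d ^+ 2 + v ^+ 2)).
Proof.
move=> d0 v; apply: cvgM; first exact: cvg_cst.
apply: cvgV; first by rewrite gt_eqF// ltr_wpDr ?sqr_ge0// exprn_gt0.
by apply: cvgD; [exact: cvg_cst|exact: exprn_continuous].
Qed.

Lemma poisson_integral (d s a b : R) : 0 < d -> a <= b ->
  \int[mu]_(t in `]a, b[) (d / (d ^+ 2 + (t - s) ^+ 2)) =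
  atan ((b - s) / d) - atan ((a - s) / d).
Proof.
move=> d0 ab.
have cf : continuous (fun t : R => d / (d ^+ 2 + (t - s) ^+ 2)).
  move=> t; apply: (@continuous_comp _ _ _ (fun t => t - s) (fun v => d / (d ^+ 2 + v ^+ 2))).
    by apply: cvgB; [exact: cvg_id|exact: cvg_cst].
  exact: poisson_continuous.
have ic : intg `[a, b] (fun t : R => d / (d ^+ 2 + (t - s) ^+ 2)).
  by apply: continuous_compact_integrable; [exact: segment_compact|exact: continuous_subspaceT].
rewrite Rintegral_itv_obnd_cbnd; last first.
  by apply: integrableS ic => //; exact: subset_itv_oo_cc.
rewrite Rintegral_itv_bndo_bndc; last first.
  by apply: integrableS ic => //; exact: subset_itv_co_cc.
have dF (x : R) : is_derive x 1 (fun t => atan ((t - s) / d)) (d / (d ^+ 2 + (x - s) ^+ 2)).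
  apply: is_derive_eq; rewrite /GRing.scale/=; field.
  by rewrite !gt_eqF// ltr_wpDr ?sqr_ge0// exprn_gt0.
by rewrite (Rintegral_FTC _ dF).
Qed.

Lemma poisson_integral_le (d s a b : R) : 0 < d -> a <= b ->
  \int[mu]_(t in `]a, b[) (d / (d ^+ 2 + (t - s) ^+ 2)) <= pi.
Proof.
move=> d0 ab; rewrite poisson_integral//.
have := atan_ltpi2 ((b - s) / d); have := atan_gtNpi2 ((a - s) / d); lra.
Qed.

Definition pow_spec g y := ctr g y ^+ 2 + str g y ^+ 2.

Lemma poisson_form (d : R) g h : 0 < d -> L2 g -> L2 h ->
  \int[mu]_(t in I) (h t * \int[mu]_(s in I) (g s * (d / (d ^+ 2 + (t - s) ^+ 2)))) =
  \int[mu]_(y in H) (expR (- (d * y)) * (ctr g y * ctr h y + str g y * str h y)).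
Proof.
move=> d0 Lg Lh.
pose E y := expR (- (d * y)).
have iE : intg H E by have [] := expRN_integral 0 d0.
have ic : intg H (fun y => E y * ctr g y) by exact: intg_ctrM.
have is_ : intg H (fun y => E y * str g y) by exact: intg_strM.
transitivity (\int[mu]_(t in I) (h t * cosint (fun y => E y * ctr g y) t +
    h t * sinint (fun y => E y * str g y) t)).
  apply: eq_Rintegral => t _; rewrite -mulrDr -conv_cosint//.
  by congr (_ * _); apply: eq_Rintegral => s _; rewrite poissonE.
rewrite RintegralD//; last 2 first.
- by apply: L2_mul => //; exact: L2_cosint.
- by apply: L2_mul => //; exact: L2_sinint.
rewrite ip_cosint// ip_sinint// -RintegralD//; last 2 first.
- exact: intg_ctrM.
- exact: intg_strM.
by apply: eq_Rintegral => y _; rewrite /E; ring.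
Qed.

Let P (d : R) t s := d / (d ^+ 2 + (t - s) ^+ 2).

Let measurable_P d t : 0 < d -> measurable_fun setT (P d t).
Proof.
move=> d0; apply: (measurableT_comp (continuous_measurable_fun (poisson_continuous d0))).
exact: measurable_funB.
Qed.

Let measurable_P2 d : 0 < d ->
  measurable_fun setT (fun p : measurableTypeR R * measurableTypeR R => P d p.1 p.2).
Proof.
move=> d0; apply: (measurableT_comp (continuous_measurable_fun (poisson_continuous d0))).
exact: measurable_funB.
Qed.

Let P_bounded d t s : 0 < d -> `|P d t s| <= d^-1.
Proof. by move=> d0; rewrite ger0_norm ?poisson_ge0// poisson_le. Qed.

Let intg_P d f t : 0 < d -> intg I f -> intg I (fun s => f s * P d t s).
Proof.
move=> d0 i; apply: (@intgM_bounded _ _ _ mu _ _ _ d^-1) => //.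
  by apply: measurable_funTS; exact: measurable_P.
by move=> s _; exact: P_bounded.
Qed.

Let PC d t s : P d t s = P d s t.
Proof. by rewrite /P -[in RHS]opprB sqrrN. Qed.

Let quad_pointwise (d : R) g t : 0 < d -> L2 g ->
  g t * \int[mu]_(s in I) (g s * P d t s) <=
  2^-1 * (g t ^+ 2 * \int[mu]_(s in I) (1 * P d t s) +
          1 * \int[mu]_(s in I) (g s ^+ 2 * P d s t)).
Proof.
move=> d0 Lg; have ig := L2_int T0 Lg; have ig2 := Lg.2.
have i1 := intg_P t d0 (intg_cst T0 1).
have i2 : intg I (fun s => g s ^+ 2 * P d s t).
  by have := intg_P t d0 ig2; apply: eq_integrable => // s _ /=; rewrite PC.
have i0 := intg_P t d0 ig.
have mI := measurable_I T.
rewrite mul1r -(RintegralZl (g t) mI i0) -(RintegralZl (g t ^+ 2) mI i1).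
rewrite -(RintegralD mI (intgZ (g t ^+ 2) mI i1) i2).
rewrite -(RintegralZl _ mI (intgD mI (intgZ (g t ^+ 2) mI i1) i2)).
apply: (le_Rintegral mI (intgZ (g t) mI i0)
  (intgZ _ mI (intgD mI (intgZ (g t ^+ 2) mI i1) i2))).
move=> s _; rewrite (PC d s t).
move: (P d t s) (poisson_ge0 (t - s) d0 : 0 <= P d t s) (g t) (g s) => p p0 a b.
rewrite -subr_ge0 (_ : _ - _ = 2^-1 * (p * (a - b) ^+ 2)); last by field.
by apply: mulr_ge0; [rewrite invr_ge0|apply: mulr_ge0 => //; exact: sqr_ge0].
Qed.

Let P_mass_le d t : 0 < d -> \int[mu]_(s in I) (1 * P d t s) <= pi.
Proof.
move=> d0; rewrite [leLHS](_ : _ = \int[mu]_(s in I) (d / (d ^+ 2 + (s - t) ^+ 2))).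
  by apply: poisson_integral_le => //; rewrite ge0_cp// ltW.
by apply: eq_Rintegral => s _; rewrite mul1r PC.
Qed.

(** Schur's test: the Poisson kernel is symmetric, nonnegative and has total
    mass at most [pi]. *)
Lemma poisson_quad_le (d : R) g : 0 < d -> L2 g ->
  \int[mu]_(t in I) (g t * \int[mu]_(s in I) (g s * P d t s)) <= pi * sqn T g.
Proof.
move=> d0 Lg; have ig := L2_int T0 Lg; have ig2 := Lg.2.
have mI := measurable_I T.
have [i1 _ _] := swap mI mI ig ig (measurable_P2 d0) (fun x y _ _ => P_bounded x y d0).
have [i2 i3 e] := swap mI mI ig2 (intg_cst T0 1) (measurable_P2 d0)
  (fun x y _ _ => P_bounded x y d0).
have pw t : I t -> _ := fun _ => quad_pointwise t d0 Lg.
pose A t := g t ^+ 2 * \int[mu]_(s in I) (1 * P d t s).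
have A_le t : I t -> A t <= pi * g t ^+ 2.
  by move=> _; rewrite [leRHS]mulrC; exact: (ler_wpM2l (sqr_ge0 _) (P_mass_le t d0)).
rewrite -/A in i2 e pw A_le.
apply: (le_trans (le_Rintegral mI i1 (intgZ 2^-1 mI (intgD mI i2 i3)) pw)).
rewrite (RintegralZl 2^-1 mI (intgD mI i2 i3)) (RintegralD mI i2 i3) -e.
have := le_Rintegral mI i2 (intgZ pi mI ig2) A_le.
by rewrite (RintegralZl pi mI ig2) -[X in X + X]mul1r -mulrDl mulrA mulVf ?mul1r.
Qed.

(** Bessel's inequality on the half line; the factor [pi] is optimal. *)
Lemma bessel g : L2 g -> intg H (pow_spec g) /\
  \int[mu]_(y in H) pow_spec g y <= pi * sqn T g.
Proof.
move=> Lg.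
pose d (n : nat) : R := n.+1%:R^-1.
have d0 n : 0 < d n by rewrite invr_gt0.
have mp : measurable_fun setT (pow_spec g).
  apply: measurable_funD; apply: measurable_funX.
    exact: measurable_ctr.
  exact: measurable_str.
have p0 y : 0 <= pow_spec g y by rewrite addr_ge0// sqr_ge0.
have dn0 : d n @[n --> \oo] --> (0 : R) by exact: cvg_harmonic.
pose u n y := expR (- (d n * y)) * pow_spec g y.
have mu_ n : measurable_fun setT (u n).
  apply: measurable_funM => //; apply: continuous_measurable_fun => x.
  have dE (z : R) : is_derive z 1 (fun x : R => expR (- (d n * x))) (- d n * expR (- (d n * z))).
    by apply: is_derive_eq; rewrite /GRing.scale/=; ring.
  exact: continuous_is_derive dE _.
have iu n : intg H (u n).
  have [iE _] := expRN_integral 0 (d0 n).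
  have := intgD (@measurable_H R) (intg_ctrM T0 (intg_ctrM T0 iE Lg) Lg)
    (intg_strM T0 (intg_strM T0 iE Lg) Lg).
  by apply: eq_integrable => // y _ /=; congr EFin; rewrite /u /pow_spec; ring.
have ule n : \int[mu]_(y in H) u n y <= pi * sqn T g.
  apply: le_trans (poisson_quad_le (d0 n) Lg).
  rewrite poisson_form// le_eqVlt; apply/orP; left; apply/eqP.
have le : (\int[mu]_(y in H) (pow_spec g y)%:E <= (pi * sqn T g)%:E)%E.
  have e : (\int[mu]_(y in H) (pow_spec g y)%:E =
      limn (fun n => \int[mu]_(y in H) (u n y)%:E))%E.
    rewrite -monotone_convergence//.
    - apply: eq_integral => y _; apply/esym/cvg_lim => //.
      apply: cvg_EFin; first exact: nearW.
      rewrite -[X in _ --> X]mul1r; apply: cvgM; last exact: cvg_cst.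
      rewrite -[X in _ --> X]expR0; apply: continuous_cvg; first exact: continuous_expR.
      rewrite -oppr0; apply: cvgN; rewrite -[X in _ --> X](mul0r y).
      exact: (cvgM dn0 (cvg_cst (y : R))).
    - by move=> n; apply/measurable_EFinP; apply: measurable_funTS; exact: mu_.
    - by move=> n y _; rewrite lee_fin mulr_ge0// expR_ge0.
    - move=> y; rewrite /= in_itv/= andbT => y0 m n mn.
      rewrite lee_fin ler_wpM2r// ler_expR lerN2 ler_wpM2r//.
      by rewrite lef_pV2 ?posrE// ler_nat.
  rewrite e; apply: lime_le.
    apply: ereal_nondecreasing_is_cvgn => m n mn; apply: ge0_le_integral => //.
    - by move=> y _; rewrite lee_fin mulr_ge0// expR_ge0.
    - by apply/measurable_EFinP; apply: measurable_funTS; exact: mu_.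
    - by apply/measurable_EFinP; apply: measurable_funTS; exact: mu_.
    - move=> y; rewrite /= in_itv/= andbT => y0.
      rewrite lee_fin ler_wpM2r// ler_expR lerN2 ler_wpM2r//.
      by rewrite lef_pV2 ?posrE// ler_nat.
  apply: nearW => n; rewrite -(fineK (integrable_fin_num _ (iu n)))//.
  by rewrite lee_fin ule.
have ip : intg H (pow_spec g).
  apply/integrableP; split; first by apply/measurable_EFinP; apply: measurable_funTS.
  under eq_integral do rewrite gee0_abs ?lee_fin//.
  exact: (le_lt_trans le (ltry _)).
by split => //; rewrite -lee_fin /Rintegral fineK// integrable_fin_num.
Qed.

End poisson.

(** * The Riesz-Fischer theorem *)

Section riesz_fischer.
Context (R : realType) (T : R).
Hypothesis T0 : 0 < T.
Notation mu := (@lebesgue_measure R).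
Local Notation I := (sym_itv T).
Implicit Types (g h : R -> R).
Local Notation L2 := (L2 T).
Local Notation sqn := (sqn T).
Hint Extern 0 (measurable (sym_itv _)) => (apply: measurable_I) : core.

(** A pointwise limit of functions within [e] of [g] is within [e] of [g]. *)
Lemma fatou_sqn (v : nat -> R -> R) g h (e : R) : (forall k, L2 (v k)) -> L2 g ->
  measurable_fun setT h ->
  {ae mu, forall t, I t -> v k t @[k --> \oo] --> h t} ->
  (\forall k \near \oo, sqn (fun t => g t - v k t) <= e) ->
  L2 h /\ sqn (fun t => g t - h t) <= e.
Proof.
move=> Lv Lg mh vh le_e.
have mI := measurable_I T.
have mgv k : measurable_fun I (fun t => ((g t - v k t) ^+ 2)%:E).
  apply/measurable_EFinP; apply: measurable_funTS; apply: measurable_funX.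
  by apply: measurable_funB; [case: Lg|case: (Lv k)].
have mgh : measurable_fun I (fun t => ((g t - h t) ^+ 2)%:E).
  apply/measurable_EFinP; apply: measurable_funTS; apply: measurable_funX.
  by apply: measurable_funB => //; case: Lg.
have : (\int[mu]_(t in I) ((g t - h t) ^+ 2)%:E <= e%:E)%E.
  rewrite (@ae_eq_integral _ _ _ mu _ (fun t => limn_einf (fun k => ((g t - v k t) ^+ 2)%:E)))//.
  - apply: (le_trans (@fatou _ _ _ mu _ mI (fun k t => ((g t - v k t) ^+ 2)%:E) mgv _)).
      by move=> n t _; rewrite lee_fin sqr_ge0.
    have gvE k : (\int[mu]_(t in I) ((g t - v k t) ^+ 2)%:E =
        (sqn (fun t => g t - v k t))%:E)%E.
      rewrite /Submission.sqn /Rintegral fineK//; apply: integrable_fin_num => //.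
      by have [] := L2B Lg (Lv k).
    rewrite limn_einf_lim; apply: lime_le; first exact: is_cvg_einfs.
    apply: filterS le_e => k ek; apply: (@le_trans _ _ (sqn (fun t => g t - v k t))%:E).
      by apply: ereal_inf_lbound; exists k => //=; exact: gvE.
    by rewrite lee_fin.
  - rewrite /limn_einf; apply: measurableT_comp => //.
    apply: measurable_fun_limn_esup => k.
    exact: (measurableT_comp (@oppe_measurable R setT) (mgv k)).
  - move: vh; apply: filterS; first exact: (ae_filter_ringOfSetsType mu).
    move=> t vh It /=.
    rewrite (cvg_limn_einf_sup (l := ((g t - h t) ^+ 2)%:E))//.
    apply: cvg_EFin; first exact: nearW.
    have cv : g t - v k t @[k --> \oo] --> g t - h t.
      by apply: cvgB; [exact: cvg_cst|exact: vh].
    exact: (cvgM cv cv).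
move=> le1.
have Lgh : L2 (fun t => g t - h t).
  split; first by apply: measurable_funB => //; case: Lg.
  apply/integrableP; split => //.
  under eq_integral do rewrite gee0_abs ?lee_fin ?sqr_ge0//.
  exact: le_lt_trans le1 (ltry _).
split.
  have := L2B Lg Lgh; congr L2.
  by apply/funext => t; rewrite opprB addrC subrK.
rewrite -lee_fin /Submission.sqn /Rintegral fineK//.
by apply: integrable_fin_num => //; case: Lgh.
Qed.

Lemma summable_increments_cvg (v : nat -> R) :
  (\sum_(0 <= k <oo) (`|v k.+1 - v k|%:E) < +oo)%E -> cvgn v.
Proof.
move=> S.
have vE : v = (fun k => v 0%N + series (telescope v) k).
  by apply/funext => k; rewrite eq_sum_telescope.
rewrite vE; apply: is_cvgD; first exact: is_cvg_cst.
apply: normed_cvg; apply: nondecreasing_is_cvgn.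
  apply/nondecreasing_seqP => n; rewrite /normed_series_of !seriesEnat /=.
  by rewrite big_nat_recr//= lerDl.
exists (fine (\sum_(0 <= k <oo) (`|v k.+1 - v k|%:E))%E) => _ [n _ <-].
rewrite -lee_fin fineK.
  rewrite /normed_series_of seriesEnat /= -sumEFin; apply: nneseries_lim_ge => k _ _.
  by rewrite lee_fin.
by rewrite ge0_fin_numE// nneseries_ge0// => k _ _; rewrite lee_fin.
Qed.

Let increment_pointwise (k : nat) (x : R) :
  x <= 2^-1 * (2^-1 ^+ k + 2 ^+ k * x ^+ 2).
Proof.
have p2 : 0 < (2 ^+ k : R) by rewrite exprn_gt0.
rewrite exprVn -subr_ge0.
rewrite (_ : _ - _ = 2^-1 * (2 ^+ k * (x - (2 ^+ k)^-1) ^+ 2)); last by field; rewrite gt_eqF.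
by rewrite mulr_ge0 ?invr_ge0// mulr_ge0 ?sqr_ge0// ltW.
Qed.

Let increment_arith (k : nat) (x : R) : x <= 4^-1 ^+ k ->
  2^-1 * (2^-1 ^+ k * (2 * T) + 2 ^+ k * x) <= (2 * T + 1) / (2 ^ k.+1)%:R.
Proof.
have p2 : 0 < (2 ^+ k : R) by rewrite exprn_gt0.
rewrite natrX exprS !exprVn (_ : 4 = 2 * 2 :> R); last by ring.
rewrite exprMn => xk.
rewrite -subr_ge0 (_ : _ - _ = 2^-1 * (2 ^+ k * ((2 ^+ k * 2 ^+ k)^-1 - x))).
  by rewrite mulr_ge0 ?invr_ge0// mulr_ge0 ?subr_ge0// ltW.
by field; rewrite gt_eqF.
Qed.

(** A subsequence with summable increments converges almost everywhere, and
    Fatou's lemma turns the Cauchy condition into convergence to its limit. *)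
Lemma riesz_fischer (u : nat -> R -> R) : (forall n, L2 (u n)) ->
  (forall e, 0 < e -> \forall N \near \oo, forall m n, (N <= m)%N -> (N <= n)%N ->
     sqn (fun t => u m t - u n t) <= e) ->
  exists2 h, L2 h & sqn (fun t => u n t - h t) @[n --> \oo] --> (0 : R).
Proof.
move=> Lu cu.
have mI := measurable_I T.
have /choice[phi0 phi0P] (k : nat) : exists N, forall m n, (N <= m)%N -> (N <= n)%N ->
    sqn (fun t => u m t - u n t) <= 4^-1 ^+ k.
  have e0 : 0 < 4^-1 ^+ k :> R by rewrite exprn_gt0// invr_gt0.
  have [N _ /(_ N (leqnn _)) h] := cu _ e0.
  by exists N.
pose phi k := (\sum_(i < k.+1) phi0 i)%N.
have phi0_le j k : (k <= j)%N -> (phi0 k <= phi j)%N.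
  move=> kj; rewrite /phi (bigD1 (Ordinal (kj : (k < j.+1)%N)))//=.
  exact: leq_addr.
pose v k := u (phi k).
have Lv k : L2 (v k) by exact: Lu.
have Ld k : L2 (fun t => v k.+1 t - v k t) by exact: (L2B (Lv k.+1) (Lv k)).
pose d k t := `|v k.+1 t - v k t|.
have md k : measurable_fun setT (d k).
  by apply: measurableT_comp => //; case: (Ld k).
have idk k : intg I (d k) by apply: integrable_norm => //; exact: (L2_int T0).
have d_le k : \int[mu]_(t in I) d k t <= (2 * T + 1) / (2 ^ k.+1)%:R.
  have p2 : 0 < (2 ^+ k : R) by rewrite exprn_gt0.
  apply: (@le_trans _ _ (\int[mu]_(t in I) (2^-1 * (2^-1 ^+ k + 2 ^+ k * (v k.+1 t - v k t) ^+ 2)))).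
    apply: le_Rintegral => //.
      apply: intgZ => //; apply: intgD => //; first exact: intg_cst.
      by apply: intgZ => //; case: (Ld k).
    move=> t _; rewrite /d -(real_normK (num_real (v k.+1 t - v k t))).
    exact: increment_pointwise.
  have iq := (Ld k).2; have i1 := intg_cst T0 (2^-1 ^+ k).
  rewrite (RintegralZl _ mI (intgD mI i1 (intgZ _ mI iq))).
  rewrite (RintegralD mI i1 (intgZ _ mI iq)) (RintegralZl _ mI iq) Rintegral_cst//.
  rewrite [X in _ * fine X](mu_I T0) /=.
  have := phi0P k (phi k.+1) (phi k) (phi0_le _ _ (leqnSn k)) (phi0_le _ _ (leqnn k)).
  rewrite -/(v k.+1) -/(v k) -[Rintegral _ _ _]/(sqn (fun t => v k.+1 t - v k t)).
  exact: increment_arith.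
pose S t := (\sum_(0 <= k <oo) (d k t)%:E)%E.
have S_lt : (\int[mu]_(t in I) S t < +oo)%E.
  rewrite integral_nneseries//; last 2 first.
  - by move=> k; apply/measurable_EFinP; apply: measurable_funTS; exact: md.
  - by move=> k t _; rewrite lee_fin normr_ge0.
  apply: (@le_lt_trans _ _ (\sum_(0 <= k <oo) ((2 * T + 1) / (2 ^ k.+1)%:R)%:E)%E).
    apply: lee_nneseries => k _.
      by move=> _; apply: integral_ge0 => t _; rewrite lee_fin normr_ge0.
    rewrite -(fineK (integrable_fin_num _ (idk k)))//.
    by rewrite lee_fin; exact: d_le.
  have T1 : 0 <= 2 * T + 1 by rewrite addr_ge0// mulr_ge0// ltW.
  exact: (le_lt_trans (epsilon_trick0 xpredT T1) (ltry _)).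
have mS : measurable_fun I S.
  apply: ge0_emeasurable_sum => [k t _ _|k _]; first by rewrite lee_fin normr_ge0.
  by apply/measurable_EFinP; apply: measurable_funTS; exact: md.
have iS : mu.-integrable I S.
  apply/integrableP; split => //; apply: le_lt_trans S_lt.
  rewrite le_eqVlt; apply/orP; left; apply/eqP; apply: eq_integral => t _.
  by rewrite gee0_abs// nneseries_ge0// => k _ _; rewrite lee_fin normr_ge0.
pose h t := fine (limn_esup (fun k => (v k t)%:E)).
have vh : {ae mu, forall t, I t -> v k t @[k --> \oo] --> h t}.
  have := integrable_ae mI iS.
  apply: filterS => t St It.
  have /cvg_ex[l vl] : cvgn (v ^~ t).
    apply: summable_increments_cvg.
    move: (St It); rewrite ge0_fin_numE// nneseries_ge0// => k _ _.
    by rewrite lee_fin normr_ge0.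
  have vl' : (v k t)%:E @[k --> \oo] --> l%:E by apply: cvg_EFin => //; exact: nearW.
  by rewrite /h (cvg_limn_einf_sup vl').2.
have mh : measurable_fun setT h.
  apply: measurableT_comp => //.
  by apply: measurable_fun_limn_esup => k; apply/measurable_EFinP; case: (Lv k).
have key n k : (phi0 k <= n)%N -> L2 h /\ sqn (fun t => u n t - h t) <= 4^-1 ^+ k.
  move=> kn; apply: (fatou_sqn Lv (Lu n) mh vh).
  exists k => // j /= kj; apply: phi0P => //; exact: phi0_le.
exists h; first by have [] := key (phi0 0%N) 0%N (leqnn _).
apply/cvgr0Pnorm_le => e e0.
have : (4^-1 : R) ^+ k @[k --> \oo] --> (0 : R).
  by apply: cvg_expr; rewrite ger0_norm ?invr_ge0//; lra.
move=> /cvgr0Pnorm_le/(_ e e0)[k _ /(_ k (leqnn _)) ke].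
exists (phi0 k) => // n /= kn; rewrite ger0_norm ?sqn_ge0//.
have [_] := key n k kn; move=> /le_trans; apply.
by apply: le_trans ke; exact: ler_norm.
Qed.

End riesz_fischer.

(** * The bilinear form of a symbol *)

Section arith.
Context (R : realType).
Implicit Types a b c d k x y : R.

Lemma mul_le_sqr k : 0 < k -> forall a b,
  `|a * b| <= 2^-1 * (k * a ^+ 2 + k^-1 * b ^+ 2).
Proof.
move=> k0 a b; rewrite -(real_normK (num_real a)) -(real_normK (num_real b)) normrM.
move: `|a| `|b| => {}a {}b; rewrite -subr_ge0.
rewrite (_ : _ - _ = 2^-1 * (k * (a - k^-1 * b) ^+ 2)); last first.
  by field; rewrite gt_eqF.
by apply: mulr_ge0; [rewrite invr_ge0|apply: mulr_ge0; [exact: ltW|exact: sqr_ge0]].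
Qed.

Lemma form_arith1 k k' a b c d a' b' c' d' : 0 <= k -> 0 <= k' ->
  k * a ^+ 2 + k' * c ^+ 2 + (k * b ^+ 2 + k' * d ^+ 2) <=
  k * (a ^+ 2 + b ^+ 2 + (a' ^+ 2 + b' ^+ 2)) +
  k' * (c ^+ 2 + d ^+ 2 + (c' ^+ 2 + d' ^+ 2)).
Proof.
move=> k0 k1; rewrite -subr_ge0.
rewrite (_ : _ - _ = k * (a' ^+ 2 + b' ^+ 2) + k' * (c' ^+ 2 + d' ^+ 2)); last by ring.
by rewrite addr_ge0// mulr_ge0// addr_ge0// sqr_ge0.
Qed.

Lemma absorb_arith k s x y : 0 < k -> y <= k * s ->
  s <= 2^-1 * (k * x + k^-1 * y) -> s <= k * x.
Proof.
move=> k0 ys sxy; have : k^-1 * y <= s by rewrite ler_pdivrMl.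
lra.
Qed.

End arith.

Section wform.
Context (R : realType) (T : R).
Hypothesis T0 : 0 < T.
Notation mu := (@lebesgue_measure R).
Local Notation I := (sym_itv T).
Local Notation H := (`[0, +oo[%classic : set (measurableTypeR R)).
Implicit Types (g h w u : R -> R).
Local Notation L2 := (L2 T).
Local Notation sqn := (sqn T).
Local Notation ip := (ip T).
Local Notation ctr := (ctr T).
Local Notation str := (str T).
Local Notation mI := (measurable_I T).
Local Notation mH := (@measurable_H R).

Lemma ipC g h : ip g h = ip h g.
Proof. by apply: eq_Rintegral => t _; rewrite mulrC. Qed.

Lemma sqnE g : sqn g = ip g g. Proof. by []. Qed.

Lemma ipBl f g h : L2 f -> L2 g -> L2 h -> ip (fun t => f t - g t) h = ip f h - ip g h.
Proof.
move=> Lf Lg Lh; rewrite -(RintegralB mI (L2_mul Lf Lh) (L2_mul Lg Lh)).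
by apply: eq_Rintegral => t _; rewrite mulrBl.
Qed.

Lemma ipDl f g h : L2 f -> L2 g -> L2 h -> ip (fun t => f t + g t) h = ip f h + ip g h.
Proof.
move=> Lf Lg Lh; rewrite -(RintegralD mI (L2_mul Lf Lh) (L2_mul Lg Lh)).
by apply: eq_Rintegral => t _; rewrite mulrDl.
Qed.

Lemma ipZl k g h : L2 g -> L2 h -> ip (fun t => k * g t) h = k * ip g h.
Proof.
move=> Lg Lh; rewrite -(RintegralZl k mI (L2_mul Lg Lh)).
by apply: eq_Rintegral => t _; rewrite mulrA.
Qed.

Lemma ip_le g h k : 0 < k -> L2 g -> L2 h ->
  `|ip g h| <= 2^-1 * (k * sqn g + k^-1 * sqn h).
Proof.
move=> k0 Lg Lh; have ig := Lg.2; have ih := Lh.2.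
rewrite /Submission.sqn -(RintegralZl k mI ig) -(RintegralZl k^-1 mI ih).
rewrite -(RintegralD mI (intgZ k mI ig) (intgZ k^-1 mI ih)).
rewrite -(RintegralZl _ mI (intgD mI (intgZ k mI ig) (intgZ k^-1 mI ih))).
apply: (le_Rintegral_norm mI (L2_mul Lg Lh)
  (intgZ _ mI (intgD mI (intgZ k mI ig) (intgZ k^-1 mI ih)))) => t _.
exact: mul_le_sqr.
Qed.

(** Spectral density of [g] together with that of [t * g t]: by
    Bessel's inequality its integral is controlled by the norm of [g], and it
    dominates every product occurring in [wform]. *)
Definition energy g y := pow_spec T g y + pow_spec T (mulX g) y.

Lemma energy_ge0 g y : 0 <= energy g y.
Proof. by rewrite !addr_ge0 ?sqr_ge0. Qed.

Lemma energy_bound g : L2 g -> intg H (energy g) /\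
  \int[mu]_(y in H) energy g y <= pi * (1 + T ^+ 2) * sqn g.
Proof.
move=> Lg; have [i1 le1] := bessel T0 Lg; have [i2 le2] := bessel T0 (L2X Lg).
split; first exact: intgD.
rewrite RintegralD// mulrDr mulr1 mulrDl lerD//.
by rewrite (le_trans le2)// -mulrA ler_wpM2l ?pi_ge0// sqnX.
Qed.

(** Integrand of the form of the kernel
    [int (w0 y * cos (v y) + w1 y * v * sin (v y)) dy] at [v = t - s], written
    through the transforms of [g] and [h]. The factor [v] is the difference of
    the multiplications by [t] and by [s], hence the transforms of [mulX g] and
    of [mulX h]. *)
Definition wform w0 w1 g h y :=
  w0 y * (ctr h y * ctr g y + str h y * str g y) +
  w1 y * (str (mulX h) y * ctr g y - ctr (mulX h) y * str g y
          - str h y * ctr (mulX g) y + ctr h y * str (mulX g) y).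

Lemma form_le w0 w1 g h y k : 0 < k -> `|wform w0 w1 g h y| <=
  (`|w0 y| + `|w1 y|) * (2^-1 * (k * energy g y + k^-1 * energy h y)).
Proof.
move=> k0; rewrite (le_trans (ler_normD _ _))// mulrDl !normrM.
have M := mul_le_sqr k0.
apply: lerD; apply: ler_wpM2l => //; rewrite /energy /pow_spec.
- apply: (le_trans (ler_normD _ _)).
  have := lerD (M (ctr g y) (ctr h y)) (M (str g y) (str h y)).
  rewrite [ctr g y * _]mulrC [str g y * _]mulrC => /le_trans; apply.
  rewrite -mulrDr ler_pM2l ?invr_gt0//.
  have k1 : 0 <= k^-1 by rewrite invr_ge0 ltW.
  by apply: form_arith1 => //; exact: ltW.
- have := lerD (lerD (M (ctr g y) (str (mulX h) y)) (M (str g y) (ctr (mulX h) y)))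
    (lerD (M (ctr (mulX g) y) (str h y)) (M (str (mulX g) y) (ctr h y))).
  rewrite [ctr g y * _]mulrC [str g y * _]mulrC [ctr (mulX g) y * _]mulrC
    [str (mulX g) y * _]mulrC => le4.
  apply: le_trans (le_trans le4 _).
    rewrite -[X in `|X|]addrA (le_trans (ler_normD _ _))// lerD//.
      exact: ler_normB.
    by rewrite (le_trans (ler_normD _ _))// normrN.
  by rewrite -!mulrDr ler_pM2l ?invr_gt0// le_eqVlt; apply/orP; left; apply/eqP; ring.
Qed.

Lemma measurable_form w0 w1 g h : measurable_fun setT w0 -> measurable_fun setT w1 ->
  L2 g -> L2 h -> measurable_fun setT (wform w0 w1 g h).
Proof.
move=> m0 m1 Lg Lh.
have c1 := measurable_ctr T0 Lg; have c2 := measurable_ctr T0 Lh.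
have s1 := measurable_str T0 Lg; have s2 := measurable_str T0 Lh.
have c3 := measurable_ctr T0 (L2X Lg); have c4 := measurable_ctr T0 (L2X Lh).
have s3 := measurable_str T0 (L2X Lg); have s4 := measurable_str T0 (L2X Lh).
apply: measurable_funD; apply: measurable_funM => //.
  by apply: measurable_funD; exact: measurable_funM.
apply: measurable_funD; last exact: measurable_funM.
apply: measurable_funB; last exact: measurable_funM.
by apply: measurable_funB; exact: measurable_funM.
Qed.

Lemma measurable_energy g : L2 g -> measurable_fun setT (energy g).
Proof.
move=> Lg; apply: measurable_funD; apply: measurable_funD; apply: measurable_funX.
- exact: measurable_ctr.
- exact: measurable_str.
- exact: (measurable_ctr T0 (L2X Lg)).
- exact: (measurable_str T0 (L2X Lg)).
Qed.

Lemma intg_energyM w C g : measurable_fun setT w -> (forall y, 0 <= y -> `|w y| <= C) ->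
  L2 g -> intg H (fun y => w y * energy g y).
Proof.
move=> mw wC Lg; have [ie _] := energy_bound Lg.
have mw' : measurable_fun H w by exact: measurable_funTS.
have wC' y : H y -> `|w y| <= C by rewrite /= in_itv/= andbT; exact: wC.
have := intgM_bounded mH ie mw' wC'.
by apply: eq_integrable => // y _ /=; rewrite mulrC.
Qed.

(** The weight [k] is left free in order to absorb the energy of [h]. *)
Lemma form_dominated w0 w1 W C g h k : 0 < k ->
  measurable_fun setT w0 -> measurable_fun setT w1 -> measurable_fun setT W ->
  (forall y, 0 <= y -> `|w0 y| + `|w1 y| <= W y) -> (forall y, 0 <= y -> W y <= C) ->
  L2 g -> L2 h -> intg H (wform w0 w1 g h) /\
  `|\int[mu]_(y in H) wform w0 w1 g h y| <=
  2^-1 * (k * (\int[mu]_(y in H) (W y * energy g y)) +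
          k^-1 * (\int[mu]_(y in H) (W y * energy h y))).
Proof.
move=> k0 m0 m1 mW wW WC Lg Lh.
have WC' y : 0 <= y -> `|W y| <= C.
  by move=> y0; rewrite ger0_norm ?WC// (le_trans _ (wW _ y0))// addr_ge0.
have ig := intg_energyM mW WC' Lg; have ih := intg_energyM mW WC' Lh.
have iD := intgZ 2^-1 mH (intgD mH (intgZ k mH ig) (intgZ k^-1 mH ih)).
have le y : H y -> `|wform w0 w1 g h y| <=
    2^-1 * (k * (W y * energy g y) + k^-1 * (W y * energy h y)).
  rewrite /= in_itv/= andbT => y0; apply: (le_trans (form_le _ _ _ _ _ k0)).
  rewrite (_ : 2^-1 * (k * (W y * energy g y) + _) =
    W y * (2^-1 * (k * energy g y + k^-1 * energy h y))); last by ring.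
  apply: ler_wpM2r; last exact: wW.
  by rewrite mulr_ge0 ?invr_ge0// addr_ge0// mulr_ge0 ?energy_ge0 ?invr_ge0// ltW.
have iform : intg H (wform w0 w1 g h).
  apply: (intg_le mH iD) => //.
  by apply: measurable_funTS; exact: measurable_form.
split=> //; apply: (le_trans (le_Rintegral_norm mH iform iD le)).
rewrite (RintegralZl _ mH (intgD mH (intgZ k mH ig) (intgZ k^-1 mH ih))).
rewrite (RintegralD mH (intgZ k mH ig) (intgZ k^-1 mH ih)).
by rewrite (RintegralZl _ mH ig) (RintegralZl _ mH ih).
Qed.

(** Testing against [u] itself bounds [sqn u] by a mixed form; choosing [k]
    so that the energy of [u] is half of the left-hand side absorbs it. *)
Lemma form_energy w0 w1 W C g u : 0 < C ->
  measurable_fun setT w0 -> measurable_fun setT w1 -> measurable_fun setT W ->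
  (forall y, 0 <= y -> `|w0 y| + `|w1 y| <= W y) -> (forall y, 0 <= y -> W y <= C) ->
  L2 g -> L2 u -> sqn u = \int[mu]_(y in H) wform w0 w1 g u y ->
  sqn u <= C * (pi * (1 + T ^+ 2)) * \int[mu]_(y in H) (W y * energy g y).
Proof.
move=> C0 m0 m1 mW wW WC Lg Lu uE.
have pT : 0 < pi * (1 + T ^+ 2) :> R.
  by rewrite mulr_gt0 ?pi_gt0// ltr_wpDr ?sqr_ge0.
have k0 : 0 < C * (pi * (1 + T ^+ 2)) by rewrite mulr_gt0.
have [_] := form_dominated k0 m0 m1 mW wW WC Lg Lu.
rewrite -uE (ger0_norm (sqn_ge0 _ _)).
have [iu leu] := energy_bound Lu.
have W0 y : 0 <= y -> 0 <= W y.
  by move=> y0; rewrite (le_trans _ (wW _ y0))// addr_ge0.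
have leW : \int[mu]_(y in H) (W y * energy u y) <= C * (pi * (1 + T ^+ 2)) * sqn u.
  rewrite -mulrA; apply: (@le_trans _ _ (C * \int[mu]_(y in H) energy u y)); last first.
    by rewrite ler_wpM2l// ltW.
  rewrite -(RintegralZl C mH iu); apply: le_Rintegral mH _ _ _.
  - by apply: (@intg_energyM _ C) => // y y0; rewrite ger0_norm ?W0 ?WC.
  - exact: intgZ.
  - move=> y; rewrite /= in_itv/= andbT => y0.
    by rewrite ler_wpM2r ?energy_ge0 ?WC.
exact: absorb_arith k0 leW.
Qed.

End wform.

(** * Operators with an integrable symbol, and their limits *)

Lemma six_arith (R : realFieldType) (a b : R) : a <= 1 -> b <= 1 -> 2 + a + (2 + b) <= 6.
Proof. lra. Qed.

Lemma div_halves (R : realFieldType) (e c : R) : c != 0 ->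
  e / (c * 2) + e / (c * 2) = e / c.
Proof. by move=> c0; field. Qed.

Lemma lin_cvg0 (R : realType) (V u : nat -> R) (E : R) :
  V n @[n --> \oo] --> (0 : R) -> u n @[n --> \oo] --> (0 : R) ->
  2 * V n + u n * E @[n --> \oo] --> (0 : R).
Proof.
move=> V0 u0; rewrite -[X in _ --> X]addr0; apply: cvgD.
  by rewrite -[X in _ --> X](mulr0 2); apply: cvgM => //; exact: cvg_cst.
by rewrite -[X in _ --> X](mul0r E); apply: cvgM => //; exact: cvg_cst.
Qed.

Section kop.
Context (R : realType) (T : R).
Hypothesis T0 : 0 < T.
Notation mu := (@lebesgue_measure R).
Local Notation I := (sym_itv T).
Local Notation H := (`[0, +oo[%classic : set (measurableTypeR R)).
Implicit Types (g h w u : R -> R).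
Local Notation L2 := (L2 T).
Local Notation sqn := (sqn T).
Local Notation ip := (ip T).
Local Notation ctr := (ctr T).
Local Notation str := (str T).
Local Notation wform := (wform T).
Local Notation energy := (energy T).
Local Notation mI := (measurable_I T).
Local Notation mH := (@measurable_H R).

Definition kern w0 w1 v := cosint w0 v + v * sinint w1 v.

Definition kop w0 w1 g t := \int[mu]_(s in I) (g s * kern w0 w1 (t - s)).

Lemma intg_conv g k t B : L2 g -> continuous k -> (forall v, `|k v| <= B) ->
  intg I (fun s => g s * k (t - s)).
Proof.
move=> Lg ck kB; apply: (intgM_bounded mI (L2_int T0 Lg) (B := B)).
  apply: measurable_funTS; apply: (measurableT_comp (continuous_measurable_fun ck)).
  exact: measurable_funB.
by move=> s _; exact: kB.
Qed.

Lemma kopE w0 w1 g t : intg H w0 -> intg H w1 -> L2 g -> kop w0 w1 g t =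
  cosint (fun y => w0 y * ctr g y) t + sinint (fun y => w0 y * str g y) t +
  (t * (sinint (fun y => w1 y * ctr g y) t - cosint (fun y => w1 y * str g y) t) -
  (sinint (fun y => w1 y * ctr (mulX g) y) t - cosint (fun y => w1 y * str (mulX g) y) t)).
Proof.
move=> i0 i1 Lg; have LX := L2X Lg.
have j0 := intg_conv t Lg (cosint_continuous i0) (fun v => cosint_bounded v i0).
have j1 := intg_conv t Lg (sinint_continuous i1) (fun v => sinint_bounded v i1).
have j2 := intg_conv t LX (sinint_continuous i1) (fun v => sinint_bounded v i1).
rewrite -(conv_cosint T0 t Lg i0) -(conv_sinint T0 t Lg i1) -(conv_sinint T0 t LX i1).
rewrite -(RintegralZl t mI j1) -(RintegralB mI (intgZ t mI j1) j2).
rewrite -(RintegralD mI j0 (intgB mI (intgZ t mI j1) j2)).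
by apply: eq_Rintegral => s _; rewrite /kern /mulX; ring.
Qed.

Lemma L2_kop w0 w1 g : intg H w0 -> intg H w1 -> L2 g -> L2 (kop w0 w1 g).
Proof.
move=> i0 i1 Lg; have LX := L2X Lg.
have -> : kop w0 w1 g = _ := funext (fun t => kopE t i0 i1 Lg).
apply: L2D.
  apply: L2D; [apply: L2_cosint => //; exact: intg_ctrM|].
  by apply: L2_sinint => //; exact: intg_strM.
apply: L2B.
  apply: (@L2X _ _ (fun t => sinint (fun y => w1 y * ctr g y) t - cosint (fun y => w1 y * str g y) t)).
  apply: L2B; [apply: L2_sinint => //; exact: intg_ctrM|].
  by apply: L2_cosint => //; exact: intg_strM.
apply: L2B; [apply: L2_sinint => //; exact: intg_ctrM|].
by apply: L2_cosint => //; exact: intg_strM.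
Qed.

Lemma ip_kop w0 w1 g h : intg H w0 -> intg H w1 -> L2 g -> L2 h ->
  intg H (wform w0 w1 g h) /\
  ip (kop w0 w1 g) h = \int[mu]_(y in H) wform w0 w1 g h y.
Proof.
move=> i0 i1 Lg Lh; have LX := L2X Lg; have LXh := L2X Lh.
have a1 := intg_ctrM T0 i0 Lg; have a2 := intg_strM T0 i0 Lg.
have b1 := intg_ctrM T0 i1 Lg; have b2 := intg_strM T0 i1 Lg.
have c1 := intg_ctrM T0 i1 LX; have c2 := intg_strM T0 i1 LX.
have ipc u k : intg H u -> L2 k -> ip (cosint u) k = \int[mu]_(y in H) (u y * ctr k y).
  by move=> iu Lk; rewrite ipC -ip_cosint.
have ips u k : intg H u -> L2 k -> ip (sinint u) k = \int[mu]_(y in H) (u y * str k y).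
  by move=> iu Lk; rewrite ipC -ip_sinint.
have ipX u k : ip (fun t => t * u t) k = ip u (mulX k).
  by apply: eq_Rintegral => t _; rewrite /mulX; ring.
have A1 := L2_cosint T0 a1; have A2 := L2_sinint T0 a2.
have B1 := L2_sinint T0 b1; have B2 := L2_cosint T0 b2.
have C1 := L2_sinint T0 c1; have C2 := L2_cosint T0 c2.
have p1 := intg_ctrM T0 a1 Lh; have p2 := intg_strM T0 a2 Lh.
have q1 := intg_strM T0 b1 LXh; have q2 := intg_ctrM T0 b2 LXh.
have r1 := intg_strM T0 c1 Lh; have r2 := intg_ctrM T0 c2 Lh.
have E : wform w0 w1 g h = fun y => (w0 y * ctr g y * ctr h y + w0 y * str g y * str h y) +
    ((w1 y * ctr g y * str (mulX h) y - w1 y * str g y * ctr (mulX h) y) -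
     (w1 y * ctr (mulX g) y * str h y - w1 y * str (mulX g) y * ctr h y)).
  by apply/funext => y; rewrite /Submission.wform; ring.
rewrite E; split.
  exact (intgD mH (intgD mH p1 p2) (intgB mH (intgB mH q1 q2) (intgB mH r1 r2))).
have -> : kop w0 w1 g = _ := funext (fun t => kopE t i0 i1 Lg).
rewrite (ipDl (L2D A1 A2) (L2B (L2X (L2B B1 B2)) (L2B C1 C2)) Lh).
rewrite (ipDl A1 A2 Lh) (ipBl (L2X (L2B B1 B2)) (L2B C1 C2) Lh) ipX.
rewrite (ipBl B1 B2 LXh) (ipBl C1 C2 Lh).
rewrite (ipc _ _ a1 Lh) (ips _ _ a2 Lh) (ips _ _ b1 LXh) (ipc _ _ b2 LXh).
rewrite (ips _ _ c1 Lh) (ipc _ _ c2 Lh).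
clear ipc ips ipX A1 A2 B1 B2 C1 C2 E.
rewrite -(RintegralB mH r1 r2) -(RintegralB mH q1 q2) -(RintegralD mH p1 p2).
rewrite -(RintegralB mH (intgB mH q1 q2) (intgB mH r1 r2)).
by rewrite -(RintegralD mH (intgD mH p1 p2) (intgB mH (intgB mH q1 q2) (intgB mH r1 r2))).
Qed.

(** Majorant, up to a constant, of the error made when a symbol is multiplied by
    [expR (- (d * y))] or by [(1 + d) * expR (- (d * y))]. *)
Definition damp (d y : R) := 2 * (1 - expR (- (d * y))) + d.

Lemma damp_ge0 d y : 0 < d -> 0 <= y -> 0 <= damp d y.
Proof.
move=> d0 y0; apply: addr_ge0; last exact: ltW.
apply: mulr_ge0 => //; rewrite subr_ge0 -expR0 ler_expR oppr_le0.
by apply: mulr_ge0 => //; exact: ltW.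
Qed.

Lemma damp_le d y : damp d y <= 2 + d.
Proof. by rewrite lerD2r ler_piMr// lerBlDr lerDl expR_ge0. Qed.

Lemma measurable_damp d : measurable_fun setT (damp d).
Proof.
apply: continuous_measurable_fun => x.
have dE (z : R) : is_derive z 1 (damp d) (2 * d * expR (- (d * z))).
  by apply: is_derive_eq; rewrite /GRing.scale/=; ring.
exact: continuous_is_derive dE _.
Qed.

Lemma intg_damp d g : 0 < d -> L2 g -> intg H (fun y => damp d y * energy g y).
Proof.
move=> d0 Lg; apply: (@intg_energyM _ _ T0 _ (2 + d)) => //; first exact: measurable_damp.
by move=> y y0; rewrite ger0_norm ?damp_ge0// damp_le.
Qed.

(** Dominated convergence: the damping error tends to [0] pointwise and the
    energy is integrable. *)
Lemma damping_cvg g : L2 g ->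
  \int[mu]_(y in H) (damp d y * energy g y) @[d --> 0^'+] --> (0 : R).
Proof.
move=> Lg; have [ie _] := energy_bound T0 Lg.
apply/cvg_at_rightP => u [u0 u_cvg].
pose v n y := (1 - expR (- (u n * y))) * energy g y.
have e_ge0 n y : 0 <= y -> 0 <= 1 - expR (- (u n * y)).
  by move=> y0; rewrite subr_ge0 -expR0 ler_expR oppr_le0 mulr_ge0// ltW.
have mv n : measurable_fun setT (v n).
  apply: measurable_funM; last exact: measurable_energy.
  apply: continuous_measurable_fun => x.
  have dE (z : R) : is_derive z 1 (fun y => 1 - expR (- (u n * y))) (u n * expR (- (u n * z))).
    by apply: is_derive_eq; rewrite /GRing.scale/=; ring.
  exact: continuous_is_derive dE _.
have v_le n y : H y -> `|v n y| <= energy g y.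
  rewrite /= in_itv/= andbT => y0.
  rewrite /v normrM (ger0_norm (e_ge0 _ _ y0)) (ger0_norm (energy_ge0 _ _ _)).
  by apply: ler_piMl; [exact: energy_ge0|rewrite lerBlDr lerDl expR_ge0].
have iv n : intg H (v n).
  by apply: (intg_le mH ie (measurable_funTS (mv n))) => y; exact: v_le.
have [_ cv] : intg H (fun=> 0) /\ \int[mu]_(y in H) v n y @[n --> \oo] --> \int[mu]_(y in H) (0 : R).
  apply: (@Rdominated_cvg _ _ _ mu H v (fun=> 0) (energy g) mH) => //.
    by move=> n; apply: measurable_funTS; exact: mv.
  move=> y _; rewrite -[X in _ --> X](mul0r (energy g y)).
  apply: cvgM; last exact: cvg_cst.
  rewrite -[X in _ --> X](subrr 1); apply: cvgB; first exact: cvg_cst.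
  rewrite -[X in _ --> X]expR0; apply: continuous_cvg; first exact: continuous_expR.
  rewrite -oppr0; apply: cvgN; rewrite -[X in _ --> X](mul0r y).
  exact: (cvgM u_cvg (cvg_cst (y : R))).
rewrite (_ : (fun n => _) = (fun n => 2 * (\int[mu]_(y in H) v n y) +
    u n * \int[mu]_(y in H) energy g y)); last first.
  apply/funext => n; rewrite -(RintegralZl 2 mH (iv n)) -(RintegralZl (u n) mH ie).
  rewrite -(RintegralD mH (intgZ 2 mH (iv n)) (intgZ (u n) mH ie)).
  by apply: eq_Rintegral => y _; rewrite /damp /v; ring.
rewrite Rintegral_cst// mul0r in cv.
exact: (lin_cvg0 _ cv u_cvg).
Qed.

Lemma wformB a0 a1 b0 b1 g h y :
  wform (fun y => a0 y - b0 y) (fun y => a1 y - b1 y) g h y =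
  wform a0 a1 g h y - wform b0 b1 g h y.
Proof. by rewrite /Submission.wform; ring. Qed.

Lemma ip_cvg0 (X : Type) (F : set_system X) {FF : Filter F} (f : X -> R -> R) h :
  (\forall d \near F, L2 (f d)) -> L2 h ->
  sqn (f d) @[d --> F] --> (0 : R) -> ip (f d) h @[d --> F] --> (0 : R).
Proof.
move=> Lf Lh f0; apply/cvgr0Pnorm_le => e e0.
have s0 := sqn_ge0 T h; have k0 : 0 < (sqn h + 1) / e.
  by rewrite divr_gt0// ltr_wpDl.
move/cvgr0Pnorm_le : f0 => /(_ (e / ((sqn h + 1) / e)) (divr_gt0 e0 k0)) f0.
apply: filterS2 Lf f0 => d Lfd; rewrite (ger0_norm (sqn_ge0 _ _)) => fe.
apply: (le_trans (ip_le k0 Lfd Lh)).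
rewrite ler_pdivrMl// mulr_natl mulr2n; apply: lerD; first by rewrite mulrC -ler_pdivlMr.
rewrite invf_div mulrAC ler_pdivrMr; last exact: ltr_wpDl.
by apply: ler_wpM2l; [exact: ltW|rewrite lerDl].
Qed.

Section weak_limit.
Variables (w0 w1 : R -> R -> R) (d0 d1 : R -> R) (M : R).
Hypothesis M0 : 0 < M.
Hypothesis i0 : forall d, 0 < d -> intg H (w0 d).
Hypothesis i1 : forall d, 0 < d -> intg H (w1 d).
Hypothesis m0 : forall d, measurable_fun setT (w0 d).
Hypothesis m1 : forall d, measurable_fun setT (w1 d).
Hypothesis md0 : measurable_fun setT d0.
Hypothesis md1 : measurable_fun setT d1.
Hypothesis dM : forall y, 0 <= y -> `|d0 y| + `|d1 y| <= M.
Hypothesis wd : forall d y, 0 < d -> 0 <= y ->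
  `|w0 d y - d0 y| + `|w1 d y - d1 y| <= M * damp d y.

Let r g d := \int[mu]_(y in H) (damp d y * energy g y).
Let U g d := kop (w0 d) (w1 d) g.

Let LU g d : L2 g -> 0 < d -> L2 (U g d).
Proof. by move=> Lg d_gt0; apply: L2_kop => //; [exact: i0|exact: i1]. Qed.

Let intg_dform g h : L2 g -> L2 h -> intg H (wform d0 d1 g h).
Proof.
move=> Lg Lh.
have mM : measurable_fun setT (fun _ : R => M) by [].
by have [] := form_dominated T0 ltr01 md0 md1 mM dM (fun y _ => lexx M) Lg Lh.
Qed.

Let diff_dominated d g h : 0 < d -> L2 g -> L2 h ->
  `|\int[mu]_(y in H) wform (w0 d) (w1 d) g h y - \int[mu]_(y in H) wform d0 d1 g h y| <=
  2^-1 * (M * r g d + M * r h d).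
Proof.
move=> d_gt0 Lg Lh.
have [iw _] := ip_kop (i0 d_gt0) (i1 d_gt0) Lg Lh.
rewrite -(RintegralB mH iw (intg_dform Lg Lh)).
have mW : measurable_fun setT (fun y => M * damp d y).
  by apply: measurable_funM => //; exact: measurable_damp.
have leW y : 0 <= y -> M * damp d y <= M * (2 + d).
  by move=> _; rewrite ler_pM2l// damp_le.
have [_] := form_dominated T0 ltr01 (measurable_funB (m0 d) md0) (measurable_funB (m1 d) md1)
  mW (fun y => wd d_gt0) leW Lg Lh.
rewrite invr1 !mul1r.
have E k : L2 k -> \int[mu]_(y in H) (M * damp d y * energy k y) = M * r k d.
  move=> Lk; rewrite -(RintegralZl M mH (intg_damp d_gt0 Lk)).
  by apply: eq_Rintegral => y _; rewrite mulrA.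
rewrite !E//; apply: le_trans; rewrite le_eqVlt; apply/orP; left; apply/eqP.
by congr (`| _ |); apply: eq_Rintegral => y _; rewrite wformB.
Qed.

(** The family of truncated operators is Cauchy: an operator difference is
    tested against itself. *)
Let cauchy_diff g a b : L2 g -> 0 < a <= 1 -> 0 < b <= 1 ->
  sqn (fun t => U g a t - U g b t) <=
  M * 6 * (pi * (1 + T ^+ 2)) * (M * (r g a + r g b)).
Proof.
move=> Lg /andP[a0 a1] /andP[b0 b1].
have La := LU Lg a0; have Lb := LU Lg b0; have Lab := L2B La Lb.
have [ia ea] := ip_kop (i0 a0) (i1 a0) Lg Lab.
have [ib eb] := ip_kop (i0 b0) (i1 b0) Lg Lab.
have ja := intg_damp a0 Lg; have jb := intg_damp b0 Lg.
have := @form_energy _ _ T0 (fun y => w0 a y - w0 b y) (fun y => w1 a y - w1 b y)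
   (fun y => M * (damp a y + damp b y)) (M * 6) g (fun t => U g a t - U g b t).
rewrite (_ : \int[mu]_(y in H) (M * (damp a y + damp b y) * energy g y) =
    M * (r g a + r g b)); last first.
  rewrite -(RintegralD mH ja jb) -(RintegralZl M mH (intgD mH ja jb)).
  by apply: eq_Rintegral => y _; ring.
apply=> //.
- by rewrite mulr_gt0.
- exact: measurable_funB.
- exact: measurable_funB.
- by apply: measurable_funM => //; apply: measurable_funD; exact: measurable_damp.
- move=> y y0; rewrite mulrDr; apply: le_trans (lerD (wd a0 y0) (wd b0 y0)).
  rewrite addrACA; apply: lerD.
    by rewrite [in leRHS](distrC (w0 b y)) -[in leLHS](subrKA (d0 y)) ler_normD.
  by rewrite [in leRHS](distrC (w1 b y)) -[in leLHS](subrKA (d1 y)) ler_normD.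
- move=> y _; rewrite ler_pM2l// (le_trans (lerD (damp_le a y) (damp_le b y)))//.
  exact: six_arith.
rewrite -[LHS]/(ip _ _) (ipBl La Lb Lab) ea eb -(RintegralB mH ia ib).
by apply: eq_Rintegral => y _; rewrite wformB.
Qed.

(** The kernels need not converge pointwise, but the forms do, and a Cauchy
    estimate in the norm upgrades this to strong convergence. *)
Lemma weak_limit g : L2 g -> exists q, [/\ L2 q,
  forall h, L2 h -> intg H (wform d0 d1 g h) /\
     ip q h = \int[mu]_(y in H) wform d0 d1 g h y &
  sqn (fun t => kop (w0 d) (w1 d) g t - q t) @[d --> 0^'+] --> (0 : R)].
Proof.
move=> Lg.
pose d (n : nat) : R := n.+1%:R^-1.
have d_gt0 n : 0 < d n by rewrite invr_gt0.
have d_le1 n : d n <= 1 by rewrite invf_le1// ler1n.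
have d_cvg : d n @[n --> \oo] --> (0 : R) by exact: cvg_harmonic.
have r_cvg k : L2 k -> r k (d n) @[n --> \oo] --> (0 : R).
  by move=> /damping_cvg /cvg_at_rightP; apply; split.
have pT : 0 < pi * (1 + T ^+ 2) :> R.
  by apply: mulr_gt0; [exact: pi_gt0|apply: ltr_wpDr; [exact: sqr_ge0|]].
have [q Lq qu] : exists2 q, L2 q & sqn (fun t => U g (d n) t - q t) @[n --> \oo] --> (0 : R).
  apply: (riesz_fischer T0) => [n|e e0]; first exact: LU.
  have c0 : 0 < M * 6 * (pi * (1 + T ^+ 2)) * M.
    by apply: mulr_gt0 => //; apply: mulr_gt0 => //; apply: mulr_gt0.
  have /cvgr0Pnorm_le/(_ _ (divr_gt0 e0 (mulr_gt0 c0 (ltr0Sn R 1)))) [N _ rN] := r_cvg _ Lg.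
  exists N => // N' /= NN' m n mN nN.
  apply: (le_trans (cauchy_diff Lg _ _)); rewrite ?d_gt0 ?d_le1//.
  rewrite mulrA mulrC -ler_pdivlMr//.
  apply: (le_trans (lerD (ler_norm _) (ler_norm _))).
  apply: (le_trans (lerD (rN m (leq_trans NN' mN)) (rN n (leq_trans NN' nN)))).
  by rewrite (div_halves e (lt0r_neq0 c0)).
have ipq h : L2 h -> ip q h = \int[mu]_(y in H) wform d0 d1 g h y.
  move=> Lh.
  have c1 : ip (U g (d n)) h @[n --> \oo] --> ip q h.
    have LUq : \forall n \near \oo, L2 (fun t => U g (d n) t - q t).
      by apply: nearW => n; exact: (L2B (LU Lg (d_gt0 n)) Lq).
    apply/subr_cvg0; have := ip_cvg0 LUq Lh qu.
    have -> : (fun n => ip (fun t => U g (d n) t - q t) h) = (fun n => ip (U g (d n)) h - ip q h).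
      by apply/funext => n; exact: (ipBl (LU Lg (d_gt0 n)) Lq Lh).
    exact.
  have c2 : ip (U g (d n)) h @[n --> \oo] --> \int[mu]_(y in H) wform d0 d1 g h y.
    apply/subr_cvg0.
    have lim0 : 2^-1 * (M * r g (d n) + M * r h (d n)) @[n --> \oo] --> (0 : R).
      have -> : (0 : R) = 2^-1 * (M * 0 + M * 0) by rewrite !(mulr0, addr0).
      by apply: cvgM; [exact: cvg_cst|apply: cvgD; apply: cvgM; [exact: cvg_cst|exact: r_cvg|exact: cvg_cst|exact: r_cvg]].
    apply/norm_cvg0P; apply: (squeeze_cvgr _ (cvg_cst 0) lim0).
    apply: nearW => n; rewrite normr_ge0/=.
    by have [_ ->] := ip_kop (i0 (d_gt0 n)) (i1 (d_gt0 n)) Lg Lh; exact: diff_dominated.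
  by rewrite -(cvg_lim (@Rhausdorff R) c1); apply/cvg_lim.
exists q; split => //.
  by move=> h Lh; split; [exact: intg_dform|exact: ipq].
pose c := M * 3 * (pi * (1 + T ^+ 2)) * M.
have lim0 : c * r g e @[e --> 0^'+] --> (0 : R).
  rewrite -[X in _ --> X](mulr0 c).
  by apply: cvgM; [exact: cvg_cst|exact: damping_cvg].
apply: (squeeze_cvgr _ (cvg_cst 0) lim0); near=> e.
have e0 : 0 < e by near: e; exact: nbhs_right_gt.
have e1 : e <= 1 by near: e; exact: nbhs_right_le.
rewrite sqn_ge0/=.
have Lk := L2B (LU Lg e0) Lq.
have [ie ee] := ip_kop (i0 e0) (i1 e0) Lg Lk.
have je := intg_damp e0 Lg.
have := @form_energy _ _ T0 (fun y => w0 e y - d0 y) (fun y => w1 e y - d1 y)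
   (fun y => M * damp e y) (M * 3) g (fun t => U g e t - q t).
rewrite (_ : \int[mu]_(y in H) (M * damp e y * energy g y) = M * r g e); last first.
  by rewrite -(RintegralZl M mH je); apply: eq_Rintegral => y _; ring.
rewrite [X in _ <= X](_ : _ = c * r g e); last by rewrite /c; ring.
apply=> //.
- by rewrite mulr_gt0.
- exact: measurable_funB.
- exact: measurable_funB.
- by apply: measurable_funM => //; exact: measurable_damp.
- by move=> y y0; exact: wd.
- move=> y _; rewrite ler_pM2l// (le_trans (damp_le e y))//.
  by rewrite -lerBrDl (le_trans e1)// -[X in X <= _]addr0 -lerBlDr; lra.
rewrite -[LHS]/(ip _ _) (ipBl (LU Lg e0) Lq Lk) ee (ipq _ Lk) -(RintegralB mH ie (intg_dform Lg Lk)).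
by apply: eq_Rintegral => y _; rewrite wformB.
Unshelve. all: by end_near. Qed.

End weak_limit.

End kop.

(** * Parseval's identity *)

Section parseval.
Context (R : realType) (T : R).
Hypothesis T0 : 0 < T.
Notation mu := (@lebesgue_measure R).
Local Notation I := (sym_itv T).
Local Notation H := (`[0, +oo[%classic : set (measurableTypeR R)).
Implicit Types (g h w u : R -> R).
Local Notation L2 := (L2 T).
Local Notation sqn := (sqn T).
Local Notation ip := (ip T).
Local Notation ctr := (ctr T).
Local Notation str := (str T).
Local Notation mI := (measurable_I T).
Local Notation mH := (@measurable_H R).

(** By Lebesgue's differentiation theorem the primitive has derivative [f] almost
    everywhere. *)
Lemma ae_eq0_of_primitive f : intg I f ->
  (forall x, I x -> \int[mu]_(t in `]- T, x]) f t = 0) ->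
  {ae mu, forall t, I t -> f t = 0}.
Proof.
move=> intf f0; pose F := f \_ I.
have iF : intg setT F by apply/(intg_mkcond _ _ mI).
have iFy (y : R) : intg [set` Interval (BRight (- T)) (BRight y)] F.
  by apply: integrableS iF => //; exact: measurable_itv.
have locF : locally_integrable setT F by apply: open_integrable_locally => //; exact: openT.
have := FTC1 iFy locF; apply: filterS; first exact: (ae_filter_ringOfSetsType mu).
move=> x FE Ix.
have := Ix; rewrite /sym_itv/= in_itv/= => /andP[Tx xT].
have [] := FE (_ : (BRight (- T) < BRight x)%O) => //.
move=> _; rewrite {2}/F patchE mem_set// => <-.
rewrite derive1E (@near_eq_derive _ _ _ _ (cst 0)).
  by rewrite derive_cst.
near=> z.
  have zI : I z.
    rewrite /sym_itv/= in_itv/=; apply/andP; split.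
      by near: z; exact: lt_nbhsr.
    by near: z; exact: lt_nbhsl.
  rewrite -[RHS](f0 z zI); apply: eq_Rintegral => t.
  rewrite inE/= in_itv/= => /andP[t1 t2]; rewrite /F patchE mem_set//.
  move: zI; rewrite /sym_itv/= !in_itv/= t1/= => /andP[_].
  exact: le_lt_trans.
Unshelve. all: by end_near. Qed.

Lemma cvg_atan_sg (c : R) (d : nat -> R) : (forall n, 0 < d n) -> d n @[n --> \oo] --> (0 : R) ->
  atan (c / d n) @[n --> \oo] --> pi / 2 * Num.sg c.
Proof.
move=> d0 dc.
have hw (b : R) : 0 < b -> atan (b / d n) @[n --> \oo] --> pi / 2.
  move=> b0; apply: (@cvg_comp _ _ _ (fun n => b / d n) atan _ (pinfty_nbhs R)); last first.
    exact: cvgy_atan.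
  apply/gtr0_cvgV0; first by apply: nearW => n; rewrite divr_gt0.
  have : d n * b^-1 @[n --> \oo] --> (0 : R).
    by rewrite -[X in _ --> X](mul0r b^-1); apply: cvgM => //; exact: cvg_cst.
  by apply: cvg_trans; apply: near_eq_cvg; apply: nearW => n; rewrite /= invf_div.
have [->|c0|c0] := sgrP c.
- rewrite mulr0; apply: cvg_near_cst; apply: nearW => n; by rewrite mul0r atan0.
- by rewrite mulr1; exact: hw.
- rewrite mulrN1; have := hw (- c); rewrite oppr_gt0 => /(_ c0) hc.
  rewrite (_ : (fun n => _) = (fun n => - atan (- c / d n))); first exact: cvgN.
  by apply/funext => n; rewrite mulNr atanN opprK.
Qed.

Let P (d : R) t s := d / (d ^+ 2 + (t - s) ^+ 2).

Let one (y : R) : R := 1.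
Let zero (y : R) : R := 0.
Let Ed (d y : R) := expR (- (d * y)).

Lemma intg0 (D : set (measurableTypeR R)) : measurable D -> intg D zero.
Proof. by move=> mD; apply: integrable0. Qed.

Lemma measurable_expRN (d : R) : measurable_fun setT (Ed d).
Proof.
apply: continuous_measurable_fun => x.
have dE (z : R) : is_derive z 1 (Ed d) (- d * Ed d z).
  by rewrite /Ed; apply: is_derive_eq; rewrite /GRing.scale/=; ring.
exact: continuous_is_derive dE _.
Qed.

Lemma kop_poisson d g t : 0 < d ->
  kop T (Ed d) zero g t = \int[mu]_(s in I) (g s * P d t s).
Proof.
move=> d0; apply: eq_Rintegral => s _; rewrite /kern /Ed poissonE//.
rewrite /sinint (_ : (fun _ => _) = cst 0); last first.
  by apply/funext => y; rewrite /zero mul0r.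
by rewrite Rintegral_cst ?mul0r ?mulr0 ?addr0//; exact: mH.
Qed.

Definition halfI (x t : R) : R := \1_(`]- T, x[ : set R) t.

Lemma L2_halfI x : L2 (halfI x).
Proof.
have mh : measurable_fun setT (halfI x) by apply: measurable_indic; exact: measurable_itv.
have E : (fun t => halfI x t * 1) = halfI x by apply/funext => t; rewrite mulr1.
rewrite -E; apply: (@L2_bounded _ _ _ _ 1 mh); last exact: (L2_cst T0).
by move=> t _; rewrite /halfI indicE; case: (_ \in _); rewrite /= ?normr0 ?normr1.
Qed.

Lemma ip_halfI g x : I x -> ip g (halfI x) = \int[mu]_(t in `]- T, x[) g t.
Proof.
rewrite /sym_itv/= in_itv/= => /andP[Tx xT].
rewrite [RHS]Rintegral_mkcond /Submission.ip [LHS]Rintegral_mkcond.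
apply: eq_Rintegral => t _; rewrite !patchE /halfI indicE.
have [tx|] := boolP (t \in (`]- T, x[%classic : set R)); last by rewrite mulr0 if_same.
rewrite mulr1 mem_set//; move: tx; rewrite inE/= /sym_itv/= !in_itv/= => /andP[->/=].
by move=> /lt_trans; exact.
Qed.

(** Integrating the Poisson kernel in one variable gives a difference of
    arctangents, which tends to a multiple of an indicator function. *)
Lemma poisson_halfI (d : R) g x : 0 < d -> L2 g -> I x ->
  ip (kop T (Ed d) zero g) (halfI x) =
  \int[mu]_(s in I) (g s * (atan ((x - s) / d) - atan ((- T - s) / d))).
Proof.
move=> d0 Lg Ix; have ih := L2_int T0 (L2_halfI x); have ig := L2_int T0 Lg.
have mP : measurable_fun setT
    (fun p : measurableTypeR R * measurableTypeR R => P d p.1 p.2).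
  apply: (measurableT_comp (continuous_measurable_fun (poisson_continuous d0))).
  exact: measurable_funB.
have PB t s : I t -> I s -> `|P d t s| <= d^-1.
  by move=> _ _; rewrite ger0_norm ?poisson_ge0// poisson_le.
have [_ _ e] := swap mI mI ih ig mP PB.
transitivity (\int[mu]_(t in I) (halfI x t * \int[mu]_(s in I) (g s * P d t s))).
  by apply: eq_Rintegral => t _; rewrite kop_poisson// mulrC.
rewrite e; apply: eq_Rintegral => s _; congr (_ * _).
have Tx : - T <= x.
  by move: Ix; rewrite /sym_itv/= in_itv/= => /andP[/ltW].
transitivity (ip (fun t => P d t s) (halfI x)).
  by apply: eq_Rintegral => t _; rewrite mulrC.
by rewrite (ip_halfI _ Ix); exact: poisson_integral.
Qed.

Lemma parseval_halfI g q x : L2 g -> L2 q -> I x ->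
  sqn (fun t => kop T (Ed d) zero g t - q t) @[d --> 0^'+] --> (0 : R) ->
  ip q (halfI x) = pi * ip g (halfI x).
Proof.
move=> Lg Lq Ix q_cvg; have ig := L2_int T0 Lg.
pose d (n : nat) : R := n.+1%:R^-1.
have d_gt0 n : 0 < d n by rewrite invr_gt0.
have d_cvg : d n @[n --> \oo] --> (0 : R) by exact: cvg_harmonic.
have LK e : 0 < e -> L2 (kop T (Ed e) zero g).
  move=> e0; apply: L2_kop => //; last exact: (intg0 mH).
  by have [] := expRN_integral 0 e0.
have qd : sqn (fun t => kop T (Ed (d n)) zero g t - q t) @[n --> \oo] --> (0 : R).
  by move/cvg_at_rightP : q_cvg; apply; split.
have c1 : ip (kop T (Ed (d n)) zero g) (halfI x) @[n --> \oo] --> ip q (halfI x).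
  have LUq : \forall n \near \oo, L2 (fun t => kop T (Ed (d n)) zero g t - q t).
    by apply: nearW => n; exact: (L2B (LK _ (d_gt0 n)) Lq).
  apply/subr_cvg0; have := ip_cvg0 LUq (L2_halfI x) qd.
  have -> : (fun n => ip (fun t => kop T (Ed (d n)) zero g t - q t) (halfI x)) =
      (fun n => ip (kop T (Ed (d n)) zero g) (halfI x) - ip q (halfI x)).
    by apply/funext => n; exact: (ipBl (LK _ (d_gt0 n)) Lq (L2_halfI x)).
  exact.
pose v n s := g s * (atan ((x - s) / d n) - atan ((- T - s) / d n)).
pose l s := g s * (pi / 2 * Num.sg (x - s) - pi / 2 * Num.sg (- T - s)).
have at_le (n : nat) (c : R) : `|atan (c / d n)| <= pi / 2.
  by rewrite ler_norml (ltW (atan_gtNpi2 _)) (ltW (atan_ltpi2 _)).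
have iv n : measurable_fun I (v n).
  apply: measurable_funM; first exact: (intg_measurable ig).
  apply: measurable_funTS; apply: measurable_funB.
    apply: (measurableT_comp (continuous_measurable_fun (@continuous_atan R))).
    by apply: measurable_funM => //; exact: measurable_funB.
  apply: (measurableT_comp (continuous_measurable_fun (@continuous_atan R))).
  by apply: measurable_funM => //; exact: measurable_funB.
have [il c2] : intg I l /\ \int[mu]_(s in I) v n s @[n --> \oo] --> \int[mu]_(s in I) l s.
  apply: (@Rdominated_cvg _ _ _ mu I v l (fun s => pi * `|g s|) mI iv).
  - move=> s _; apply: cvgM; first exact: cvg_cst.
    by apply: cvgB; exact: cvg_atan_sg.
  - by apply: (intgZ pi mI); exact: integrable_norm.
  - move=> n s _; rewrite /v normrM mulrC; apply: ler_wpM2r => //.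
    apply: (le_trans (ler_normB _ _)).
    have -> : pi = pi / 2 + pi / 2 :> R by rewrite -splitr.
    exact: lerD.
have e : \int[mu]_(s in I) l s = pi * ip g (halfI x).
  rewrite -(ipZl pi Lg (L2_halfI x)) /Submission.ip; congr fine; apply: ae_eq_integral.
  - exact: mI.
  - by apply/measurable_EFinP; exact: (intg_measurable il).
  - by apply/measurable_EFinP; exact: (intg_measurable (L2_mul (L2Z pi Lg) (L2_halfI x))).
  exists [set x]; split.
  - exact: measurable_set1.
  - exact: lebesgue_measure_set1.
  move=> s /= /not_implyP[Is ls]; apply: contrapT => sx; apply: ls; congr EFin.
  have Ts : - T - s < 0.
    by move: Is; rewrite /sym_itv/= in_itv/= => /andP[? _]; rewrite subr_lt0.
  rewrite /l /halfI indicE (ltr0_sg Ts).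
  have [xs|sx'|xs] := ltgtP x s.
  - rewrite ltr0_sg ?subr_lt0// subrr mulr0.
    rewrite memNset ?mulr0//= in_itv/= => /andP[_].
    by rewrite ltNge (ltW xs).
  - rewrite gtr0_sg ?subr_gt0// mem_set; last first.
      by rewrite /= in_itv/= sx' andbT -subr_lt0.
    by rewrite mulrN1 mulr1 mulr1 opprK -splitr mulrC.
  - by case: sx; rewrite xs.
rewrite -e -(cvg_lim (@Rhausdorff R) c1); apply/cvg_lim => //.
rewrite (_ : (fun n => _) = (fun n => \int[mu]_(s in I) v n s))//.
by apply/funext => n; rewrite poisson_halfI.
Qed.

(** Parseval's identity on the half line for functions supported in [I]. *)
Lemma parseval g h : L2 g -> L2 h ->
  \int[mu]_(y in H) (ctr g y * ctr h y + str g y * str h y) = pi * ip g h.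
Proof.
move=> Lg Lh.
have h0 d : 0 < d -> intg H (Ed d) by move=> d0; have [] := expRN_integral 0 d0.
have h1 (d : R) : 0 < d -> intg H zero by move=> _; exact: (intg0 mH).
have m0 d : measurable_fun setT (Ed d) by exact: measurable_expRN.
have mz (d : R) : measurable_fun setT zero by rewrite /zero.
have mo : measurable_fun setT one by rewrite /one.
have hM y : 0 <= y -> `|one y| + `|zero y| <= 1.
  by move=> _; rewrite /one /zero normr0 normr1 addr0.
have hw d y : 0 < d -> 0 <= y -> `|Ed d y - one y| + `|zero y - zero y| <= 1 * damp d y.
  move=> d0 y0; rewrite subrr normr0 addr0 mul1r distrC.
  have e0 : 0 <= one y - Ed d y.
    rewrite subr_ge0 -[one y]expR0 ler_expR oppr_le0.
    by apply: mulr_ge0 => //; exact: ltW.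
  rewrite (ger0_norm e0) /damp; move: e0; rewrite /Ed /one; move: (1 - _) => z z0.
  rewrite mulr_natl mulr2n -addrA lerDl.
  by apply: addr_ge0 => //; exact: ltW.
have [q [Lq qE q_cvg]] := weak_limit T0 ltr01 h0 h1 m0 mz mo (mz 1) hM hw Lg.
have [_ e] := qE h Lh.
transitivity (ip q h).
  rewrite e; apply: eq_Rintegral => y _.
  by rewrite /wform /one /zero; ring.
have Lpg := L2Z pi Lg.
have i_diff := L2_int T0 (L2B Lq Lpg).
have ae0 : {ae mu, forall t, I t -> q t - pi * g t = 0}.
  apply: ae_eq0_of_primitive => // x Ix.
  have iS : intg `]- T, x] (fun t => q t - pi * g t).
    apply: integrableS i_diff => //; first exact: measurable_itv.
    move=> t; move: Ix; rewrite /sym_itv/= !in_itv/= => /andP[_ xT] /andP[->/= tx].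
    exact: le_lt_trans tx xT.
  rewrite -Rintegral_itv_bndo_bndc; last first.
    apply: (integrableS _ _ _ iS); [exact: measurable_itv|exact: measurable_itv|].
    by move=> t; rewrite /= !in_itv/= => /andP[-> /ltW ->].
  rewrite -ip_halfI// (ipBl Lq Lpg (L2_halfI x)) (ipZl _ Lg (L2_halfI x)).
  by rewrite (parseval_halfI Lg Lq Ix q_cvg) subrr.
rewrite -(ipZl pi Lg Lh); congr fine; apply: ae_eq_integral => //.
- exact: mI.
- by apply/measurable_EFinP; exact: (intg_measurable (L2_mul Lq Lh)).
- by apply/measurable_EFinP; exact: (intg_measurable (L2_mul Lpg Lh)).
move: ae0; apply: filterS; first exact: (ae_filter_ringOfSetsType mu).
by move=> t qg It /=; move/subr0_eq : (qg It) => ->.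
Qed.

End parseval.

(** * Counting functions and Dirichlet series *)

Section counting.
Context (R : realType) (K : set nat).
Hypothesis hK : K `<=` [set n | (0 < n)%N].
Notation mu := (@lebesgue_measure R).
Local Notation H := (`[0, +oo[%classic : set (measurableTypeR R)).
Local Notation mH := (@measurable_H R).

Definition pcount (N : nat) (x : R) : R :=
  \sum_(1 <= n < N | n \in K) (n%:R <= x)%R%:R.

Lemma pcount_ge0 N x : 0 <= pcount N x.
Proof. by apply: sumr_ge0 => n _; rewrite ler0n. Qed.

Lemma pcount_le N x : 0 <= x -> pcount N x <= x.
Proof.
move=> x0; apply: (@le_trans _ _ (\sum_(1 <= n < N) (n%:R <= x)%R%:R)).
  rewrite /pcount big_mkcond/=; apply: ler_sum => n _.
  by case: ifP => // _; rewrite ler0n.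
elim: N => [|N IH]; first by rewrite big_geq.
case: N IH => [|N] IH; first by rewrite big_geq.
rewrite big_nat_recr//=; have [Nx|_] := leP N.+1%:R x; last by rewrite addr0.
apply: le_trans Nx; rewrite -natr1 lerD2r.
apply: (@le_trans _ _ (\sum_(1 <= n < N.+1) (1 : R))).
  by apply: ler_sum => n _; rewrite lern1 leq_b1.
by rewrite sumr_const_nat subn1.
Qed.

Lemma pcount_stable N x : x < N%:R -> pcount N x = (set_count K x)%:R.
Proof.
move=> xN.
have fin : finite_set (K `&` [set n | n%:R <= x]).
  apply: (@sub_finite_set _ _ `I_N); last exact: finite_II.
  by move=> n [_ /= nx]; rewrite -(ltr_nat R); exact: le_lt_trans nx xN.
rewrite /pcount /set_count -natr_sum; congr (_%:R).
have -> : (\sum_(1 <= n < N | n \in K) nat_of_bool (n%:R <= x)%R =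
    size [seq n <- index_iota 1 N | (n \in K) && (n%:R <= x)%R])%N.
  rewrite size_filter -sum1_count [RHS]big_mkcondr.
  by apply: eq_bigr => n _; case: (_ <= _)%R.
apply: perm_size; apply: uniq_perm.
- by rewrite filter_uniq// iota_uniq.
- exact: finmap.fset_uniq.
move=> n; rewrite mem_filter mem_index_iota in_fset_set// in_setI.
have -> : (n \in [set m : nat | m%:R <= x]) = (n%:R <= x).
  by apply/idP/idP => [/set_mem|nx]; last exact/mem_set.
have [nK|//] := boolP (n \in K); rewrite /=.
have [nx|//] := boolP (n%:R <= x); rewrite /=.
have n0 : (0 < n)%N by apply: hK; exact: set_mem.
by rewrite n0/= -(ltr_nat R) (le_lt_trans nx xN).
Qed.

Lemma measurable_pcount N : measurable_fun setT (fun y : R => pcount N (expR y)).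
Proof.
rewrite (_ : (fun y => _) = (fun y =>
    \sum_(n <- [seq n <- index_iota 1 N | n \in K]) \1_[set z : R | n%:R <= expR z] y)).
  apply: measurable_sum => n; apply: measurable_indic.
  rewrite (_ : [set _ | _] = expR @^-1` `[n%:R, +oo[); last first.
    by apply/seteqP; split => z /=; rewrite in_itv/= andbT.
  rewrite -[X in measurable X]setTI.
  by apply: (measurable_expR (measurableT : measurable [set: R])); exact: measurable_itv.
apply/funext => y; rewrite /pcount -big_filter; apply: eq_bigr => n _; rewrite indicE.
by congr ((nat_of_bool _)%:R); apply/idP/idP => [ny|/set_mem//]; exact/mem_set.
Qed.

Definition dens (y : R) : R := (set_count K (expR y))%:R * expR (- y).

Lemma pcount_cvg y : pcount N (expR y) @[N --> \oo] --> ((set_count K (expR y))%:R : R).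
Proof.
apply: cvg_near_cst; near=> N; apply: pcount_stable.
by near: N; exact: nbhs_infty_gtr.
Unshelve. all: by end_near. Qed.

Lemma dens_ge0 y : 0 <= dens y.
Proof. by rewrite mulr_ge0// expR_ge0. Qed.

Lemma dens_le1 y : dens y <= 1.
Proof.
have : (set_count K (expR y))%:R <= expR y :> R.
  rewrite -(cvg_lim (@Rhausdorff R) (@pcount_cvg y)).
  by apply: limr_le; [exact: cvgP (@pcount_cvg y)|apply: nearW => N; exact: pcount_le (expR_ge0 _)].
by rewrite /dens expRN ler_pdivrMr ?expR_gt0// mul1r.
Qed.

Lemma measurable_dens : measurable_fun setT dens.
Proof.
apply: measurable_funM.
  apply: (measurable_fun_cvg (h := fun N y => pcount N (expR y))).
    exact: measurable_pcount.
  by move=> y _; exact: pcount_cvg.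
by apply: (measurableT_comp (@measurable_expR R)); exact: measurable_funN.
Qed.

Section phase.
(** [p] and [q] stand for [cos (v * y), sin (v * y)] or for
    [sin (v * y), - cos (v * y)]: both pairs satisfy [p' = - v q]. *)
Variables (v : R) (p q q' : R -> R).
Hypothesis dp : forall y : R, is_derive y 1 p (- v * q y).
Hypothesis dq : forall y : R, is_derive y 1 q (q' y).
Hypothesis p1 : forall y, `|p y| <= 1.
Hypothesis q1 : forall y, `|q y| <= 1.

Let phi (c y : R) := expR (- (c * y)) * (c * p y + v * q y).

Let phi_le c y : 0 < c -> `|phi c y| <= (c + `|v|) * expR (- (c * y)).
Proof.
move=> c0; rewrite normrM ger0_norm ?expR_ge0// mulrC ler_wpM2r ?expR_ge0//.
rewrite (le_trans (ler_normD _ _))// !normrM (gtr0_norm c0) lerD//.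
  by rewrite ler_piMr// ltW.
by rewrite ler_piMr.
Qed.

Let phi_continuous c : continuous (phi c).
Proof.
have dE (z : R) : is_derive z 1 (phi c)
    (- c * expR (- (c * z)) * (c * p z + v * q z) +
     expR (- (c * z)) * (c * (- v * q z) + v * q' z)).
  have Dp := dp z; have Dq := dq z.
  by apply: is_derive_eq; rewrite /GRing.scale/=; ring.
exact: continuous_is_derive dE.
Qed.

Let intg_phi c a : 0 < c -> intg `[a, +oo[ (phi c).
Proof.
move=> c0; have mA : measurable (`[a, +oo[%classic : set (measurableTypeR R)) by exact: measurable_itv.
have [iE _] := expRN_integral a c0.
apply: (intg_le mA (intgZ (c + `|v|) mA iE)) => [|y _]; last exact: phi_le.
by apply: measurable_funTS; exact: continuous_measurable_fun.
Qed.

Let integral_phi c a : 0 < c ->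
  \int[mu]_(y in `[a, +oo[) phi c y = expR (- (c * a)) * p a.
Proof.
move=> c0.
have dF (z : R) : is_derive z 1 (fun y => - (expR (- (c * y)) * p y)) (phi c z).
  have Dp := dp z.
  by rewrite /phi; apply: is_derive_eq; rewrite /GRing.scale/=; ring.
rewrite (@Rintegral_FTCy _ (fun y => - (expR (- (c * y)) * p y)) (phi c) a 0 dF).
- by rewrite sub0r opprK.
- exact: phi_continuous.
- by rewrite -oppr0; apply: cvgN; exact: cvg_expRNM c0 p1.
- exact: intg_phi.
Qed.

Let integral_phi_ge c n : 0 < c -> (0 < n)%N ->
  intg H (fun y => (n%:R <= expR y)%R%:R * phi c y) /\
  \int[mu]_(y in H) ((n%:R <= expR y)%R%:R * phi c y) =
  expR (- (c * ln n%:R)) * p (ln n%:R).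
Proof.
move=> c0 n0; have ln0 : 0 <= ln n%:R :> R by rewrite ln_ge0// ler1n.
have mA : measurable (`[ln n%:R, +oo[%classic : set (measurableTypeR R)) by exact: measurable_itv.
have sub : `[ln n%:R, +oo[ `<=` H.
  by move=> y; rewrite /= !in_itv/= !andbT; exact: le_trans.
have HA : H `&` `[ln n%:R, +oo[%classic = `[ln n%:R, +oo[%classic by exact: setIidr.
have E : (fun y => (n%:R <= expR y)%R%:R * phi c y) = phi c \_ `[ln n%:R, +oo[.
  apply/funext => y; rewrite patchE; case: ifPn => [/set_mem|/negP yn].
    rewrite /= in_itv/= andbT => ny.
    by rewrite -[n%:R]lnK ?posrE ?ltr0n// ler_expR ny mul1r.
  rewrite (_ : (_ <= _) = false) ?mul0r//; apply/negbTE/negP => ny; apply: yn.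
  by apply/mem_set; rewrite /= in_itv/= andbT -ler_expR lnK ?posrE ?ltr0n.
have i := intg_phi (ln n%:R) c0.
split.
  rewrite E; have iT := (intg_mkcond _ _ mA).1 i.
  by apply: (integrableS _ _ _ iT) => //; exact: mH.
by rewrite -integral_phi// -HA Rintegral_mkcondr -E.
Qed.

(** Each integer contributes an integral over a half line that is evaluated by
    the fundamental theorem of calculus. *)
Lemma pcount_integral c N : 0 < c ->
  intg H (fun y => pcount N (expR y) * phi c y) /\
  \int[mu]_(y in H) (pcount N (expR y) * phi c y) =
  \sum_(1 <= n < N | n \in K) expR (- (c * ln n%:R)) * p (ln n%:R).
Proof.
move=> c0.
have gen : forall s : seq nat, all (fun n => (0 < n)%N) s ->
    intg H (fun y => (\sum_(n <- s) (n%:R <= expR y)%R%:R) * phi c y) /\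
    \int[mu]_(y in H) ((\sum_(n <- s) (n%:R <= expR y)%R%:R) * phi c y) =
    \sum_(n <- s) expR (- (c * ln n%:R)) * p (ln n%:R).
  elim=> [_|n s IH /= /andP[n0 /IH[i e]]].
    have E0 : (fun y => (\sum_(n <- [::]) (n%:R <= expR y)%R%:R) * phi c y) = cst 0.
      by apply/funext => y; rewrite big_nil mul0r.
    rewrite E0 [RHS]big_nil; split; first exact: integrable0.
    by rewrite Rintegral_cst ?mul0r//; exact: mH.
  have [j f] := integral_phi_ge c0 n0.
  have E : (fun y => (\sum_(n <- n :: s) (n%:R <= expR y)%R%:R) * phi c y) =
    (fun y => (n%:R <= expR y)%R%:R * phi c y +
      (\sum_(n <- s) (n%:R <= expR y)%R%:R) * phi c y).
    by apply/funext => y; rewrite big_cons mulrDl.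
  by rewrite E big_cons -e -f -(RintegralD mH j i); split => //; exact: (intgD mH j i).
have := gen [seq n <- index_iota 1 N | n \in K]; rewrite !big_filter.
have E : (fun y => pcount N (expR y) * phi c y) =
    (fun y => (\sum_(n <- [seq n <- index_iota 1 N | n \in K]) (n%:R <= expR y)%R%:R) * phi c y).
  by apply/funext => y; rewrite big_filter.
rewrite E; apply; apply/allP => n; rewrite mem_filter => /andP[nK _].
by apply: hK; exact: set_mem.
Qed.

(** Abel summation in the variable [y = ln x], with dominated convergence by
    [expR (- (d * y))]. *)
Lemma dirichlet_cvg (d : R) : 0 < d ->
  \sum_(1 <= n < N | n \in K) expR (- ((1 + d) * ln n%:R)) * p (ln n%:R) @[N --> \oo] -->
  \int[mu]_(y in H) (dens y * expR (- (d * y)) * ((1 + d) * p y + v * q y)).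
Proof.
move=> d0; have c0 : 0 < 1 + d by rewrite addr_gt0.
have [_ cv] : intg H (fun y => (set_count K (expR y))%:R * phi (1 + d) y) /\
    \int[mu]_(y in H) (pcount N (expR y) * phi (1 + d) y) @[N --> \oo] -->
    \int[mu]_(y in H) ((set_count K (expR y))%:R * phi (1 + d) y).
  apply: (@Rdominated_cvg _ _ _ mu H _ _ (fun y => (1 + d + `|v|) * expR (- (d * y))) mH).
  - move=> N; exact: (intg_measurable (pcount_integral N c0).1).
  - by move=> y _; apply: cvgM; [exact: pcount_cvg|exact: cvg_cst].
  - by apply: intgZ; [exact: mH|have [] := expRN_integral 0 d0].
  - move=> N y _; rewrite normrM (ger0_norm (pcount_ge0 _ _)).
    apply: (le_trans (ler_pM (pcount_ge0 _ _) (normr_ge0 _) (pcount_le _ (expR_ge0 _)) (phi_le _ c0))).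
    rewrite mulrCA -expRD le_eqVlt; apply/orP; left; apply/eqP.
    by congr (_ * expR _); ring.
rewrite (_ : (fun N => _) = (fun N => \int[mu]_(y in H) (pcount N (expR y) * phi (1 + d) y))); last first.
  by apply/funext => N; rewrite (pcount_integral N c0).2.
rewrite (_ : Rintegral _ _ _ = \int[mu]_(y in H) ((set_count K (expR y))%:R * phi (1 + d) y))//.
apply: eq_Rintegral => y _; rewrite /dens /phi mulrA; congr (_ * _).
by rewrite -mulrA -expRD; congr (_ * expR _); ring.
Qed.

End phase.

End counting.

(** * The zeta function as a Laplace transform *)

Import ComplexField.
Local Open Scope complex_scope.

Section zeta.
Context (R : realType).
Notation mu := (@lebesgue_measure R).
Local Notation H := (`[0, +oo[%classic : set (measurableTypeR R)).
Local Notation mH := (@measurable_H R).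
Local Notation Re := (@complex.Re _).
Local Notation Im := (@complex.Im _).

Lemma normc_le (x y : R) : `|x +i* y| <= (`|x| + `|y|)%:C.
Proof.
rewrite normc_def/= lecR -[leRHS]ger0_norm ?addr_ge0// -sqrtr_sqr.
rewrite ler_wsqrtr// sqrrD !real_normK ?num_real// -addrA lerD2l lerDr.
by rewrite mulrn_wge0// mulr_ge0.
Qed.

Lemma cvg_complex (u : nat -> R[i]) (a b : R) :
  Re (u n) @[n --> \oo] --> a -> Im (u n) @[n --> \oo] --> b ->
  (u n : R[i]^o) @[n --> \oo] --> (a +i* b : R[i]^o).
Proof.
move=> ua ub; apply/cvgrPdist_lt => e e0.
have : exists2 r : R, 0 < r & e = r%:C.
  by case: e e0 => x y; rewrite ltcE/= => /andP[/eqP-> x0]; exists x.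
move=> [r r0 ->].
have r2 : 0 < r / 2 by rewrite divr_gt0.
move/cvgrPdist_lt : ua => /(_ _ r2); move/cvgrPdist_lt : ub => /(_ _ r2).
apply: filterS2 => n bn an.
have -> : (a +i* b : R[i]^o) - u n = ((a - Re (u n)) +i* (b - Im (u n))).
  by case: (u n).
by rewrite (le_lt_trans (normc_le _ _))// ltcR [ltRHS]splitr ltrD.
Qed.

Lemma nat_cpowE (n : nat) (x y : R) : nat_cpow n (- (x +i* y)) =
  (expR (- (x * ln n%:R)) * cos (y * ln n%:R)) +i* (- (expR (- (x * ln n%:R)) * sin (y * ln n%:R))).
Proof.
rewrite /nat_cpow /cexp /= !mulr0 subr0 add0r.
rewrite !mulNr cosN sinN.
by apply/eqP; rewrite eq_complex/= !mul0r subr0 addr0 mulrN !eqxx.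
Qed.

(** At [s = 1 + d + i v] the zeta function is [s] times the Laplace transform of
    [dens K] at [s - 1]; the second factor is the real part of
    [s * exp (- i v y)]. *)
Lemma Re_zeta (K : set nat) (d v : R) : K `<=` [set n | (0 < n)%N] -> 0 < d ->
  Re (zeta_set K ((1 + d) +i* v)) =
  \int[mu]_(y in H) (dens K y * expR (- (d * y)) * ((1 + d) * cos (v * y) + v * sin (v * y))).
Proof.
move=> hK d0.
have dcos (y : R) : is_derive y 1 (fun y => cos (v * y)) (- v * sin (v * y)).
  by apply: is_derive_eq; rewrite /GRing.scale/=; ring.
have dsin (y : R) : is_derive y 1 (fun y => sin (v * y)) (v * cos (v * y)).
  by apply: is_derive_eq; rewrite /GRing.scale/=; ring.
have dsin' (y : R) : is_derive y 1 (fun y => sin (v * y)) (- v * - cos (v * y)).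
  by apply: is_derive_eq; rewrite /GRing.scale/=; ring.
have dcos' (y : R) : is_derive y 1 (fun y => - cos (v * y)) (v * sin (v * y)).
  by apply: is_derive_eq; rewrite /GRing.scale/=; ring.
have c1 y : `|cos (v * y)| <= 1 by exact: cos_max.
have s1 y : `|sin (v * y)| <= 1 by exact: sin_max.
have c1' y : `|- cos (v * y)| <= 1 by rewrite normrN; exact: cos_max.
have rc := dirichlet_cvg hK dcos dsin c1 s1 d0.
have ic := dirichlet_cvg hK dsin' dcos' s1 c1' d0.
pose u (N : nat) : R[i] := \sum_(1 <= n < N | n \in K) nat_cpow n (- ((1 + d) +i* v)).
have Reu : (fun N => Re (u N)) = (fun N => \sum_(1 <= n < N | n \in K)
    expR (- ((1 + d) * ln n%:R)) * cos (v * ln n%:R)).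
  apply/funext => N; rewrite (big_morph Re (@ReD R) erefl).
  by apply: eq_bigr => n _; rewrite nat_cpowE.
have Imu : (fun N => Im (u N)) = (fun N => - (\sum_(1 <= n < N | n \in K)
    expR (- ((1 + d) * ln n%:R)) * sin (v * ln n%:R))).
  apply/funext => N; rewrite (big_morph Im (@ImD R) erefl) -sumrN.
  by apply: eq_bigr => n _; rewrite nat_cpowE.
rewrite -Reu in rc; move/cvgN in ic; rewrite -[X in X @ _]Imu in ic.
exact: (congr1 Re (cvg_lim (@norm_hausdorff _ _) (cvg_complex rc ic))).
Qed.

End zeta.

(** * The limit of the regularized operators *)

Lemma damp_arith (R : realFieldType) (d z : R) : 0 <= d -> 0 <= z ->
  d + z + z <= 2 * (2 * z + d).
Proof. lra. Qed.

Lemma le1_arith (R : realFieldType) : `|1 : R| + `|0 : R| <= 1.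
Proof. by rewrite normr1 normr0 addr0. Qed.

Lemma le1_arith' (R : realFieldType) : `|0 : R| + `|1 : R| <= 1.
Proof. by rewrite normr1 normr0 add0r. Qed.

Section symbol.
Context (R : realType) (T : R).
Hypothesis T0 : 0 < T.
Notation mu := (@lebesgue_measure R).
Local Notation I := (sym_itv T).
Local Notation H := (`[0, +oo[%classic : set (measurableTypeR R)).
Implicit Types (g h w u : R -> R).
Local Notation L2 := (L2 T).
Local Notation sqn := (sqn T).
Local Notation ip := (ip T).
Local Notation ctr := (ctr T).
Local Notation str := (str T).
Local Notation wform := (wform T).
Local Notation mI := (measurable_I T).
Local Notation mH := (@measurable_H R).
Local Notation Ed := (fun d y : R => expR (- (d * y))).
Local Notation cst0 := (fun _ : R => 0 : R).
Local Notation cst1 := (fun _ : R => 1 : R).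
Local Notation int g := (\int[mu]_(t in I) g t).

Lemma conjugate_poissonE (d v : R) : 0 < d ->
  sinint (Ed d) v = v / (d ^+ 2 + v ^+ 2).
Proof.
move=> d0; have dv0 : d ^+ 2 + v ^+ 2 != 0.
  by rewrite gt_eqF// ltr_wpDr ?sqr_ge0// exprn_gt0.
pose F y := expR (- (d * y)) * (- (d * sin (v * y) + v * cos (v * y)) / (d ^+ 2 + v ^+ 2)).
have dF (x : R) : is_derive x 1 F (expR (- (d * x)) * sin (v * x)).
  by apply: is_derive_eq; rewrite /GRing.scale/=; field.
rewrite /sinint (@Rintegral_FTCy _ F _ 0 0 dF).
- by rewrite /F !mulr0 oppr0 expR0 cos0 sin0; field.
- have dE (x : R) : is_derive x 1 (fun x : R => expR (- (d * x)) * sin (v * x))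
      (- expR (- (d * x)) * (d * sin (v * x) - v * cos (v * x))).
    by apply: is_derive_eq; rewrite /GRing.scale/=; ring.
  exact: continuous_is_derive dE.
- apply: (@cvg_expRNM _ _ ((`|d| + `|v|) / (d ^+ 2 + v ^+ 2))) => // x.
  rewrite normrM normrN [X in _ * X]ger0_norm ?invr_ge0 ?addr_ge0 ?sqr_ge0//.
  rewrite ler_wpM2r ?invr_ge0 ?addr_ge0 ?sqr_ge0//.
  rewrite (le_trans (ler_normD _ _))// !normrM lerD// ler_piMr//.
    exact: sin_max.
  exact: cos_max.
- by apply: intg_sinH; have [] := expRN_integral 0 d0.
Qed.

Lemma ip_cvg (f : R -> R -> R) q h :
  (forall d, 0 < d -> L2 (f d)) -> L2 q -> L2 h ->
  sqn (fun t => f d t - q t) @[d --> 0^'+] --> (0 : R) ->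
  ip (f d) h @[d --> 0^'+] --> ip q h.
Proof.
move=> Lf Lq Lh fq.
have Lfq : \forall d \near 0^'+, L2 (fun t => f d t - q t).
  by near=> d; apply: L2B => //; apply: Lf; near: d; exact: nbhs_right_gt.
apply/subr_cvg0; apply: cvg_trans (ip_cvg0 Lfq Lh fq).
apply: near_eq_cvg; near=> d; rewrite ipBl//; apply: Lf; near: d; exact: nbhs_right_gt.
Unshelve. all: by end_near. Qed.

Let intgE d : 0 < d -> intg H (Ed d).
Proof. by move=> d0; have [] := expRN_integral 0 d0. Qed.

Let mz : measurable_fun setT cst0. Proof. by []. Qed.
Let mo : measurable_fun setT cst1. Proof. by []. Qed.

Let damp_1 d y : 0 < d -> 0 <= y -> `|Ed d y - 1| <= 1 * damp d y.
Proof.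
move=> d0 y0; have e0 : 0 <= 1 - Ed d y.
  by rewrite subr_ge0 -expR0 ler_expR oppr_le0; apply: mulr_ge0 => //; exact: ltW.
rewrite distrC (ger0_norm e0) mul1r /damp; move: e0; move: (1 - _) => z z0.
by rewrite mulr_natl mulr2n -addrA lerDl; apply: addr_ge0 => //; exact: ltW.
Qed.

(** The second half of the symbol [1] contributes a rank one form: its
    regularization has the kernel [v ^+ 2 / (d ^+ 2 + v ^+ 2)], which tends to
    [1]. *)
Lemma form01 g h : L2 g -> L2 h ->
  \int[mu]_(y in H) wform cst0 cst1 g h y = int g * int h.
Proof.
move=> Lg Lh; have i0 (d : R) : 0 < d -> intg H cst0 by move=> _; exact: (intg0 mH).
have mE := @measurable_expRN R.
have hM0 (y : R) : 0 <= y -> `|0 : R| + `|1 : R| <= 1.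
  by move=> _; rewrite normr0 normr1 add0r.
have hM1 (y : R) : 0 <= y -> `|1 : R| + `|0 : R| <= 1.
  by move=> _; rewrite normr0 normr1 addr0.
have hw0 d y : 0 < d -> 0 <= y -> `|0 - 0 : R| + `|Ed d y - 1| <= 1 * damp d y.
  by move=> d0 y0; rewrite subrr normr0 add0r; exact: damp_1.
have hw1 d y : 0 < d -> 0 <= y -> `|Ed d y - 1| + `|0 - 0 : R| <= 1 * damp d y.
  by move=> d0 y0; rewrite subrr normr0 addr0; exact: damp_1.
have [q0 [Lq0 q0E q0_cvg]] := 
  @weak_limit _ _ T0 (fun=> cst0) Ed cst0 cst1 1 ltr01 i0 intgE (fun=> mz) mE mz mo hM0 hw0 g Lg.
have [q1 [Lq1 _ q1_cvg]] := 
  @weak_limit _ _ T0 Ed (fun=> cst0) cst1 cst0 1 ltr01 intgE i0 mE (fun=> mz) mo mz hM1 hw1 g Lg.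
have [_ <-] := q0E h Lh.
have L0 d : 0 < d -> L2 (kop T cst0 (Ed d) g).
  by move=> d0; exact: (L2_kop T0 (i0 d d0) (intgE d0) Lg).
have L1 d : 0 < d -> L2 (kop T (Ed d) cst0 g).
  by move=> d0; exact: (L2_kop T0 (intgE d0) (i0 d d0) Lg).
have c0 : ip (kop T cst0 (Ed d) g) h @[d --> 0^'+] --> ip q0 h.
  exact: (ip_cvg L0 Lq0 Lh q0_cvg).
have c1 : ip (kop T (Ed d) cst0 g) h @[d --> 0^'+] --> ip q1 h.
  exact: (ip_cvg L1 Lq1 Lh q1_cvg).
have e d : 0 < d -> ip (kop T cst0 (Ed d) g) h =
    int g * int h - d * ip (kop T (Ed d) cst0 g) h.
  move=> d0; have ig := L2_int T0 Lg.
  have LK := L1 d d0; have Lc := L2_cst T0 (int g).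
  have kE : kop T cst0 (Ed d) g = fun t => int g - d * kop T (Ed d) cst0 g t.
    apply/funext => t; rewrite kop_poisson//.
    have iP : intg I (fun s => g s * (d / (d ^+ 2 + (t - s) ^+ 2))).
      apply: (intgM_bounded mI ig (B := d^-1)).
        apply: measurable_funTS.
        apply: (measurableT_comp (continuous_measurable_fun (poisson_continuous d0))).
        exact: measurable_funB.
      by move=> s _; rewrite ger0_norm ?poisson_ge0// poisson_le.
    rewrite -(RintegralZl d mI iP) -(RintegralB mI ig (intgZ d mI iP)).
    apply: eq_Rintegral => s _; rewrite /kern conjugate_poissonE//.
    rewrite /cosint (_ : (fun _ => _) = cst 0); last first.
      by apply/funext => y; rewrite mul0r.
    rewrite Rintegral_cst; last exact: mH.
    by field; rewrite gt_eqF// ltr_wpDr ?sqr_ge0// exprn_gt0.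
  rewrite kE (ipBl Lc (L2Z d LK) Lh) (ipZl d LK Lh); congr (_ - _).
  by rewrite /Submission.ip (RintegralZl _ mI (L2_int T0 Lh)).
have c : ip (kop T cst0 (Ed d) g) h @[d --> 0^'+] --> int g * int h - 0 * ip q1 h.
  have : int g * int h - d * ip (kop T (Ed d) cst0 g) h @[d --> 0^'+] -->
      int g * int h - 0 * ip q1 h.
    apply: cvgB; first exact: cvg_cst.
    by apply: cvgM => //; apply: cvg_at_right_filter; exact: cvg_id.
  apply: cvg_trans; apply: near_eq_cvg; near=> d.
  have d0 : 0 < d by near: d; exact: nbhs_right_gt.
  by rewrite (e d d0).
rewrite mul0r subr0 in c.
by rewrite -(cvg_lim (@Rhausdorff R) c0); apply/cvg_lim.
Unshelve. all: by end_near. Qed.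

Section density.
(** [D] is the normalized counting function, [A] its expected limit. *)
Variables (D : R -> R) (A : R).
Hypothesis mD : measurable_fun setT D.
Hypothesis D_ge0 : forall y, 0 <= D y.
Hypothesis D_le1 : forall y, D y <= 1.

Local Notation E := (fun y => D y - A).

Definition wA0 d y := (1 + d) * (D y * expR (- (d * y))).
Definition wA1 d y := D y * expR (- (d * y)).

Let i1 d : 0 < d -> intg H (wA1 d).
Proof.
move=> d0; have := intgM_bounded mH (intgE d0) (measurable_funTS mD) (B := 1).
have h y : H y -> `|D y| <= 1 by move=> _; rewrite ger0_norm.
by move=> /(_ h); apply: eq_integrable => // y _ /=; rewrite /wA1 mulrC.
Qed.

Let m1 d : measurable_fun setT (wA1 d).
Proof. by apply: measurable_funM => //; exact: measurable_expRN. Qed.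

Let hM y : 0 <= y -> `|D y| + `|D y| <= 2.
Proof. by move=> _; rewrite ger0_norm// -[2]/(1 + 1) lerD. Qed.

Let hw d y : 0 < d -> 0 <= y ->
  `|wA0 d y - D y| + `|wA1 d y - D y| <= 2 * damp d y.
Proof.
move=> d0 y0; have e0 : 0 <= 1 - expR (- (d * y)).
  by rewrite subr_ge0 -expR0 ler_expR oppr_le0; apply: mulr_ge0 => //; exact: ltW.
have e1 : expR (- (d * y)) <= 1 by rewrite -subr_ge0.
have h1 : `|wA1 d y - D y| <= 1 - expR (- (d * y)).
  rewrite distrC (_ : D y - wA1 d y = D y * (1 - expR (- (d * y)))); last first.
    by rewrite /wA1; ring.
  by rewrite ger0_norm ?mulr_ge0// ler_piMl.
have h2 : `|wA0 d y - D y| <= d + (1 - expR (- (d * y))).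
  rewrite (_ : wA0 d y - D y = d * (D y * expR (- (d * y))) + (wA1 d y - D y)); last first.
    by rewrite /wA0 /wA1; ring.
  apply: (le_trans (ler_normD _ _)); apply: lerD => //.
  rewrite ger0_norm; last by rewrite !mulr_ge0 ?expR_ge0// ltW.
  by apply: ler_piMr; [exact: ltW|apply: mulr_ile1 => //; exact: expR_ge0].
apply: (le_trans (lerD h2 h1)); apply: damp_arith => //; exact: ltW.
Qed.

Lemma intg_wA d : 0 < d -> intg H (wA0 d) /\ intg H (wA1 d).
Proof. by move=> d0; split; [exact: intgZ mH (i1 d0)|exact: i1]. Qed.

(** The constant part [A] of the symbol is evaluated by Parseval's identity for
    its cosine half and by a rank one form for its sine half; only the
    deviation [E] remains under the integral. *)
Lemma symbol_limit g : L2 g -> exists q, [/\ L2 q,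
  sqn (fun t => kop T (wA0 d) (wA1 d) g t - q t) @[d --> 0^'+] --> (0 : R) &
  forall h, L2 h -> intg H (wform E E g h) /\
    ip q h = A * (pi * ip g h) + A * (int g * int h) + \int[mu]_(y in H) wform E E g h y].
Proof.
move=> Lg.
have i0 d : 0 < d -> intg H (wA0 d) by move=> d0; exact: intgZ mH (i1 d0).
have m0 d : measurable_fun setT (wA0 d).
  by apply: measurable_funM => //; exact: m1.
have [q [Lq qE q_cvg]] := @weak_limit _ _ T0 wA0 wA1 D D 2 (ltr0Sn R 1)
  i0 i1 m0 m1 mD mD hM hw g Lg.
exists q; split => // h Lh.
have [iDD ->] := qE h Lh.
have [iF _] := @form_dominated _ _ T0 cst1 cst0 cst1 1 g h 1 ltr01 mo mz mo
  (fun y _ => le1_arith R) (fun y _ => lexx 1) Lg Lh.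
have [iG _] := @form_dominated _ _ T0 cst0 cst1 cst1 1 g h 1 ltr01 mz mo mo
  (fun y _ => le1_arith' R) (fun y _ => lexx 1) Lg Lh.
have iAFG := intgD mH (intgZ A mH iF) (intgZ A mH iG).
have EE : wform E E g h = fun y => wform D D g h y - (A * wform cst1 cst0 g h y + A * wform cst0 cst1 g h y).
  by apply/funext => y; rewrite /Submission.wform; ring.
have iEE : intg H (wform E E g h) by rewrite EE; exact: (intgB mH iDD iAFG).
split => //.
rewrite EE (RintegralB mH iDD iAFG) (RintegralD mH (intgZ A mH iF) (intgZ A mH iG)).
rewrite (RintegralZl A mH iF) (RintegralZl A mH iG) (form01 Lg Lh).
have -> : \int[mu]_(y in H) wform cst1 cst0 g h y = pi * ip g h.
  rewrite -(parseval T0 Lg Lh); apply: eq_Rintegral => y _.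
  by rewrite /Submission.wform; ring.
by rewrite addrC subrK.
Qed.

End density.

End symbol.

(** * Real and imaginary parts in the quotient space *)

Local Open Scope quotient_scope.

Section integral_mrestr.
Context d (X : measurableType d) (R : realType).
Variables (mu : {measure set X -> \bar R}) (D : set X) (mD : measurable D).
Import HBNNSimple.
Local Open Scope ereal_scope.

Let sfun (h : {nnsfun X >-> R}) :
  \int[mrestr mu mD]_x (h x)%:E = \int[mu]_(x in D) (h x)%:E.
Proof.
have hE x : (h x)%:E = \sum_(k \in range h) k%:E * (\1_(h @^-1` [set k]) x)%:E.
  by rewrite fsumEFin //= fimfunE.
have -> : (fun x => (h x)%:E) = _ := funext hE.
have mk r : measurable_fun setT (fun x => r%:E * (\1_(h @^-1` [set r]) x)%:E).
  exact/measurable_EFinP/measurableT_comp.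
rewrite ge0_integral_fsum//; last by move=> r x _; exact: nnfun_muleindic_ge0.
rewrite ge0_integral_fsum//; last 2 first.
- by move=> r; exact: measurable_funTS.
- by move=> r x _; exact: nnfun_muleindic_ge0.
apply: eq_fsbigr => r; rewrite inE => -[z _ <-].
have m1 : measurable_fun setT (EFin \o (\1_(h @^-1` [set h z]) : X -> R)).
  exact/measurable_EFinP.
rewrite ge0_integralZl//; last by rewrite lee_fin.
rewrite ge0_integralZl//; last 2 first.
- exact: measurable_funTS.
- by rewrite lee_fin.
by rewrite !integral_indic//= setIT.
Qed.

(** Approximation by simple functions, for which both sides are sums of
    measures. *)
Lemma integral_mrestr (f : X -> \bar R) : measurable_fun setT f ->
  (forall x, 0 <= f x) -> \int[mrestr mu mD]_x f x = \int[mu]_(x in D) f x.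
Proof.
move=> mf f0; pose g := nnsfun_approx measurableT mf.
have fE x : f x = limn (fun n => (g n x)%:E).
  by apply/esym/cvg_lim => //; exact: cvg_nnsfun_approx.
have -> : f = _ := funext fE.
have mg n : measurable_fun setT (fun x => (g n x)%:E) by exact/measurable_EFinP.
have g0 n x : 0 <= (g n x)%:E by rewrite lee_fin.
have nd x : {homo (fun n => (g n x)%:E) : a b / (a <= b)%N >-> a <= b}.
  by move=> a b ab; rewrite lee_fin; exact/lefP/nd_nnsfun_approx.
rewrite monotone_convergence//; rewrite monotone_convergence//.
- by congr (limn _); apply/funext => n; exact: sfun.
- by move=> n; exact: measurable_funTS.
Qed.

End integral_mrestr.

Section bridge.
Context (R : realType) (T : R).
Hypothesis T0 : 0 < T.
Notation mu := (@lebesgue_measure R).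
Local Notation muI := (mrestr (@lebesgue_measure R) (measurable_sym_itv T)).
Local Notation I := (sym_itv T).
Local Notation L2 := (L2 T).
Local Notation sqn := (sqn T).
Local Notation ip := (ip T).
Local Notation mI := (measurable_I T).
Local Notation Re := (@complex.Re _).
Local Notation Im := (@complex.Im _).
Local Notation normc := (@Normc.normc _).

Lemma integral_muI (f : R -> \bar R) : measurable_fun setT f ->
  (forall x, 0 <= f x)%E -> (\int[muI]_x f x = \int[mu]_(x in I) f x)%E.
Proof. by move=> mf f0; exact: integral_mrestr. Qed.

Lemma sqr_poweR2 (x : R) : (`|x%:E| `^ 2)%E = (x ^+ 2)%:E.
Proof. by rewrite /= powR_mulrn// real_normK ?num_real. Qed.

Lemma normc_sq (z : R[i]) : normc z ^+ 2 = Re z ^+ 2 + Im z ^+ 2.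
Proof. by case: z => x y; rewrite /= sqr_sqrtr// addr_ge0// sqr_ge0. Qed.

Lemma Lnorm2_sq (f : R -> R[i]) :
  measurable_fun setT (Re \o f) -> measurable_fun setT (Im \o f) ->
  (Lnorm muI 2%:E (EFin \o (normc \o f)) `^ 2 =
   \int[mu]_(t in I) ((Re (f t)) ^+ 2 + (Im (f t)) ^+ 2)%:E)%E.
Proof.
move=> mr mi; rewrite powR_Lnorm// -integral_muI.
- by apply: eq_integral => t _; rewrite sqr_poweR2/= normc_sq.
- by apply/measurable_EFinP/measurable_funD; exact: measurable_funX.
- by move=> t; rewrite lee_fin addr_ge0// sqr_ge0.
Qed.

Lemma sqn_sum_fin (f : R -> R[i]) : L2 (Re \o f) -> L2 (Im \o f) ->
  (\int[mu]_(t in I) ((Re (f t)) ^+ 2 + (Im (f t)) ^+ 2)%:E)%E =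
  (sqn (Re \o f) + sqn (Im \o f))%:E.
Proof.
move=> [_ ir] [_ ii]; rewrite -(RintegralD mI ir ii) /Rintegral fineK//.
exact: (integrable_fin_num mI (intgD mI ir ii)).
Qed.

Lemma cL2_setP (f : R -> R[i]) : cL2_set muI f <-> L2 (Re \o f) /\ L2 (Im \o f).
Proof.
split.
- move=> [mr mi nf]; have E := Lnorm2_sq mr mi.
  have lty : (\int[mu]_(t in I) ((Re (f t)) ^+ 2 + (Im (f t)) ^+ 2)%:E < +oo)%E.
    by rewrite -E; exact: poweR_lty.
  have part (g h : R -> R) : measurable_fun setT g -> measurable_fun setT h ->
    (\int[mu]_(t in I) (g t ^+ 2 + h t ^+ 2)%:E < +oo)%E -> L2 g.
    move=> mg mh gh; split => //; apply/integrableP; split.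
      by apply/measurable_EFinP; apply: measurable_funTS; exact: measurable_funX.
    apply: le_lt_trans gh.
    have -> : (\int[mu]_(t in I) `|(g t ^+ 2)%:E| = \int[mu]_(t in I) (g t ^+ 2)%:E)%E.
      by apply: eq_integral => t _; rewrite gee0_abs// lee_fin sqr_ge0.
    apply: ge0_le_integral.
    - exact: mI.
    - by move=> t _; rewrite lee_fin sqr_ge0.
    - by apply/measurable_EFinP; apply: measurable_funTS; exact: measurable_funX.
    - by apply/measurable_EFinP; apply: measurable_funTS; apply: measurable_funD; exact: measurable_funX.
    - by move=> t _; rewrite lee_fin lerDl sqr_ge0.
  split; first exact: part mi lty.
  apply: part mi mr _; move: lty.
  by congr (_ < _)%E; apply: eq_integral => t _; rewrite addrC.
- move=> [Lr Li]; have [mr _] := Lr; have [mi _] := Li; split => //.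
  have := Lnorm2_sq mr mi; rewrite sqn_sum_fin//.
  have := Lnorm_ge0 muI 2%:E (EFin \o (normc \o f)); rewrite /finite_norm.
  move: (Lnorm muI 2%:E _) => -[r _ _|_|//]; first exact: ltry.
  by rewrite poweRyr ?pnatr_eq0.
Qed.

Lemma cL2fun_L2 (f : cL2fun muI) : L2 (Re \o val f) /\ L2 (Im \o val f).
Proof. by apply/cL2_setP; have := valP f; rewrite inE. Qed.

Lemma cL2fun_norm_sq (f : cL2fun muI) :
  cL2fun_norm f ^+ 2 = sqn (Re \o val f) + sqn (Im \o val f).
Proof.
have [Lr Li] := cL2fun_L2 f; have [mr _] := Lr; have [mi _] := Li.
have := Lnorm2_sq mr mi; rewrite sqn_sum_fin// -cL2fun_norm_fin.
move=> /(congr1 fine) /= <-.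
by rewrite powR_mulrn// /cL2fun_norm fine_ge0// Lnorm_ge0.
Qed.

Lemma cL2fun_norm_ge0 (f : cL2fun muI) : 0 <= cL2fun_norm f.
Proof. by rewrite /cL2fun_norm fine_ge0// Lnorm_ge0. Qed.

Section mk.
Variables (a b : R -> R) (La : L2 a) (Lb : L2 b).

Lemma mk_proof : (fun t => a t +i* b t) \in cL2_pred muI.
Proof. by rewrite inE; apply/cL2_setP. Qed.

(** Vectors are built from their real and imaginary parts, so that the analysis
    is done on real functions. *)
Definition mkcL2 : cL2fun muI := exist _ (fun t => a t +i* b t) mk_proof.

End mk.

Definition rep (u : cL2 muI) : R -> R[i] := val (repr u).
Definition rre (u : cL2 muI) : R -> R := Re \o rep u.
Definition rim (u : cL2 muI) : R -> R := Im \o rep u.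

Lemma L2_rre u : L2 (rre u). Proof. by have [] := cL2fun_L2 (repr u). Qed.
Lemma L2_rim u : L2 (rim u). Proof. by have [] := cL2fun_L2 (repr u). Qed.

(** Real part of the inner product. *)
Definition rip (u w : cL2 muI) := ip (rre u) (rre w) + ip (rim u) (rim w).

Definition rnorm (u : cL2 muI) := cL2fun_norm (repr u).

Lemma normE (u : cL2 muI) : `|u| = (rnorm u)%:C. Proof. by []. Qed.

Lemma rnorm_ge0 u : 0 <= rnorm u. Proof. exact: cL2fun_norm_ge0. Qed.

Lemma rnorm_sq u : rnorm u ^+ 2 = rip u u.
Proof. exact: cL2fun_norm_sq. Qed.

Lemma ae2 (P Q S : R -> Prop) : {ae mu, forall t, P t} -> {ae mu, forall t, Q t} ->
  (forall t, P t -> Q t -> S t) -> {ae mu, forall t, S t}.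
Proof.
move=> aP aQ PQS; move: aP aQ; apply: filterS2; first exact: (ae_filter_ringOfSetsType mu).
exact: PQS.
Qed.

Lemma ae_all (P : R -> Prop) : (forall t, P t) -> {ae mu, forall t, P t}.
Proof. by move=> aP; exact: aeW. Qed.

Lemma ae_muI (P : R -> Prop) : {ae muI, forall t, P t} -> {ae mu, forall t, I t -> P t}.
Proof.
move=> [N [mN N0 PN]]; exists (N `&` I); split.
- exact: (@measurableI _ (measurableTypeR R) _ _ mN mI).
- exact: N0.
- by move=> t /= /not_implyP[It nP]; split => //; exact: PN.
Qed.

Lemma eq_ip g g' h h' : L2 g -> L2 g' -> L2 h -> L2 h' ->
  {ae mu, forall t, I t -> g t = g' t} -> {ae mu, forall t, I t -> h t = h' t} ->
  ip g h = ip g' h'.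
Proof.
move=> Lg Lg' Lh Lh' gg hh; congr fine; apply: ae_eq_integral.
- exact: mI.
- by apply/measurable_EFinP; exact: (intg_measurable (L2_mul Lg Lh)).
- by apply/measurable_EFinP; exact: (intg_measurable (L2_mul Lg' Lh')).
by apply: (ae2 gg hh) => t gg' hh' It /=; rewrite gg'// hh'.
Qed.

Lemma rep_pi (f : cL2fun muI) :
  {ae mu, forall t, I t -> rep (cL2_pi f) t = val f t}.
Proof. exact/ae_muI/repr_cL2_pi. Qed.

Lemma rre_pi (f : cL2fun muI) :
  {ae mu, forall t, I t -> rre (cL2_pi f) t = Re (val f t)}.
Proof. by apply: (ae2 (rep_pi f) (rep_pi f)) => t ft _ It; rewrite /rre/= ft. Qed.

Lemma rim_pi (f : cL2fun muI) :
  {ae mu, forall t, I t -> rim (cL2_pi f) t = Im (val f t)}.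
Proof. by apply: (ae2 (rep_pi f) (rep_pi f)) => t ft _ It; rewrite /rim/= ft. Qed.

Lemma rip_pi (f : cL2fun muI) u :
  rip (cL2_pi f) u = ip (Re \o val f) (rre u) + ip (Im \o val f) (rim u).
Proof.
have [Lr Li] := cL2fun_L2 f; have Lu := L2_rre u; have Lu' := L2_rim u.
rewrite /rip (eq_ip (L2_rre _) Lr Lu Lu (rre_pi f)); last exact: ae_all.
by rewrite (eq_ip (L2_rim _) Li Lu' Lu' (rim_pi f))//; exact: ae_all.
Qed.

End bridge.

(** * Hilbert space structure of the quotient *)

Section hilbert.
Context (R : realType) (T : R).
Hypothesis T0 : 0 < T.
Notation mu := (@lebesgue_measure R).
Local Notation muI := (mrestr (@lebesgue_measure R) (measurable_sym_itv T)).
Local Notation I := (sym_itv T).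
Local Notation L2 := (L2 T).
Local Notation sqn := (sqn T).
Local Notation ip := (ip T).
Local Notation mI := (measurable_I T).
Local Notation Re := (@complex.Re _).
Local Notation Im := (@complex.Im _).
Implicit Types (u v w : cL2 muI).

Lemma rep_comb (a : R[i]) u v :
  {ae mu, forall t, I t -> rep (a *: u + v) t = a * rep u t + rep v t}.
Proof.
have -> : a *: u + v = cL2_pi (a *: repr u + repr v).
  by rewrite cL2_piD cL2_piK; congr (_ + _); rewrite -[u in LHS]cL2_piK; exact: cL2_piZ.
apply: (ae2 (rep_pi (a *: repr u + repr v)) (rep_pi (a *: repr u + repr v))) => t + _ It => ->//.
Qed.

Lemma rre_comb (a : R[i]) u v :
  {ae mu, forall t, I t -> rre (a *: u + v) t = Re a * rre u t - Im a * rim u t + rre v t}.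
Proof.
apply: (ae2 (rep_comb a u v) (rep_comb a u v)) => t e _ It.
by rewrite /rre/= e// Defs.ReD Defs.ReM.
Qed.

Lemma rim_comb (a : R[i]) u v :
  {ae mu, forall t, I t -> rim (a *: u + v) t = Re a * rim u t + Im a * rre u t + rim v t}.
Proof.
apply: (ae2 (rep_comb a u v) (rep_comb a u v)) => t e _ It.
by rewrite /rim/= e// Defs.ImD Defs.ImM.
Qed.

Lemma ip_rre_comb (a : R[i]) u v h : L2 h ->
  ip (rre (a *: u + v)) h = Re a * ip (rre u) h - Im a * ip (rim u) h + ip (rre v) h.
Proof.
move=> Lh; have Lu := L2_rre u; have Lu' := L2_rim u; have Lv := L2_rre v.
have L1 := L2Z (Re a) Lu; have L2' := L2Z (Im a) Lu'.
rewrite (eq_ip (L2_rre _) (L2D (L2B L1 L2') Lv) Lh Lh (rre_comb a u v) (ae_all (fun t _ => erefl))).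
by rewrite (ipDl (L2B L1 L2') Lv Lh) (ipBl L1 L2' Lh) (ipZl _ Lu Lh) (ipZl _ Lu' Lh).
Qed.

Lemma ip_rim_comb (a : R[i]) u v h : L2 h ->
  ip (rim (a *: u + v)) h = Re a * ip (rim u) h + Im a * ip (rre u) h + ip (rim v) h.
Proof.
move=> Lh; have Lu := L2_rre u; have Lu' := L2_rim u; have Lv := L2_rim v.
have L1 := L2Z (Re a) Lu'; have L2' := L2Z (Im a) Lu.
rewrite (eq_ip (L2_rim _) (L2D (L2D L1 L2') Lv) Lh Lh (rim_comb a u v) (ae_all (fun t _ => erefl))).
by rewrite (ipDl (L2D L1 L2') Lv Lh) (ipDl L1 L2' Lh) (ipZl _ Lu Lh) (ipZl _ Lu' Lh).
Qed.

Lemma rnorm_subC u v : rnorm (u - v) = rnorm (v - u).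
Proof. by have /(congr1 Re) := distrC u v. Qed.

Lemma rnormD u v : rnorm (u + v) <= rnorm u + rnorm v.
Proof. by have := ler_normD u v; rewrite !normE -rmorphD lecR. Qed.

Lemma rnorm_sub_sq u v : rnorm (u - v) ^+ 2 =
  sqn (fun t => rre u t - rre v t) + sqn (fun t => rim u t - rim v t).
Proof.
have -> : u - v = (-1) *: v + u by rewrite scaleN1r addrC.
rewrite rnorm_sq /rip -!sqnE.
have r1 := rre_comb (-1) v u; have r2 := rim_comb (-1) v u.
have e1 : {ae mu, forall t, I t -> rre (-1 *: v + u) t = rre u t - rre v t}.
  by apply: (ae2 r1 r1) => t + _ It => -> //=; rewrite oppr0 mul0r subr0 mulN1r addrC.
have e2 : {ae mu, forall t, I t -> rim (-1 *: v + u) t = rim u t - rim v t}.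
  by apply: (ae2 r2 r2) => t + _ It => -> //=; rewrite oppr0 mul0r addr0 mulN1r addrC.
have La := L2B (L2_rre u) (L2_rre v); have Lb := L2B (L2_rim u) (L2_rim v).
by congr (_ + _); [exact: (eq_ip (L2_rre _) La (L2_rre _) La e1 e1)|
  exact: (eq_ip (L2_rim _) Lb (L2_rim _) Lb e2 e2)].
Qed.

Lemma rnorm_sub_pi u (a b : R -> R) (La : L2 a) (Lb : L2 b) :
  rnorm (u - cL2_pi (mkcL2 La Lb)) ^+ 2 =
  sqn (fun t => rre u t - a t) + sqn (fun t => rim u t - b t).
Proof.
rewrite rnorm_sub_sq; set f := mkcL2 La Lb.
have e1 : {ae mu, forall t, I t -> rre u t - rre (cL2_pi f) t = rre u t - a t}.
  by apply: (ae2 (rre_pi f) (rre_pi f)) => t + _ It => ->.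
have e2 : {ae mu, forall t, I t -> rim u t - rim (cL2_pi f) t = rim u t - b t}.
  by apply: (ae2 (rim_pi f) (rim_pi f)) => t + _ It => ->.
have L1 := L2B (L2_rre u) (L2_rre (cL2_pi f)); have L1' := L2B (L2_rre u) La.
have L2a := L2B (L2_rim u) (L2_rim (cL2_pi f)); have L2' := L2B (L2_rim u) Lb.
by congr (_ + _); [exact: (eq_ip L1 L1' L1 L1' e1 e1)|exact: (eq_ip L2a L2' L2a L2' e2 e2)].
Qed.

Lemma cvg_cL2P (F : set_system (cL2 muI)) {FF : Filter F} u :
  (forall e : R, 0 < e -> \forall y \near F, rnorm (u - y) < e) -> F --> u.
Proof.
move=> h B /nbhs_ballP[e /= e0 eB].
case: e e0 eB => r s; rewrite ltcE/= => /andP[/eqP-> r0] eB.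
apply: filterS (h r r0) => y ur; apply: eB.
by rewrite -ball_normE/= normE ltcR.
Qed.

Lemma near_cL2P u (e : R) : 0 < e -> \forall y \near u, rnorm (u - y) < e.
Proof.
move=> e0; apply/nbhs_ballP; exists e%:C; first by rewrite /= ltcR.
by move=> y; rewrite -ball_normE/= normE ltcR.
Qed.

(** A sequence chosen in smaller and smaller sets of the filter is Cauchy; its
    limit, obtained on real and imaginary parts, is a limit of the filter. *)
Lemma cL2_complete (F : set_system (cL2 muI)) : ProperFilter F ->
  (forall e : R, 0 < e -> exists2 S, F S & forall x y, S x -> S y -> rnorm (x - y) <= e) ->
  exists u, F --> u.
Proof.
move=> FF cF.
have d0 (n : nat) : 0 < n.+1%:R^-1 :> R by rewrite invr_gt0.
have /choice[S SP] (n : nat) : exists S, F S /\ forall x y, S x -> S y -> rnorm (x - y) <= n.+1%:R^-1.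
  by have [S FS SP] := cF _ (d0 n); exists S.
pose B n := \bigcap_(k in `I_n.+1) S k.
have FB n : F (B n).
  rewrite /B; elim: n => [|n IH].
    apply: filterS (SP 0%N).1 => y Sy k /=; by rewrite ltnS leqn0 => /eqP->.
  apply: filterS (filterI IH (SP n.+1).1) => y [By Sy] k /=.
  by rewrite ltnS leq_eqVlt => /orP[/eqP->//|kn]; exact: By.
have /choice[x Bx] n : exists x, B n x by exact: (@filter_ex _ F FF _ (FB n)).
have Sx n m : (n <= m)%N -> S n (x m) by move=> nm; apply: Bx; rewrite /= ltnS.
have xS n y : S n y -> rnorm (x n - y) <= n.+1%:R^-1.
  by move=> Sy; have [_] := SP n; apply => //; exact: Sx.
have cau (e : R) : 0 < e -> \forall N \near \oo, forall m n, (N <= m)%N -> (N <= n)%N ->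
    rnorm (x m - x n) ^+ 2 <= e.
  move=> e0; near=> N => m n Nm Nn.
  have h : rnorm (x m - x n) <= N.+1%:R^-1 by have [_] := SP N; apply; exact: Sx.
  have N1 : N.+1%:R^-1 <= 1 :> R by rewrite invf_le1// ler1n.
  have sq (r s : R) : 0 <= r -> r <= s -> s <= 1 -> r ^+ 2 <= s by move=> *; nra.
  apply: (le_trans (sq _ _ (rnorm_ge0 _) h N1)); apply: ltW.
  by near: N; exact: near_infty_natSinv_lt (PosNum e0).
have part (p : cL2 muI -> R -> R) : (forall u, L2 (p u)) ->
    (forall u v, sqn (fun t => p u t - p v t) <= rnorm (u - v) ^+ 2) ->
    exists2 h, L2 h & sqn (fun t => p (x n) t - h t) @[n --> \oo] --> (0 : R).
  move=> Lp pn; apply: riesz_fischer => [//|n|e e0]; first exact: Lp.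
  apply: filterS (cau e e0) => N h m n Nm Nn.
  by apply: le_trans (h m n Nm Nn); exact: pn.
have [|a La ca] := part (fun u => rre u) (fun u => L2_rre u).
  by move=> u v; rewrite rnorm_sub_sq lerDl sqn_ge0.
have [|b Lb cb] := part (fun u => rim u) (fun u => L2_rim u).
  by move=> u v; rewrite rnorm_sub_sq lerDr sqn_ge0.
exists (cL2_pi (mkcL2 La Lb)); set u := cL2_pi _.
have cxu : rnorm (x n - u) ^+ 2 @[n --> \oo] --> (0 : R).
  under eq_fun do rewrite rnorm_sub_pi.
  by rewrite -(addr0 0); exact: cvgD.
apply: cvg_cL2P => e e0; have e2 : 0 < e / 2 by rewrite divr_gt0.
near \oo => n.
have hn : n.+1%:R^-1 < e / 2.
  by near: n; exact: near_infty_natSinv_lt (PosNum e2).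
have hu : rnorm (x n - u) < e / 2.
  rewrite -(@ltr_pXn2r _ 2%N)// ?nnegrE ?rnorm_ge0 ?(ltW e2)//.
  near: n; apply: cvgr_lt cxu _ _; exact: exprn_gt0.
have [FS _] := SP n; apply: filterS FS => y Sy.
rewrite -(subrKA (x n)) [ltRHS]splitr; apply: le_lt_trans (rnormD _ _) _.
by rewrite rnorm_subC; apply: ltrD => //; exact: le_lt_trans (xS _ _ Sy) hn.
Unshelve. all: by end_near.
Qed.

Lemma rip_le (k : R) u v : 0 < k ->
  `|rip u v| <= 2^-1 * (k * rnorm u ^+ 2 + k^-1 * rnorm v ^+ 2).
Proof.
move=> k0; rewrite !rnorm_sq /rip -!sqnE.
have h1 := ip_le k0 (L2_rre u) (L2_rre v); have h2 := ip_le k0 (L2_rim u) (L2_rim v).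
apply: (le_trans (ler_normD _ _)); apply: (le_trans (lerD h1 h2)).
by rewrite le_eqVlt; apply/orP; left; apply/eqP; ring.
Qed.

Lemma rip_comb (a : R) u v w : rip (a%:C *: u + v) w = a * rip u w + rip v w.
Proof.
rewrite /rip (ip_rre_comb _ _ _ (L2_rre w)) (ip_rim_comb _ _ _ (L2_rim w)) /=; ring.
Qed.

Lemma rnorm_eq0 u : rnorm u = 0 -> u = 0.
Proof. by move=> h; apply: normr0_eq0; rewrite normE h. Qed.

(** The real part of the inner product is enough to separate points: apply it
    to the difference itself. *)
Lemma rip_inj u v : (forall w, rip u w = rip v w) -> u = v.
Proof.
move=> h; apply/eqP; rewrite -subr_eq0; apply/eqP/rnorm_eq0.
have : rnorm (u - v) ^+ 2 = 0.
  have e : u - v = (-1)%:C *: v + u by rewrite rmorphN1 scaleN1r addrC.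
  by rewrite rnorm_sq {1}e rip_comb h mulN1r addNr.
by move/eqP; rewrite sqrf_eq0 => /eqP.
Qed.

End hilbert.

(** * The zeta operator in weak form *)

Section hilbert.
Context (R : realType) (T : R).
Hypothesis T0 : 0 < T.
Notation mu := (@lebesgue_measure R).
Local Notation muI := (mrestr (@lebesgue_measure R) (measurable_sym_itv T)).
Local Notation I := (sym_itv T).
Local Notation L2 := (L2 T).
Local Notation sqn := (sqn T).
Local Notation ip := (ip T).
Local Notation mI := (measurable_I T).
Local Notation Re := (@complex.Re _).
Local Notation Im := (@complex.Im _).
Implicit Types (u v w : cL2 muI).

Local Notation H := (`[0, +oo[%classic : set (measurableTypeR R)).

Lemma rnorm_sub_pi2 (a b a' b' : R -> R) (La : L2 a) (Lb : L2 b) (La' : L2 a') (Lb' : L2 b') :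
  rnorm (cL2_pi (mkcL2 La Lb) - cL2_pi (mkcL2 La' Lb')) ^+ 2 =
  sqn (fun t => a t - a' t) + sqn (fun t => b t - b' t).
Proof.
rewrite rnorm_sub_pi; set f := mkcL2 La Lb.
have e1 : {ae mu, forall t, I t -> rre (cL2_pi f) t - a' t = a t - a' t}.
  by apply: (ae2 (rre_pi f) (rre_pi f)) => t + _ It => ->.
have e2 : {ae mu, forall t, I t -> rim (cL2_pi f) t - b' t = b t - b' t}.
  by apply: (ae2 (rim_pi f) (rim_pi f)) => t + _ It => ->.
have L1 := L2B (L2_rre (cL2_pi f)) La'; have L1' := L2B La La'.
have L2a := L2B (L2_rim (cL2_pi f)) Lb'; have L2' := L2B Lb Lb'.
by congr (_ + _); [exact: (eq_ip L1 L1' L1 L1' e1 e1)|exact: (eq_ip L2a L2' L2a L2' e2 e2)].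
Qed.

Variable K : set nat.
Hypothesis hK : K `<=` [set n | (0 < n)%N].
Local Notation D := (dens (R := R) K).
Local Notation kd d := (kop T (wA0 D d) (wA1 D d)).

Lemma kern_zeta (d v : R) : 0 < d ->
  Re (zeta_set K ((1 + d) +i* v)) = kern (wA0 D d) (wA1 D d) v.
Proof.
move=> d0; rewrite (Re_zeta v hK d0) /kern /cosint /sinint.
have [i0 i1] := intg_wA (measurable_dens hK) (dens_ge0 K) (dens_le1 hK) d0.
have mH := @measurable_H R.
rewrite -(RintegralZl v mH (intg_sinH v i1)).
rewrite -(RintegralD mH (intg_cosH v i0) (intgZ v mH (intg_sinH v i1))).
by apply: eq_Rintegral => y _; rewrite /wA0 /wA1; ring.
Qed.

Definition indI (g : R -> R) (t : R) : R := \1_I t / pi * g t.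

Lemma L2_indI g : L2 g -> L2 (indI g).
Proof.
move=> Lg; apply: (L2_bounded (c := fun t => \1_I t / pi) (B := pi^-1) _ _ Lg) => [|t _].
  apply: measurable_funM; [exact: (measurable_indic mI)|exact: measurable_cst].
rewrite ger0_norm; last by rewrite divr_ge0// pi_ge0.
by rewrite ler_piMl ?invr_ge0 ?pi_ge0// indicE; case: (_ \in _).
Qed.

Lemma sqn_indI g h : L2 g -> L2 h ->
  sqn (fun t => indI g t - indI h t) = pi ^- 2 * sqn (fun t => g t - h t).
Proof.
move=> Lg Lh; rewrite -(RintegralZl _ mI (L2B Lg Lh).2).
apply: eq_Rintegral => t It; rewrite /indI indicE It mul1r -mulrBr exprMn exprVn.
by [].
Qed.

(** The kernel is real, so the operator acts separately on the real and
    imaginary parts. *)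
Lemma Zreg_funE (d : R) (g : R -> R[i]) t : 0 < d -> Zreg_fun K T d g t =
  indI (kd d (Re \o g)) t +i* indI (kd d (Im \o g)) t.
Proof.
move=> d0; rewrite /Zreg_fun /cintegral /indI /kop.
have e1 : \int[mu]_(s in I) Re (g s * (Re (zeta_set K ((1 + d) +i* (t - s))))%:C) =
    \int[mu]_(s in I) ((Re \o g) s * kern (wA0 D d) (wA1 D d) (t - s)).
  by apply: eq_Rintegral => s _; rewrite Defs.ReM /= mulr0 subr0 kern_zeta.
have e2 : \int[mu]_(s in I) Im (g s * (Re (zeta_set K ((1 + d) +i* (t - s))))%:C) =
    \int[mu]_(s in I) ((Im \o g) s * kern (wA0 D d) (wA1 D d) (t - s)).
  by apply: eq_Rintegral => s _; rewrite Defs.ImM /= mulr0 add0r kern_zeta.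
rewrite e1 e2; apply/eqP; rewrite eq_complex/= !mul0r subr0 addr0.
by apply/andP; split; apply/eqP.
Qed.

Local Notation E A := (fun y => D y - A).

(** The weak form of the operator: pairing with a test vector only involves the
    transforms of both vectors and the deviation of the density. *)
Lemma Zop_weak (A : R) (u w : cL2 muI) :
  [/\ intg H (wform T (E A) (E A) (rre u) (rre w)),
      intg H (wform T (E A) (E A) (rim u) (rim w)) &
  pi * rip (Zop K T u) w = A * pi * rip u w +
  (A * ((\int[mu]_(t in I) rre u t) * (\int[mu]_(t in I) rre w t) +
        (\int[mu]_(t in I) rim u t) * (\int[mu]_(t in I) rim w t)) +
   (\int[mu]_(y in H) wform T (E A) (E A) (rre u) (rre w) y +
    \int[mu]_(y in H) wform T (E A) (E A) (rim u) (rim w) y))].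
Proof.
have mD := measurable_dens (R := R) hK; have D0 := dens_ge0 (R := R) K.
have D1 := dens_le1 (R := R) hK.
have [qa [Lqa ca wa]] := symbol_limit T0 A mD D0 D1 (L2_rre u).
have [qb [Lqb cb wb]] := symbol_limit T0 A mD D0 D1 (L2_rim u).
have Lk d g : 0 < d -> L2 g -> L2 (kd d g).
  by move=> d0 Lg; have [i0 i1] := intg_wA mD D0 D1 d0; exact: L2_kop.
pose q := cL2_pi (mkcL2 (L2_indI Lqa) (L2_indI Lqb)).
have ZE : Zop K T u = q.
  apply: cvg_lim; first exact: norm_hausdorff.
  apply: cvg_cL2P => e e0.
  have p2 : 0 < pi ^+ 2 :> R by rewrite exprn_gt0// pi_gt0.
  have c : sqn (fun t => kd d (rre u) t - qa t) + sqn (fun t => kd d (rim u) t - qb t)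
      @[d --> 0^'+] --> (0 : R).
    by rewrite -[X in _ --> X]addr0; exact: cvgD.
  suff h : \forall d \near 0^'+, rnorm (q - cL2_class muI (Zreg_fun K T d (val (repr u)))) < e by exact: h.
  near=> d.
  have d0 : 0 < d by near: d; exact: nbhs_right_gt.
  have -> : cL2_class muI (Zreg_fun K T d (val (repr u))) =
      cL2_pi (mkcL2 (L2_indI (Lk _ _ d0 (L2_rre u))) (L2_indI (Lk _ _ d0 (L2_rim u)))).
    have -> : Zreg_fun K T d (val (repr u)) =
      val (mkcL2 (L2_indI (Lk _ _ d0 (L2_rre u))) (L2_indI (Lk _ _ d0 (L2_rim u)))).
      by apply/funext => t; rewrite Zreg_funE.
    by rewrite /cL2_class valKd.
  rewrite -(@ltr_pXn2r _ 2%N)// ?nnegrE ?rnorm_ge0 ?(ltW e0)//.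
  rewrite rnorm_subC rnorm_sub_pi2 !sqn_indI//; [|exact: Lk (L2_rim u)|exact: Lk (L2_rre u)].
  rewrite -mulrDr ltr_pdivrMl//.
  near: d; apply: cvgr_lt c _ _; by rewrite mulr_gt0// exprn_gt0.
have [i1 e1] := wa _ (L2_rre w); have [i2 e2] := wb _ (L2_rim w).
split => //; rewrite ZE rip_pi.
have ipI g h : L2 g -> L2 h -> pi * ip (indI g) h = ip g h.
  move=> Lg Lh; rewrite -(RintegralZl _ mI (L2_mul (L2_indI Lg) Lh)).
  apply: eq_Rintegral => t It; rewrite /indI indicE It mul1r !mulrA divff ?mul1r//.
  by rewrite gt_eqF// pi_gt0.
have -> : pi * (ip (Re \o val (mkcL2 (L2_indI Lqa) (L2_indI Lqb))) (rre w) +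
  ip (Im \o val (mkcL2 (L2_indI Lqa) (L2_indI Lqb))) (rim w)) =
  ip qa (rre w) + ip qb (rim w).
  by rewrite mulrDr -(ipI qa _ Lqa (L2_rre w)) -(ipI qb _ Lqb (L2_rim w)).
rewrite e1 e2 /rip; ring.
Unshelve. all: by end_near.
Qed.

End hilbert.

(** * Linearity and symmetry *)

Lemma lin_arith (R : comPzRingType) (A m1 m2 i1 i2 : R) :
  A * (m1 + m2) + (i1 + i2) = (A * m1 + i1) + (A * m2 + i2).
Proof. ring. Qed.

Lemma dev_arith (R : realFieldType) (A D : R) : 0 <= A -> 0 <= D -> D <= 1 ->
  `|D - A| <= 1 + A.
Proof. by move=> *; rewrite ler_norml; apply/andP; split; lra. Qed.

Section hilbert.
Context (R : realType) (T : R).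
Hypothesis T0 : 0 < T.
Notation mu := (@lebesgue_measure R).
Local Notation muI := (mrestr (@lebesgue_measure R) (measurable_sym_itv T)).
Local Notation I := (sym_itv T).
Local Notation L2 := (L2 T).
Local Notation sqn := (sqn T).
Local Notation ip := (ip T).
Local Notation mI := (measurable_I T).
Local Notation Re := (@complex.Re _).
Local Notation Im := (@complex.Im _).
Implicit Types (u v z : cL2 muI).
Local Notation H := (`[0, +oo[%classic : set (measurableTypeR R)).

(** Transforms at [y] are inner products with the functions [pc y] and [ps y],
    which transfers linearity from inner products to transforms. *)
Definition pc (y t : R) := cos (t * y).
Definition ps (y t : R) := sin (t * y).

Lemma L2_pc y : L2 (pc y).
Proof.
have := L2_bounded (c := pc y) (B := 1) (measurable_cosM y) (fun t _ => cos_max _) (L2_cst T0 1).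
by congr L2; apply/funext => t; rewrite mulr1.
Qed.

Lemma L2_ps y : L2 (ps y).
Proof.
have := L2_bounded (c := ps y) (B := 1) (measurable_sinM y) (fun t _ => sin_max _) (L2_cst T0 1).
by congr L2; apply/funext => t; rewrite mulr1.
Qed.

Lemma ip_mulX g h : ip (mulX g) h = ip g (mulX h).
Proof. by apply: eq_Rintegral => t _; rewrite /mulX; ring. Qed.

Lemma int_ip g : \int[mu]_(t in I) g t = ip g (fun=> 1).
Proof. by apply: eq_Rintegral => t _; rewrite mulr1. Qed.

Lemma wformE w0 w1 g h y : wform T w0 w1 g h y =
  w0 y * (ip h (pc y) * ip g (pc y) + ip h (ps y) * ip g (ps y)) +
  w1 y * (ip h (mulX (ps y)) * ip g (pc y) - ip h (mulX (pc y)) * ip g (ps y)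
          - ip h (ps y) * ip g (mulX (pc y)) + ip h (pc y) * ip g (mulX (ps y))).
Proof. by rewrite -!ip_mulX. Qed.

Lemma wformC w g h y : wform T w w g h y = wform T w w h g y.
Proof. by rewrite !wformE; ring. Qed.

Lemma ip0 h : L2 h -> ip (rre (0 : cL2 muI)) h = 0 /\ ip (rim (0 : cL2 muI)) h = 0.
Proof.
move=> Lh; have := ip_rre_comb 1 0 0 Lh; have := ip_rim_comb 1 0 0 Lh.
by rewrite scaler0 addr0 /=; lra.
Qed.

Lemma ip_rreZ (a : R[i]) u h : L2 h ->
  ip (rre (a *: u)) h = Re a * ip (rre u) h - Im a * ip (rim u) h.
Proof. by move=> Lh; have := ip_rre_comb a u 0 Lh; rewrite addr0 (ip0 Lh).1 addr0. Qed.

Lemma ip_rimZ (a : R[i]) u h : L2 h ->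
  ip (rim (a *: u)) h = Re a * ip (rim u) h + Im a * ip (rre u) h.
Proof. by move=> Lh; have := ip_rim_comb a u 0 Lh; rewrite addr0 (ip0 Lh).2 addr0. Qed.

Definition cj (a : R[i]) := Re a +i* (- Im a).

(** Complex scalars move across [rip] by conjugation; this is how complex
    linearity is recovered from the real pairing. *)
Lemma rip_adj (a : R[i]) u v w :
  rip (a *: u + v) w = rip u (cj a *: w) + rip v w.
Proof.
rewrite /rip (ip_rre_comb a u v (L2_rre w)) (ip_rim_comb a u v (L2_rim w)).
rewrite [ip (rre u) (rre (_ *: _))]ipC [ip (rim u) (rim (_ *: _))]ipC.
rewrite (ip_rreZ _ _ (L2_rre u)) (ip_rimZ _ _ (L2_rim u)) /cj/=.
rewrite [ip (rre w) (rre u)]ipC [ip (rim w) (rre u)]ipC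
  [ip (rre w) (rim u)]ipC [ip (rim w) (rim u)]ipC; ring.
Qed.

Definition cform (w : R -> R) u v (y : R) := wform T w w (rre u) (rre v) y + wform T w w (rim u) (rim v) y.

Lemma cformC (w : R -> R) u v (y : R) : cform w u v y = cform w v u y.
Proof. by rewrite /cform wformC [X in _ + X]wformC. Qed.

Lemma cform_adj w (a : R[i]) u v z y :
  cform w (a *: u + v) z y = cform w u (cj a *: z) y + cform w v z y.
Proof.
have c := L2_pc y; have s := L2_ps y; have Xc := L2X c; have Xs := L2X s.
rewrite /cform !wformE.
rewrite (ip_rre_comb a u v c) (ip_rre_comb a u v s)
  (ip_rre_comb a u v Xc) (ip_rre_comb a u v Xs).
rewrite (ip_rim_comb a u v c) (ip_rim_comb a u v s)
  (ip_rim_comb a u v Xc) (ip_rim_comb a u v Xs).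
rewrite (ip_rreZ _ _ c) (ip_rreZ _ _ s) (ip_rreZ _ _ Xc) (ip_rreZ _ _ Xs).
rewrite (ip_rimZ _ _ c) (ip_rimZ _ _ s) (ip_rimZ _ _ Xc) (ip_rimZ _ _ Xs) /cj/=.
clear c s Xc Xs.
move: (ip (rre u) _) (ip (rre u) _) (ip (rre u) _) (ip (rre u) _).
move: (ip (rim u) _) (ip (rim u) _) (ip (rim u) _) (ip (rim u) _).
move: (ip (rre v) _) (ip (rre v) _) (ip (rre v) _) (ip (rre v) _).
move: (ip (rim v) _) (ip (rim v) _) (ip (rim v) _) (ip (rim v) _).
move: (ip (rre z) _) (ip (rre z) _) (ip (rre z) _) (ip (rre z) _).
move: (ip (rim z) _) (ip (rim z) _) (ip (rim z) _) (ip (rim z) _).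
by move: (w y) (Re a) (Im a) => *; ring.
Qed.

Definition mform u v :=
  (\int[mu]_(t in I) rre u t) * (\int[mu]_(t in I) rre v t) +
  (\int[mu]_(t in I) rim u t) * (\int[mu]_(t in I) rim v t).

Lemma mform_adj (a : R[i]) u v z :
  mform (a *: u + v) z = mform u (cj a *: z) + mform v z.
Proof.
rewrite /mform !int_ip; have L1 := L2_cst T0 1.
rewrite (ip_rre_comb a u v L1) (ip_rim_comb a u v L1) (ip_rreZ _ _ L1) (ip_rimZ _ _ L1) /cj/=.
by ring.
Qed.

Lemma mformC u v : mform u v = mform v u.
Proof. by rewrite /mform; congr (_ + _); exact: mulrC. Qed.

Variable (K : set nat) (A : R).
Hypothesis hK : K `<=` [set n | (0 < n)%N].
Hypothesis hA : 0 <= A.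
Definition dev (y : R) : R := dens K y - A.
Local Notation Psi := (Psi_op K A T).

Lemma measurable_dev : measurable_fun setT dev.
Proof. by apply: measurable_funB; [exact: measurable_dens|exact: measurable_cst]. Qed.

Lemma dev_le y : `|dev y| <= 1 + A.
Proof.
exact: (dev_arith hA (dens_ge0 K y) (dens_le1 hK y)).
Qed.

(** The multiple of the identity cancels the Parseval term of the operator. *)
Lemma Psi_weak u w : intg H (cform dev u w) /\
  pi * rip (Psi u) w = A * mform u w + \int[mu]_(y in H) cform dev u w y.
Proof.
have [i1 i2 e] := Zop_weak T0 hK A u w; have mH := @measurable_H R.
split; first exact: (intgD mH i1 i2).
have -> : Psi u = (- A)%:C *: u + Zop K T u.
  by rewrite /Psi_op rmorphN scaleNr addrC.
rewrite rip_comb mulrDr e -(RintegralD mH i1 i2) /mform /dev; ring.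
Qed.

Lemma pi_neq0' : pi != 0 :> R. Proof. by rewrite gt_eqF// pi_gt0. Qed.

(** The weak form determines the operator, and it is linear in its first
    argument. *)
Lemma Psi_linear : linear Psi.
Proof.
move=> a u v; apply: rip_inj => w; rewrite rip_adj.
apply: (mulfI pi_neq0'); rewrite [RHS]mulrDr.
have [i1 e1] := Psi_weak (a *: u + v) w; apply: (etrans e1).
have [i2 e2] := Psi_weak u (cj a *: w); have [i3 e3] := Psi_weak v w.
apply: esym; apply: (etrans (congr2 +%R e2 e3)); apply: esym.
have mH := @measurable_H R.
have -> : \int[mu]_(y in H) cform dev (a *: u + v) w y =
    \int[mu]_(y in H) cform dev u (cj a *: w) y + \int[mu]_(y in H) cform dev v w y.
  rewrite -(RintegralD mH i2 i3).
  by apply: eq_Rintegral => y _; rewrite cform_adj.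
by rewrite mform_adj; exact: lin_arith.
Qed.

Lemma Psi_sym u w : rip (Psi u) w = rip (Psi w) u.
Proof.
apply: (mulfI pi_neq0'); have [_ ->] := Psi_weak u w; have [_ ->] := Psi_weak w u.
have -> : \int[mu]_(y in H) cform dev u w y = \int[mu]_(y in H) cform dev w u y.
  by apply: eq_Rintegral => y _; rewrite cformC.
by rewrite mformC.
Qed.

End hilbert.

(** * An a priori estimate in terms of the deviation *)

Lemma apriori_arith (R : realFieldType) (p N m k A T X : R) : 2 <= p -> 0 <= N -> 0 <= m ->
  0 <= k -> 0 <= X -> 0 <= A -> 0 <= T ->
  p * N <= 2^-1 * A * ((A + 1) * (2 * T * m) + (A + 1)^-1 * N) +
     2^-1 * (k * (2 * X) + p * N) ->
  N <= (2 * A * (A + 1) * T + 2 * k) * (m + X).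
Proof.
move=> p2 N0 m0 k0 X0 A0 T0 h.
have q : A * (A + 1)^-1 <= 1 by rewrite ler_pdivrMr ?mul1r; lra.
have q' : 2^-1 * A * ((A + 1)^-1 * N) <= 2^-1 * N.
  rewrite -mulrA ler_pM2l ?invr_gt0// mulrA -[leRHS]mul1r; exact: ler_wpM2r.
have h1 : 2 * N <= p * N by exact: ler_wpM2r.
have h2 : 0 <= 2 * A * (A + 1) * T * X by rewrite !mulr_ge0//; lra.
have h3 : 0 <= 2 * k * m by rewrite !mulr_ge0.
move: h; rewrite [2^-1 * A * (_ + _)]mulrDr => h.
have -> : (2 * A * (A + 1) * T + 2 * k) * (m + X) =
  2 * (A * ((A + 1) * T * m)) + 2 * (k * X) + 2 * A * (A + 1) * T * X + 2 * k * m by ring.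
have e : 2^-1 * A * ((A + 1) * (2 * T * m)) = A * ((A + 1) * T * m) by field.
move: e q' h h1 h2 h3; lra.
Qed.

Lemma halves_arith (R : realFieldType) (k a b c d : R) :
  2^-1 * (k * a + k^-1 * b) + 2^-1 * (k * c + k^-1 * d) =
  2^-1 * (k * (a + c) + k^-1 * (b + d)).
Proof. by rewrite !mulrDr addrACA. Qed.

Lemma absorb_half_arith (R : realFieldType) (k X V N : R) : 0 < k -> 2 * V <= k * N ->
  2^-1 * (k * (2 * X) + k^-1 * (2 * V)) <= 2^-1 * (k * (2 * X) + N).
Proof. by move=> k0 h; rewrite ler_pM2l ?invr_gt0// lerD2l ler_pdivrMl. Qed.

Section apriori.
Context (R : realType) (T : R).
Hypothesis T0 : 0 < T.
Notation mu := (@lebesgue_measure R).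
Local Notation muI := (mrestr (@lebesgue_measure R) (measurable_sym_itv T)).
Local Notation I := (sym_itv T).
Local Notation H := (`[0, +oo[%classic : set (measurableTypeR R)).
Local Notation L2 := (L2 T).
Local Notation sqn := (sqn T).
Local Notation ip := (ip T).
Local Notation mI := (measurable_I T).
Local Notation mH := (@measurable_H R).
Local Notation energy := (energy T).
Implicit Types (u v : cL2 muI).

Definition cenergy u y := energy (rre u) y + energy (rim u) y.

Lemma cenergy_ge0 u y : 0 <= cenergy u y.
Proof. by rewrite addr_ge0// energy_ge0. Qed.

Lemma cenergy_bound u : intg H (cenergy u) /\
  \int[mu]_(y in H) cenergy u y <= pi * (1 + T ^+ 2) * rnorm u ^+ 2.
Proof.
have [i1 l1] := energy_bound T0 (L2_rre u); have [i2 l2] := energy_bound T0 (L2_rim u).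
split; first exact: (intgD mH i1 i2).
by rewrite (RintegralD mH i1 i2) rnorm_sq /rip -!sqnE mulrDr; exact: lerD.
Qed.

Lemma intg_cenergyM (w : R -> R) (C : R) u : measurable_fun setT w -> (forall y, 0 <= y -> `|w y| <= C) ->
  intg H (fun y => w y * cenergy u y).
Proof.
move=> mw wC; have i1 := intg_energyM T0 mw wC (L2_rre u).
have i2 := intg_energyM T0 mw wC (L2_rim u).
have -> : (fun y => w y * cenergy u y) =
    (fun y => w y * energy (rre u) y + w y * energy (rim u) y).
  by apply/funext => y; rewrite /cenergy mulrDr.
exact: (intgD mH i1 i2).
Qed.

Lemma prod_int_le (g h : R -> R) (k : R) : 0 < k -> L2 g -> L2 h ->
  (\int[mu]_(t in I) g t) * (\int[mu]_(t in I) h t) <=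
  2^-1 * (k * (2 * T * (\int[mu]_(t in I) g t) ^+ 2) + k^-1 * sqn h).
Proof.
move=> k0 Lg Lh; set c := \int[mu]_(t in I) g t.
have -> : c * (\int[mu]_(t in I) h t) = ip (fun=> c) h.
  by rewrite -(RintegralZl c mI (L2_int T0 Lh)).
have -> : 2 * T * c ^+ 2 = sqn (fun=> c).
  rewrite /Submission.sqn Rintegral_cst; last exact: mI.
  rewrite [c ^+ 2 * _]mulrC; congr (_ * _); exact: (esym (congr1 fine (mu_I T0))).
exact: le_trans (ler_norm _) (ip_le k0 (L2_cst T0 c) Lh).
Qed.

Variable (K : set nat) (A : R).
Hypothesis hK : K `<=` [set n | (0 < n)%N].
Hypothesis hA : 0 <= A.
Local Notation Psi := (Psi_op K A T).
Local Notation dev := (dev K A).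

Definition mass u := (\int[mu]_(t in I) rre u t) ^+ 2 + (\int[mu]_(t in I) rim u t) ^+ 2.

Lemma mass_ge0 u : 0 <= mass u. Proof. by rewrite addr_ge0// sqr_ge0. Qed.

Definition apriori_cst : R := 2 * A * (A + 1) * T + 2 * (2 * (1 + A) * (1 + T ^+ 2)).

Lemma apriori_cst_gt0 : 0 < apriori_cst.
Proof.
have A1 : 0 < 1 + A by rewrite ltr_wpDr.
have T1 : 0 < 1 + T ^+ 2 by rewrite ltr_wpDr// sqr_ge0.
apply: ltr_wpDl; last by rewrite !mulr_gt0.
by rewrite !mulr_ge0// ?(ltW T0)// addr_ge0.
Qed.

(** Test the weak form with [Psi u] and absorb its energy. What is left is the
    rank one part and the energy of [u] weighted by the deviation. *)
Lemma Psi_apriori u :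
  rnorm (Psi u) ^+ 2 <= apriori_cst * (mass u + \int[mu]_(y in H) (`|dev y| * cenergy u y)).
Proof.
set v := Psi u; have A1 : 0 < A + 1 by rewrite ltr_wpDl.
have T1 : 0 < 1 + T ^+ 2 by rewrite ltr_wpDr// sqr_ge0.
have mdev := measurable_dev A hK; have dle := dev_le hK hA.
pose W y := 2 * `|dev y|; pose C := 2 * (1 + A); pose k := C * (1 + T ^+ 2).
have k0 : 0 < k by rewrite !mulr_gt0// addrC.
have mn : measurable_fun setT (fun y => `|dev y|) by exact: measurableT_comp.
have mW : measurable_fun setT W by apply: measurable_funM.
have wW y : 0 <= y -> `|dev y| + `|dev y| <= W y by rewrite /W mulr_natl.
have WC y : 0 <= y -> W y <= C by rewrite /W /C ler_pM2l.
have [j1 b1] := form_dominated T0 k0 mdev mdev mW wW WC (L2_rre u) (L2_rre v).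
have [j2 b2] := form_dominated T0 k0 mdev mdev mW wW WC (L2_rim u) (L2_rim v).
have [_ e] := Psi_weak T0 A hK u v.
have WC' y : 0 <= y -> `|W y| <= C.
  by move=> y0; rewrite ger0_norm ?WC// /W mulr_ge0.
have eX (z : cL2 muI) : \int[mu]_(y in H) (W y * energy (rre z) y) + \int[mu]_(y in H) (W y * energy (rim z) y)
   = 2 * \int[mu]_(y in H) (`|dev y| * cenergy z y).
  rewrite -(RintegralD mH (intg_energyM T0 mW WC' (L2_rre z)) (intg_energyM T0 mW WC' (L2_rim z))).
  have dl' y : 0 <= y -> `| `|dev y| | <= 1 + A by move=> _; rewrite normr_id.
  rewrite -(RintegralZl 2 mH (intg_cenergyM z mn dl')).
  by apply: eq_Rintegral => y _; rewrite /W /cenergy; ring.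
have X0 : 0 <= \int[mu]_(y in H) (`|dev y| * cenergy u y).
  by apply: Rintegral_ge0 => y _; rewrite mulr_ge0// cenergy_ge0.
have eV : 2 * \int[mu]_(y in H) (`|dev y| * cenergy v y) <= k * (pi * rnorm v ^+ 2).
  have [iv lv] := cenergy_bound v.
  have dl' y : 0 <= y -> `| `|dev y| | <= 1 + A by move=> _; rewrite normr_id.
  have -> : k * (pi * rnorm v ^+ 2) = 2 * ((1 + A) * (pi * (1 + T ^+ 2) * rnorm v ^+ 2)).
    by rewrite /k /C; ring.
  rewrite ler_pM2l//; apply: (@le_trans _ _ ((1 + A) * \int[mu]_(y in H) cenergy v y)); last first.
    by rewrite ler_pM2l// addrC.
  rewrite -(RintegralZl (1 + A) mH iv); apply: le_Rintegral mH _ _ _.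
  - exact: (intg_cenergyM v mn dl').
  - exact: (intgZ _ mH iv).
  - by move=> y _; apply: ler_wpM2r; [exact: cenergy_ge0|exact: dle].
have main : pi * rnorm v ^+ 2 <=
    2^-1 * A * ((A + 1) * (2 * T * mass u) + (A + 1)^-1 * rnorm v ^+ 2) +
    2^-1 * (k * (2 * \int[mu]_(y in H) (`|dev y| * cenergy u y)) + pi * rnorm v ^+ 2); last first.
  exact: (apriori_arith (pi_ge2 R) (sqr_ge0 _) (mass_ge0 u) (ltW k0) X0 hA (ltW T0) main).
rewrite {1}rnorm_sq e; apply: lerD.
  rewrite /mform rnorm_sq /rip -!sqnE.
  have p1 := prod_int_le A1 (L2_rre u) (L2_rre v); have p2 := prod_int_le A1 (L2_rim u) (L2_rim v).
  have := ler_wpM2l hA (lerD p1 p2); congr (_ <= _); rewrite /mass; ring.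
rewrite (RintegralD mH j1 j2).
apply: (le_trans (lerD (le_trans (ler_norm _) b1) (le_trans (ler_norm _) b2))).
rewrite halves_arith (eX u) (eX v); exact: absorb_half_arith k0 eV.
Qed.

End apriori.

(** * Precompactness through finite codes *)

Lemma trcst_arith (R : realFieldType) (T s s' M Q : R) : 0 < T -> 0 <= s -> s <= M ->
  0 <= T ^+ 2 * s -> T ^+ 2 * s <= Q -> s' <= T ^+ 2 * s ->
  T + s <= T + M + (T + Q) /\ T + s' <= T + M + (T + Q).
Proof. by move: (T ^+ 2 * s) => q *; split; lra. Qed.

(** Finitely many bounded functionals can be recorded, up to a given error, by
    a code in a finite type. *)
Lemma finite_code (R : realType) (V : Type) (X : finType) (phi : X -> V -> R) (B : set V)
    (L eta : R) : 0 < eta -> (forall x v, B v -> `|phi x v| <= L) ->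
  exists (C : finType) (c : V -> C), forall u v, B u -> B v -> c u = c v ->
    forall x, `|phi x u - phi x v| <= eta.
Proof.
move=> e0 phiL; pose f (r : R) := Num.truncn ((r + L) / eta).
pose N := Num.truncn (2 * L / eta).
exists {ffun X -> 'I_N.+1}, (fun v => [ffun x => inord (f (phi x v))]) => u v Bu Bv /ffunP cuv x.
have g (r : R) : `|r| <= L -> 0 <= (r + L) / eta /\ (f r < N.+1)%N.
  rewrite ler_norml => /andP[r1 r2]; split.
    by rewrite divr_ge0 ?(ltW e0)//; lra.
  rewrite ltnS; apply: le_truncn; apply: ler_wpM2r; first by rewrite invr_ge0 ltW.
  lra.
have [u0 uN] := g _ (phiL x u Bu); have [v0 vN] := g _ (phiL x v Bv).
have := cuv x; rewrite !ffunE => /(congr1 val) /=; rewrite !inordK// => fuv.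
have /andP[a1 a2] := truncn_itv u0; have /andP[b1 b2] := truncn_itv v0.
have h1 : (phi x u + L) / eta - (phi x v + L) / eta <= 1.
  by move: a2 b1; rewrite -/(f _) -/(f _) fuv -natr1; lra.
have h2 : (phi x v + L) / eta - (phi x u + L) / eta <= 1.
  by move: b2 a1; rewrite -/(f _) -/(f _) fuv -natr1; lra.
move: h1 h2; rewrite -!mulrBl !ler_pdivrMr// !mul1r => h1 h2.
by rewrite ler_norml; apply/andP; split; lra.
Qed.

Section compactness.
Context (R : realType) (T : R).
Hypothesis T0 : 0 < T.
Notation mu := (@lebesgue_measure R).
Local Notation muI := (mrestr (@lebesgue_measure R) (measurable_sym_itv T)).
Local Notation I := (sym_itv T).
Local Notation H := (`[0, +oo[%classic : set (measurableTypeR R)).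
Local Notation L2 := (L2 T).
Local Notation sqn := (sqn T).
Local Notation ip := (ip T).
Local Notation mI := (measurable_I T).
Local Notation mH := (@measurable_H R).
Local Notation energy := (energy T).

(** An ultrafilter on the closure contains the closure of the image of one code
    class, for every precision; hence it is Cauchy, and it converges by
    completeness. *)
Lemma precompact_code (V : Type) (F : V -> cL2 muI) (B : set V) :
  (forall e : R, 0 < e -> exists (C : finType) (c : V -> C), forall u v, B u -> B v ->
     c u = c v -> rnorm (F u - F v) <= e) -> precompact (F @` B).
Proof.
move=> hc; rewrite precompactE compact_ultra => G UG GB.
have PG : ProperFilter G by exact: ultra_proper.
have [e e0|u Gu] := cL2_complete T0 PG.
  have e2 : 0 < e / 2 by rewrite divr_gt0.
  have e4 : 0 < e / 4 by rewrite divr_gt0.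
  have [C [c cP]] := hc _ e2.
  pose S k := closure (F @` (B `&` [set v | c v = k])).
  have [k Gk] : exists k, G (S k).
    apply: contrapT => /forallNP nG.
    have GC k : G (~` S k) by have [/nG|] := in_ultra_setVsetC (S k) UG.
    have GA : G (fun y => forall k, (~` S k) y) by exact: filter_forall.
    have [y [By Sy]] := @filter_ex _ G PG _ (filterI GB GA).
    have nS k : nbhs y (~` (F @` (B `&` [set v | c v = k]))).
      have : open (~` S k) by rewrite openC; exact: closed_closure.
      move=> oS; have := open_nbhs_nbhs (conj oS (Sy k)); apply: filterS.
      exact/subsetC/subset_closure.
    have nA : nbhs y (fun z => forall k, (~` (F @` (B `&` [set v | c v = k]))) z).
      exact: (@filter_forall _ C (fun k => ~` (F @` (B `&` [set v | c v = k]))) (nbhs y) _ nS).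
    have [z [[w Bw <-] /(_ (c w))]] := By _ nA.
    by apply; exists w.
  exists (S k) => // x y Sx Sy.
  have [x' [[a [Ba ca] <-] xa]] := Sx _ (near_cL2P x e4).
  have [y' [[b [Bb cb] <-] yb]] := Sy _ (near_cL2P y e4).
  have ab : rnorm (F a - F b) <= e / 2 by apply: cP => //; rewrite ca cb.
  have -> : x - y = (x - F a) + ((F a - F b) + (F b - y)).
    by rewrite addrA subrKA addrA subrK.
  apply: (le_trans (rnormD _ _)); apply: (le_trans (lerD (lexx _) (rnormD _ _))).
  rewrite [rnorm (F b - y)]rnorm_subC.
  by move: ab xa yb => /=; lra.
exists u; split => //; apply: closed_closure => N Nu.
exact: (@filter_ex _ G PG _ (filterI GB (Gu _ Nu))).
Qed.

Definition tr (b : bool * bool) (g : R -> R) (y : R) : R :=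
  (if b.2 then ctr T else str T) (if b.1 then mulX g else g) y.

Definition probe (b : bool * bool) (y : R) : R -> R :=
  (if b.1 then @mulX R else id) ((if b.2 then @pc R else @ps R) y).

Lemma L2_probe b y : L2 (probe b y).
Proof.
case: b => [[] []]; rewrite /probe/=.
- exact: L2X (L2_pc T0 y).
- exact: L2X (L2_ps T0 y).
- exact: L2_pc.
- exact: L2_ps.
Qed.

Lemma tr_ip b g y : tr b g y = ip g (probe b y).
Proof. by case: b => [[] []]; rewrite /tr /probe//= -ip_mulX. Qed.

Lemma energy_tr g y : energy g y = tr (false, true) g y ^+ 2 + tr (false, false) g y ^+ 2 +
  (tr (true, true) g y ^+ 2 + tr (true, false) g y ^+ 2).
Proof. by []. Qed.

Definition trcst (M : R) := (T + M) + (T + T ^+ 2 * M).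

Lemma nrm1_le g : L2 g -> nrm1 T g <= T + sqn g.
Proof.
move=> Lg; have h (t : R) : I t -> `|g t| <= 2^-1 + g t ^+ 2.
  move=> _; rewrite -(real_normK (num_real (g t))); have := sqr_ge0 (`|g t| - 2^-1).
  by rewrite sqrrB => ?; nra.
have ic := intg_cst T0 (2^-1); have ig := Lg.2.
have e : \int[mu]_(t in I) (2^-1 + g t ^+ 2) = T + sqn g.
  rewrite (RintegralD mI ic ig); congr (_ + _).
  rewrite Rintegral_cst; last exact: mI.
  have -> : fine (mu I) = 2 * T by exact: (congr1 fine (mu_I T0)).
  by rewrite mulrA mulVf ?mul1r// pnatr_eq0.
rewrite -e; apply: le_Rintegral mI (integrable_norm (L2_int T0 Lg)) (intgD mI ic ig) h.
Qed.

Lemma trcst_ge g M : L2 g -> sqn g <= M -> nrm1 T g <= trcst M /\ nrm1 T (mulX g) <= trcst M.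
Proof.
move=> Lg gM; have h1 := nrm1_le Lg; have h2 := nrm1_le (L2X Lg); have h3 := sqnX T0 Lg.
have s0 := sqn_ge0 T g; have TM : T ^+ 2 * sqn g <= T ^+ 2 * M by rewrite ler_wpM2l// sqr_ge0.
have TM0 : 0 <= T ^+ 2 * sqn g by rewrite mulr_ge0// sqr_ge0.
by have [e1 e2] := trcst_arith T0 s0 gM TM0 TM h3; split; [exact: le_trans h1 e1|exact: le_trans h2 e2].
Qed.

Lemma tr_bounded b g M y : L2 g -> sqn g <= M -> `|tr b g y| <= trcst M.
Proof.
move=> Lg gM; have [h1 h2] := trcst_ge Lg gM.
case: b => [[] []]; rewrite /tr/=.
- exact: le_trans (ctr_bounded T0 y (L2X Lg)) h2.
- exact: le_trans (str_bounded T0 y (L2X Lg)) h2.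
- exact: le_trans (ctr_bounded T0 y Lg) h1.
- exact: le_trans (str_bounded T0 y Lg) h1.
Qed.

Lemma tr_lipschitz b g M x y : L2 g -> sqn g <= M ->
  `|tr b g x - tr b g y| <= T * trcst M * `|x - y|.
Proof.
move=> Lg gM; have [h1 h2] := trcst_ge Lg gM.
have w (n : R) : n <= trcst M -> T * n * `|x - y| <= T * trcst M * `|x - y|.
  by move=> h; rewrite ler_wpM2r// ler_wpM2l// ltW.
case: b => [[] []]; rewrite /tr/=.
- exact: le_trans (ctr_lipschitz T0 x y (L2X Lg)) (w _ h2).
- exact: le_trans (str_lipschitz T0 x y (L2X Lg)) (w _ h2).
- exact: le_trans (ctr_lipschitz T0 x y Lg) (w _ h1).
- exact: le_trans (str_lipschitz T0 x y Lg) (w _ h1).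
Qed.

(** The Lipschitz bound propagates smallness from grid points to the interval
    that they span. *)
Lemma energy_grid g M (r d : R) (n : nat) : L2 g -> sqn g <= M -> 0 < d -> 0 <= r ->
  T * trcst M * d <= r ->
  (forall b (k : 'I_n), `|tr b g (k%:R * d)| <= r) ->
  forall y, 0 <= y -> y < n%:R * d -> energy g y <= 16 * r ^+ 2.
Proof.
move=> Lg gM d0 r0 dr hr y y0 yn.
have trb b : tr b g y ^+ 2 <= 4 * r ^+ 2.
  have yd : 0 <= y / d by rewrite divr_ge0// ltW.
  have /andP[k1 k2] := truncn_itv yd; set k := Num.truncn _ in k1 k2.
  have kn : (k < n)%N.
    by rewrite -(ltr_nat R); apply: le_lt_trans k1 _; rewrite ltr_pdivrMr.
  have yk : `|y - k%:R * d| <= d.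
    have h1 : k%:R * d <= y by rewrite -ler_pdivlMr.
    have h2 : y < k%:R * d + d by move: k2; rewrite -natr1 ltr_pdivrMr// mulrDl mul1r.
    by rewrite ger0_norm; lra.
  have t0 : 0 <= T * trcst M.
    rewrite mulr_ge0 ?(ltW T0)//.
    by apply: le_trans (tr_bounded b y Lg gM); exact: normr_ge0.
  have l1 := tr_lipschitz b y (k%:R * d) Lg gM.
  have l2 := hr b (Ordinal kn); rewrite /= in l2.
  have l3 : `|tr b g y| <= 2 * r.
    have -> : tr b g y = (tr b g y - tr b g (k%:R * d)) + tr b g (k%:R * d) by rewrite subrK.
    have l4 := le_trans l1 (ler_wpM2l t0 yk).
    apply: (le_trans (ler_normD _ _)); move: l2 l4 dr; lra.
  rewrite -(real_normK (num_real (tr b g y))).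
  have -> : 4 * r ^+ 2 = (2 * r) ^+ 2 by rewrite exprMn; congr (_ * _); ring.
  by rewrite ler_pXn2r// nnegrE mulr_ge0.
have := trb (false, true); have := trb (false, false); have := trb (true, true); have := trb (true, false).
rewrite energy_tr; lra.
Qed.

End compactness.

(** * A density implies compactness *)

Lemma budget_arith (R : realFieldType) (N C0 m X r2 e e1 P A Ey J : R) : 0 < C0 ->
  0 <= P -> 0 <= J -> J <= P -> 0 <= e1 ->
  0 < 2 + 32 * (1 + A) * Ey ->
  N <= C0 * (m + X) -> m <= 2 * r2 -> X <= e1 * J + (1 + A) * (32 * r2) * Ey ->
  r2 = e ^+ 2 / (2 * C0 * (2 + 32 * (1 + A) * Ey)) ->
  e1 = e ^+ 2 / (2 * C0 * (P + 1)) -> N <= e ^+ 2.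
Proof.
move=> C00 P0 J0 JP e10 Q0 NN mr XX re ee.
set Q := 2 + _ in Q0 re.
have h1 : C0 * (r2 * Q) = e ^+ 2 / 2.
  by rewrite re; field; rewrite ?gt_eqF//.
have P1 : 0 < P + 1 by rewrite ltr_wpDl.
have h2 : C0 * (e1 * (P + 1)) = e ^+ 2 / 2.
  by rewrite ee; field; rewrite ?gt_eqF//.
apply: (le_trans NN).
have -> : e ^+ 2 = C0 * (r2 * Q + e1 * (P + 1)) by rewrite mulrDr h1 h2; field.
rewrite ler_pM2l//.
have h3 : e1 * J <= e1 * P by exact: ler_wpM2l.
have h4 : r2 * Q = 2 * r2 + (1 + A) * (32 * r2) * Ey by rewrite /Q; ring.
rewrite h4 mulrDr mulr1; move: mr XX h3 e10; lra.
Qed.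

Section psi_compact.
Context (R : realType) (T : R).
Hypothesis T0 : 0 < T.
Notation mu := (@lebesgue_measure R).
Local Notation muI := (mrestr (@lebesgue_measure R) (measurable_sym_itv T)).
Local Notation I := (sym_itv T).
Local Notation H := (`[0, +oo[%classic : set (measurableTypeR R)).
Local Notation L2 := (L2 T).
Local Notation sqn := (sqn T).
Local Notation ip := (ip T).
Local Notation mI := (measurable_I T).
Local Notation mH := (@measurable_H R).
Local Notation energy := (energy T).
Local Notation tr := (tr T).
Local Notation Re := (@complex.Re _).
Local Notation Im := (@complex.Im _).
Implicit Types (u v : cL2 muI).

Lemma sqn_rre_le u : sqn (rre u) <= rnorm u ^+ 2.
Proof. by rewrite rnorm_sq lerDl sqn_ge0. Qed.

Lemma sqn_rim_le u : sqn (rim u) <= rnorm u ^+ 2.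
Proof. by rewrite rnorm_sq lerDr sqn_ge0. Qed.

Lemma bounded_rnorm (B : set (cL2 muI)) : bounded_set B ->
  exists2 M : R, 0 < M & forall u, B u -> rnorm u <= M.
Proof.
case=> z [zr zB]; exists (`|Re z| + 1); first by rewrite ltr_wpDl.
move=> u Bu; have zlt : z < (`|Re z| + 1)%:C.
  have -> : z = (Re z)%:C by apply/esym/RRe_real.
  by rewrite ltcR /= (le_lt_trans (ler_norm _))// ltrDl.
have h : `|u| <= (`|Re z| + 1)%:C by exact: zB _ zlt u Bu.
by move: h; rewrite normE lecR.
Qed.

Definition trR (x : bool * (bool * bool)) u y :=
  tr x.2 (if x.1 then rre u else rim u) y.

Lemma trRB x u v y : trR x (u - v) y = trR x u y - trR x v y.
Proof.
have -> : u - v = (-1) *: v + u by rewrite scaleN1r addrC.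
case: x => [[] b]; rewrite /trR/= !tr_ip.
- by rewrite (ip_rre_comb _ _ _ (L2_probe T0 b y)) /= oppr0 mul0r subr0 mulN1r addrC.
- by rewrite (ip_rim_comb _ _ _ (L2_probe T0 b y)) /= oppr0 mul0r addr0 mulN1r addrC.
Qed.

Lemma mass_tr u : mass u =
  trR (true, (false, true)) u 0 ^+ 2 + trR (false, (false, true)) u 0 ^+ 2.
Proof.
rewrite /mass; congr (_ ^+ 2 + _ ^+ 2); apply: eq_Rintegral => t _;
by rewrite mulr0 cos0 mulr1.
Qed.

Lemma expR_tail_le (Y y : R) : y < Y -> 1 <= expR Y * expR (- (1 * y)).
Proof. by move=> yY; rewrite -expRD mul1r -expR0 ler_expR subr_ge0 ltW. Qed.

Variable (K : set nat) (A : R).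
Hypothesis hK : K `<=` [set n | (0 < n)%N].
Hypothesis hA : 0 <= A.
Local Notation Psi := (Psi_op K A T).
Local Notation dev := (dev K A).

(** Beyond [Y] the deviation is small, and below [Y] the energy is. *)
Lemma dev_energy_split u (Y e1 q : R) : 0 <= e1 -> 0 <= q ->
  (forall y, Y <= y -> `|dev y| <= e1) ->
  (forall y, 0 <= y -> y < Y -> cenergy u y <= q) ->
  \int[mu]_(y in H) (`|dev y| * cenergy u y) <=
  e1 * (\int[mu]_(y in H) cenergy u y) + (1 + A) * q * expR Y.
Proof.
move=> e10 q0 dY eY.
have mn : measurable_fun setT (fun y => `|dev y|).
  by apply: measurableT_comp => //; exact: measurable_dev.
have dl y : 0 <= y -> `| `|dev y| | <= 1 + A by move=> _; rewrite normr_id dev_le.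
have [iu _] := cenergy_bound T0 u; have [ie ee] := @expRN_integral R 1 0 ltr01.
have i1 := intgZ e1 mH iu; have i2 := intgZ ((1 + A) * q * expR Y) mH ie.
have -> : e1 * (\int[mu]_(y in H) cenergy u y) + (1 + A) * q * expR Y =
   \int[mu]_(y in H) (e1 * cenergy u y + (1 + A) * q * expR Y * expR (- (1 * y))).
  rewrite (RintegralD mH i1 i2) (RintegralZl _ mH iu) (RintegralZl _ mH ie) ee.
  by rewrite mulr0 oppr0 expR0 divr1 mulr1.
apply: le_Rintegral mH (intg_cenergyM T0 u mn dl) (intgD mH i1 i2) _ => y.
rewrite /= in_itv/= andbT => y0; have c0 := cenergy_ge0 u y.
have A1 : 0 <= 1 + A by rewrite addr_ge0.
have [yY|Yy] := ltP y Y.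
  apply: ler_wpDl; first exact: mulr_ge0.
  apply: (@le_trans _ _ ((1 + A) * q)).
    by apply: ler_pM => //; [exact: dev_le|exact: eY].
  by rewrite -mulrA ler_peMr ?mulr_ge0// expR_tail_le.
apply: ler_wpDr; first by rewrite !mulr_ge0 ?expR_ge0.
by apply: ler_wpM2r => //; exact: dY.
Qed.

(** By the a priori estimate, [Psi] is small on vectors whose energy is small
    below the threshold [Y] after which the deviation is negligible. On bounded
    sets that energy is controlled by finitely many samples of transforms,
    which are recorded by a finite code. *)
Lemma Psi_compact : dev y @[y --> +oo] --> (0 : R) -> compact_operator Psi.
Proof.
move=> dev0; split; first exact: Psi_linear.
move=> B /bounded_rnorm[M M0 MB].
apply: (precompact_code T0) => e e0.
pose M4 := (2 * M) ^+ 2; pose P := pi * (1 + T ^+ 2) * M4.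
have C00 := apriori_cst_gt0 T0 hA; set C0 := apriori_cst T A in C00.
have T1 : 0 < 1 + T ^+ 2 by rewrite ltr_wpDr// sqr_ge0.
have P0 : 0 <= P by rewrite !mulr_ge0 ?pi_ge0 ?sqr_ge0// ltW.
pose e1 := e ^+ 2 / (2 * C0 * (P + 1)).
have e10 : 0 < e1 by rewrite divr_gt0 ?exprn_gt0// !mulr_gt0// ltr_wpDl.
have [Y0 [_ HY]] : \forall y \near +oo, `|dev y| <= e1.
  by move/cvgr0Pnorm_le : dev0; apply.
pose Y := Num.max 0 (Y0 + 1).
have Y00 : 0 <= Y by rewrite le_max lexx.
have YP y : Y <= y -> `|dev y| <= e1.
  by move=> Yy; apply: HY; apply: lt_le_trans Yy; rewrite lt_max ltrDl ltr01 orbT.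
have A1 : 0 < 1 + A by rewrite ltr_wpDr.
have Q0 : 0 < 2 + 32 * (1 + A) * expR Y.
  by rewrite ltr_wpDr// !mulr_ge0 ?expR_ge0// ltW.
pose r := Num.sqrt (e ^+ 2 / (2 * C0 * (2 + 32 * (1 + A) * expR Y))).
have rr0 : 0 < e ^+ 2 / (2 * C0 * (2 + 32 * (1 + A) * expR Y)).
  by rewrite divr_gt0 ?exprn_gt0// !mulr_gt0.
have r0 : 0 < r by rewrite sqrtr_gt0.
have r2 : r ^+ 2 = e ^+ 2 / (2 * C0 * (2 + 32 * (1 + A) * expR Y)).
  by rewrite sqr_sqrtr// ltW.
have Lc0 : 0 < T * trcst T M4.
  have M40 : 0 <= M4 by exact: sqr_ge0.
  apply: mulr_gt0 => //; apply: addr_gt0; apply: ltr_wpDr => //.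
  by apply: mulr_ge0 => //; exact: sqr_ge0.
pose d := r / (T * trcst T M4).
have d0 : 0 < d by rewrite divr_gt0.
pose n := (Num.truncn (Y / d)).+1.
have Yn : Y < n%:R * d.
  by rewrite -ltr_pdivrMr// truncnS_gt.
have [|C [c cP]] := @finite_code R _ ((bool * (bool * bool)) * 'I_n)%type
   (fun x u => trR x.1 u (x.2%:R * d)) B (trcst T (M ^+ 2)) r r0.
  move=> [[b b'] k] u Bu; rewrite /trR/=; have uM : rnorm u ^+ 2 <= M ^+ 2.
    by rewrite ler_pXn2r// ?nnegrE ?rnorm_ge0 ?MB// ltW.
  case: b; apply: tr_bounded => //.
  - exact: L2_rre.
  - exact: le_trans (sqn_rre_le u) uM.
  - exact: L2_rim.
  - exact: le_trans (sqn_rim_le u) uM.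
exists C, c => u v Bu Bv cuv; have {}cP := cP u v Bu Bv cuv.
have -> : Psi u - Psi v = Psi (u - v).
  have := Psi_linear T0 A hK (-1) v u.
  by rewrite !scaleN1r ![- _ + _]addrC.
set w := u - v.
have wP x (k : 'I_n) : `|trR x w (k%:R * d)| <= r.
  by rewrite trRB; exact: (cP (x, k)).
have wM : rnorm w ^+ 2 <= M4.
  rewrite /M4 ler_pXn2r// ?nnegrE ?rnorm_ge0 ?mulr_ge0 ?(ltW M0)//.
  apply: (le_trans (rnormD _ _)); rewrite mulr_natl mulr2n; apply: lerD; first exact: MB.
  by rewrite -[rnorm (- v)]/(rnorm _) -(sub0r v) rnorm_subC subr0; exact: MB.
have dr : T * trcst T M4 * d <= r by rewrite /d mulrC divfK// gt_eqF.
have en y : 0 <= y -> y < Y -> cenergy w y <= 32 * r ^+ 2.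
  move=> y0 yY; have yn := lt_trans yY Yn.
  have h1 := energy_grid T0 (L2_rre w) (le_trans (sqn_rre_le w) wM) d0 (ltW r0) dr
    (fun b k => wP (true, b) k) y0 yn.
  have h2 := energy_grid T0 (L2_rim w) (le_trans (sqn_rim_le w) wM) d0 (ltW r0) dr
    (fun b k => wP (false, b) k) y0 yn.
  apply: (le_trans (lerD h1 h2)); rewrite -mulrDl.
  by rewrite (_ : 16 + 16 = 32 :> R)//; ring.
have mw : mass w <= 2 * r ^+ 2.
  have h x : trR x w 0 ^+ 2 <= r ^+ 2.
    rewrite -(real_normK (num_real (trR x w 0))) ler_pXn2r// ?nnegrE// ?(ltW r0)//.
    by have := wP x ord0; rewrite mul0r.
  by rewrite mass_tr mulr_natl mulr2n; apply: lerD; exact: h.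
have [iw lw] := cenergy_bound T0 w.
have J0 : 0 <= \int[mu]_(y in H) cenergy w y.
  by apply: Rintegral_ge0 => y _; exact: cenergy_ge0.
have JP : \int[mu]_(y in H) cenergy w y <= P.
  apply: (le_trans lw); apply: ler_wpM2l wM; by rewrite mulr_ge0 ?pi_ge0// ltW.
have q0 : 0 <= 32 * r ^+ 2 by rewrite mulr_ge0// sqr_ge0.
have XX := dev_energy_split (ltW e10) q0 YP en.
have fin := budget_arith C00 P0 J0 JP (ltW e10) Q0 (Psi_apriori T0 hK hA w) mw XX r2 erefl.
by rewrite -(@ler_pXn2r _ 2%N)// nnegrE ?rnorm_ge0// ltW.
Qed.

End psi_compact.

(** * The Riemann-Lebesgue lemma and modulated transforms *)

Section calculus.
Context (R : realType).
Notation mu := (@lebesgue_measure R).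
Local Notation H := (`[0, +oo[%classic : set (measurableTypeR R)).
Local Notation mH := (@measurable_H R).

(** Differentiability from a quadratic remainder, the form in which a
    derivative passes under the integral sign. *)
Lemma is_derive_quad (f : R -> R) (l C y : R) :
  (forall h, `|f (y + h) - f y - h * l| <= C * h ^+ 2) -> is_derive y 1 f l.
Proof.
move=> fC.
have c : h^-1 *: ((f \o shift y) (h *: 1) - f y) @[h --> 0^'] --> l.
  apply/cvgrPdist_le => e e0; near=> h.
  have h0 : h != 0 by near: h; exact: nbhs_dnbhs_neq.
  have hd : `|h| <= e / (`|C| + 1).
    near: h; apply: dnbhs0_le; by rewrite divr_gt0// ltr_wpDl.
  have C1 : 0 < `|C| + 1 by rewrite ltr_wpDl.
  rewrite /= /GRing.scale/= mulr1 [h + y]addrC.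
  have -> : l - h^-1 * (f (y + h) - f y) = - (h^-1 * (f (y + h) - f y - h * l)).
    by field.
  rewrite normrN normrM normfV ler_pdivrMl ?normr_gt0//.
  apply: (le_trans (fC h)); rewrite -(real_normK (num_real h)) expr2 mulrCA.
  apply: ler_wpM2l => //.
  apply: (@le_trans _ _ ((`|C| + 1) * `|h|)).
    by apply: ler_wpM2r => //; rewrite (le_trans (ler_norm _))// lerDl.
  by rewrite mulrC -ler_pdivlMr.
by apply: DeriveDef; [exact: cvgP c|exact: cvg_lim c].
Unshelve. all: by end_near. Qed.

Lemma intg_itv_cont (f : R -> R) (a b : R) : continuous f -> intg `[a, b] f.
Proof.
move=> cf; apply: continuous_compact_integrable; first exact: segment_compact.
exact: continuous_subspaceT.
Qed.

Lemma Rintegral_subset (A B : set (measurableTypeR R)) (f : R -> R) :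
  measurable A -> measurable B -> A `<=` B -> intg B f -> (forall x, B x -> 0 <= f x) ->
  \int[mu]_(x in A) f x <= \int[mu]_(x in B) f x.
Proof.
move=> mA mB AB iB f0; have iA : intg A f by exact: integrableS iB.
apply: fine_le; [exact: integrable_fin_num|exact: integrable_fin_num|].
apply: ge0_subset_integral => //; first by apply/measurable_EFinP; exact: (intg_measurable iB).
Qed.

Lemma Rintegral_cst_itv (c a b : R) : a <= b -> \int[mu]_(x in `[a, b]) c = c * (b - a).
Proof.
move=> ab; have d (x : R) : is_derive x 1 (fun x => c * x) c.
  by apply: is_derive_eq; rewrite /GRing.scale/=; ring.
have cc : continuous (fun _ : R => c) by move=> x; exact: cvg_cst.
by rewrite (Rintegral_FTC ab d cc) mulrBr.
Qed.

Lemma measurable_ge (a : R) : measurable (`[a, +oo[%classic : set (measurableTypeR R)).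
Proof. exact: measurable_itv. Qed.

Lemma tail_cvg (f : R -> R) : intg H f ->
  \int[mu]_(x in H) (f x * \1_(`[n%:R, +oo[%classic : set R) x) @[n --> \oo] --> (0 : R).
Proof.
move=> iff_; have i0 : \int[mu]_(x in H) (0 : R) = 0 by rewrite /Rintegral integral0.
pose u (n : nat) x := f x * \1_(`[n%:R, +oo[%classic : set R) x.
have m1 n : measurable_fun H (u n).
  apply: measurable_funM; first exact: (intg_measurable iff_).
  by apply: measurable_funTS; exact: (measurable_indic (measurable_ge n%:R)).
have c1 x : H x -> u n x @[n --> \oo] --> (0 : R).
  move=> _; apply: cvg_near_cst; near=> n; rewrite /u indicE memNset ?mulr0//.
  rewrite /= in_itv/= andbT; apply/negP; rewrite -ltNge.
  by near: n; exact: nbhs_infty_gtr.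
have b1 n x : H x -> `|u n x| <= `|f x|.
  by move=> _; rewrite normrM ler_piMr// indicE; case: (_ \in _); rewrite ?normr1 ?normr0.
have [_ c] := Rdominated_cvg mH m1 c1 (integrable_norm iff_) b1.
by rewrite i0 in c.
Unshelve. all: by end_near. Qed.

(** A value above [e] would persist on an interval of fixed length and
    contribute a fixed amount to arbitrarily late tails of the integral. *)
Lemma lip_intg_cvg0 (f : R -> R) (L : R) : 0 < L -> intg H f -> (forall x, 0 <= f x) ->
  (forall x y, `|f x - f y| <= L * `|x - y|) -> f y @[y --> +oo] --> (0 : R).
Proof.
move=> L0 iff_ f0 fL; apply/cvgr0Pnorm_le => e e0.
pose d := e / (2 * L); have d0 : 0 < d by rewrite divr_gt0// mulr_gt0.
have de : 0 < d * (e / 2) by rewrite mulr_gt0// divr_gt0.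
have [N _ HN] : \forall n \near \oo,
    \int[mu]_(x in H) (f x * \1_(`[n%:R, +oo[%classic : set R) x) <= d * (e / 2).
  by apply: cvgr_le (tail_cvg iff_) _ de.
have {}HN := HN N (leqnn N).
near=> y; have yN : N%:R <= y by near: y; exact: nbhs_pinfty_ge.
rewrite ger0_norm//.
have y0 : 0 <= y by exact: le_trans (ler0n _ N) yN.
have cf : continuous f by exact: lipschitz_continuous fL.
have mJ : measurable (`[y, y + d]%classic : set (measurableTypeR R)) by exact: measurable_itv.
have JH : (`[y, y + d]%classic : set (measurableTypeR R)) `<=` H.
  by move=> x /=; rewrite !in_itv/= andbT => /andP[yx _]; exact: le_trans y0 yx.
have yd : y <= y + d by rewrite lerDl ltW.
have ic : intg `[y, y + d] (fun=> f y - L * d) by apply: intg_itv_cont => x; exact: cvg_cst.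
have h1 : (f y - L * d) * (y + d - y) <= \int[mu]_(x in `[y, y + d]) f x.
  rewrite -(Rintegral_cst_itv _ yd); apply: (le_Rintegral mJ ic (intg_itv_cont _ _ cf)).
  move=> x /=; rewrite in_itv/= => /andP[yx xd].
  have := fL y x; rewrite ler_norml => /andP[_ h].
  have xy : `|y - x| <= d by rewrite distrC ger0_norm ?subr_ge0// lerBlDl.
  have := ler_wpM2l (ltW L0) xy; lra.
have h2 : \int[mu]_(x in `[y, y + d]) f x <= d * (e / 2).
  apply: le_trans HN.
  have -> : \int[mu]_(x in `[y, y + d]) f x =
     \int[mu]_(x in `[y, y + d]) (f x * \1_(`[N%:R, +oo[%classic : set R) x).
    apply: eq_Rintegral => x; rewrite inE/= in_itv/= => /andP[yx _].
    by rewrite indicE mem_set ?mulr1//= in_itv/= andbT; exact: le_trans yN yx.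
  apply: Rintegral_subset mJ mH JH _ _.
    apply: (intgM_bounded (B := 1) mH iff_).
      by apply: measurable_funTS; exact: (measurable_indic (measurable_ge N%:R)).
    by move=> x _; rewrite indicE; case: (_ \in _); rewrite ?normr1 ?normr0.
  by move=> x _; rewrite mulr_ge0// indicE.
have h3 : f y - L * d <= e / 2.
  by move: (le_trans h1 h2); rewrite addrAC subrr add0r mulrC ler_pM2l.
have h4 : L * d = e / 2 by rewrite /d; field; rewrite gt_eqF.
by move: h3; rewrite h4; lra.
Unshelve. all: by end_near. Qed.

(** Cauchy density, the common majorant of the kernels below. *)
Definition lorentz (w y : R) := (1 + (y - w) ^+ 2)^-1.

Lemma lorentz_gt0 w y : 0 < lorentz w y.
Proof. by rewrite invr_gt0 ltr_wpDr// sqr_ge0. Qed.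

Lemma is_derive_atanB (w x : R) : is_derive x 1 (fun y => atan (y - w)) (lorentz w x).
Proof. by apply: is_derive_eq; rewrite /GRing.scale/= /lorentz; ring. Qed.

Lemma continuous_lorentz w : continuous (lorentz w).
Proof.
have dE (z : R) : is_derive z 1 (fun y : R => 1 + (y - w) ^+ 2) (2 * (z - w)).
  by apply: is_derive_eq; rewrite /GRing.scale/=; ring.
move=> x; have n0 : 1 + (x - w) ^+ 2 != 0 by rewrite gt_eqF// ltr_wpDr// sqr_ge0.
have P : continuous (fun y : R => 1 + (y - w) ^+ 2) by exact: continuous_is_derive dE.
have c := @cvgV R _ _ _ (fun y : R => 1 + (y - w) ^+ 2) _ n0 (P x).
exact: c.
Qed.

Lemma lorentz_integral (w a : R) : intg `[a, +oo[ (lorentz w) /\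
  \int[mu]_(y in `[a, +oo[) lorentz w y = pi / 2 - atan (a - w).
Proof.
have lim : atan (y - w) @[y --> +oo] --> (pi / 2 : R).
  apply: (@cvg_comp _ _ _ (fun y => y - w) atan _ (pinfty_nbhs R)); last exact: cvgy_atan.
  apply/cvgryPge => M; near=> y; rewrite lerBrDr; near: y; exact: nbhs_pinfty_ge (num_real _).
have e : (\int[mu]_(y in `[a, +oo[) (lorentz w y)%:E = (pi / 2)%:E - (atan (a - w))%:E)%E.
  apply: (@ge0_continuous_FTC2y _ (lorentz w) (fun y => atan (y - w))).
  - by move=> x _; exact: ltW (lorentz_gt0 w x).
  - by apply: continuous_subspaceT; exact: continuous_lorentz.
  - exact: lim.
  - by move=> x _; have [] := is_derive_atanB w x.
  - by apply: cvg_at_right_filter; exact: continuous_is_derive (is_derive_atanB w) _.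
  - by move=> x _; rewrite derive1E; have [_ ->] := is_derive_atanB w x.
split; last by rewrite /Rintegral e.
apply/integrableP; split.
  apply/measurable_EFinP/measurable_funTS; apply: continuous_measurable_fun.
  exact: continuous_lorentz.
under eq_integral do rewrite gee0_abs ?lee_fin ?(ltW (lorentz_gt0 _ _))//.
by rewrite e -EFinB ltry.
Unshelve. all: by end_near. Qed.

Lemma lorentz_integral_le (w a : R) : \int[mu]_(y in `[a, +oo[) lorentz w y <= pi.
Proof. by have [_ ->] := lorentz_integral w a; have := atan_gtNpi2 (a - w); lra. Qed.

Lemma mvt01 (f f' : R -> R) (B : R) : (forall s : R, is_derive s 1 f (f' s)) ->
  (forall s, 0 <= s -> s <= 1 -> `|f' s| <= B) -> `|f 1 - f 0| <= B.
Proof.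
move=> df fB; have [|c c01 ->] := MVT (@ltr01 R) (fun x _ => df x).
  exact/continuous_subspaceT/continuous_is_derive.
move: c01; rewrite in_itv/= => /andP[c0 c1].
by rewrite subr0 mulr1; apply: fB; exact: ltW.
Qed.

Lemma cos_quad (x k : R) : `|cos (x + k) - cos x - k * - sin x| <= k ^+ 2.
Proof.
have d (s : R) : is_derive s 1 (fun s => cos (x + s * k) + s * k * sin x)
    (k * (sin x - sin (x + s * k))).
  by apply: is_derive_eq; rewrite /GRing.scale/=; ring.
have := mvt01 (B := k ^+ 2) d; rewrite !mul1r !mul0r !addr0 => h.
have -> : cos (x + k) - cos x - k * - sin x = cos (x + k) + k * sin x - cos x by ring.
apply: h => s s0 s1; rewrite normrM -(real_normK (num_real k)) expr2.
apply: ler_wpM2l => //; apply: (le_trans (sin_lipschitz _ _)).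
rewrite opprD addrA subrr add0r normrN normrM ger0_norm//.
by rewrite ler_piMl.
Qed.

Lemma sin_quad (x k : R) : `|sin (x + k) - sin x - k * cos x| <= k ^+ 2.
Proof.
have d (s : R) : is_derive s 1 (fun s => sin (x + s * k) - s * k * cos x)
    (k * (cos (x + s * k) - cos x)).
  by apply: is_derive_eq; rewrite /GRing.scale/=; ring.
have := mvt01 (B := k ^+ 2) d; rewrite !mul1r !mul0r !addr0 subr0 => h.
have -> : sin (x + k) - sin x - k * cos x = sin (x + k) - k * cos x - sin x by ring.
apply: h => s s0 s1; rewrite normrM -(real_normK (num_real k)) expr2.
apply: ler_wpM2l => //; apply: (le_trans (cos_lipschitz _ _)).
by rewrite addrAC subrr add0r normrM ger0_norm// ler_piMl.
Qed.

End calculus.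

Section transforms.
Context (R : realType) (T : R).
Hypothesis T0 : 0 < T.
Notation mu := (@lebesgue_measure R).
Local Notation I := (sym_itv T).
Local Notation H := (`[0, +oo[%classic : set (measurableTypeR R)).
Local Notation L2 := (L2 T).
Local Notation ip := (ip T).
Local Notation mI := (measurable_I T).
Local Notation mH := (@measurable_H R).
Local Notation ctr := (ctr T).
Local Notation str := (str T).

(** Riemann-Lebesgue, from Bessel's inequality and the Lipschitz bound. *)
Lemma riemann_lebesgue g : L2 g ->
  ctr g y @[y --> +oo] --> (0 : R) /\ str g y @[y --> +oo] --> (0 : R).
Proof.
move=> Lg; have [ib _] := bessel T0 Lg.
have n0 : 0 <= nrm1 T g by apply: le_trans (ctr_bounded T0 0 Lg).
pose L := 4 * (nrm1 T g * (T * nrm1 T g)) + 1.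
have L0 : 0 < L by rewrite ltr_wpDl// !mulr_ge0// ltW.
have sqL (f : R -> R) : (forall y, `|f y| <= nrm1 T g) ->
    (forall x y, `|f x - f y| <= T * nrm1 T g * `|x - y|) ->
    forall x y, `|f x ^+ 2 - f y ^+ 2| <= 2 * (nrm1 T g * (T * nrm1 T g)) * `|x - y|.
  move=> fb fl x y; rewrite subr_sqr mulrC normrM.
  have h1 : `|f x + f y| <= 2 * nrm1 T g.
    by rewrite mulr_natl mulr2n (le_trans (ler_normD _ _))// lerD.
  rewrite -2!mulrA mulrA -mulrA; apply: (le_trans (ler_pM _ _ h1 (fl x y))) => //.
  by rewrite le_eqVlt; apply/orP; left; apply/eqP; ring.
have cv := @lip_intg_cvg0 _ (pow_spec T g) L L0 ib.
have {}cv : pow_spec T g y @[y --> +oo] --> (0 : R).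
  apply: cv => [x|x y]; first by rewrite addr_ge0// sqr_ge0.
  have h1 := sqL _ (fun y => ctr_bounded T0 y Lg) (fun x y => ctr_lipschitz T0 x y Lg) x y.
  have h2 := sqL _ (fun y => str_bounded T0 y Lg) (fun x y => str_lipschitz T0 x y Lg) x y.
  have -> : pow_spec T g x - pow_spec T g y =
    (ctr g x ^+ 2 - ctr g y ^+ 2) + (str g x ^+ 2 - str g y ^+ 2) by rewrite /pow_spec; ring.
  apply: (le_trans (ler_normD _ _)); apply: (le_trans (lerD h1 h2)).
  by rewrite -mulrDl; apply: ler_wpM2r => //; rewrite /L; lra.
have sm (f : R -> R) : (forall y, f y ^+ 2 <= pow_spec T g y) -> f y @[y --> +oo] --> (0 : R).
  move=> fp; apply/cvgr0Pnorm_le => e e0; near=> y.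
  have h : pow_spec T g y <= e ^+ 2.
    near: y; apply: cvgr_le cv _ _; exact: exprn_gt0.
  rewrite -(@ler_pXn2r _ 2%N)// ?nnegrE ?(ltW e0)//.
  by rewrite real_normK ?num_real// (le_trans (fp y)).
by split; apply: sm => y; rewrite /pow_spec ?lerDl ?lerDr sqr_ge0.
Unshelve. all: by end_near. Qed.

Lemma is_derive_ctr g (y : R) : L2 g -> is_derive y 1 (ctr g) (- str (mulX g) y).
Proof.
move=> Lg; apply: (@is_derive_quad _ _ _ (T ^+ 2 * nrm1 T g)) => h.
have i1 := intg_cosM T0 (y + h) Lg; have i2 := intg_cosM T0 y Lg.
have i3 := intgZ h mI (intg_sinM T0 y (L2X Lg)).
have n1 := integrable_norm (L2_int T0 Lg).
rewrite mulrN opprK -(RintegralZl h mI (intg_sinM T0 y (L2X Lg))) -(RintegralB mI i1 i2).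
rewrite -(RintegralD mI (intgB mI i1 i2) i3) [in leRHS]mulrAC -(RintegralZl (T ^+ 2 * h ^+ 2) mI n1).
apply: (le_Rintegral_norm mI (intgD mI (intgB mI i1 i2) i3) (intgZ _ mI n1)) => t It.
have -> : g t * cos (t * (y + h)) - g t * cos (t * y) + h * (mulX g t * sin (t * y)) =
  g t * (cos (t * y + t * h) - cos (t * y) - t * h * - sin (t * y)).
  by rewrite /mulX mulrDr; ring.
rewrite normrM mulrC; apply: ler_wpM2r => //; apply: (le_trans (cos_quad _ _)).
rewrite exprMn; apply: ler_wpM2r; first exact: sqr_ge0.
by rewrite -(real_normK (num_real t)) ler_pXn2r// ?nnegrE ?(ltW T0)// in_I.
Qed.

Lemma is_derive_str g (y : R) : L2 g -> is_derive y 1 (str g) (ctr (mulX g) y).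
Proof.
move=> Lg; apply: (@is_derive_quad _ _ _ (T ^+ 2 * nrm1 T g)) => h.
have i1 := intg_sinM T0 (y + h) Lg; have i2 := intg_sinM T0 y Lg.
have i3 := intgZ h mI (intg_cosM T0 y (L2X Lg)).
have n1 := integrable_norm (L2_int T0 Lg).
rewrite -(RintegralZl h mI (intg_cosM T0 y (L2X Lg))) -(RintegralB mI i1 i2).
rewrite -(RintegralB mI (intgB mI i1 i2) i3) [in leRHS]mulrAC -(RintegralZl (T ^+ 2 * h ^+ 2) mI n1).
apply: (le_Rintegral_norm mI (intgB mI (intgB mI i1 i2) i3) (intgZ _ mI n1)) => t It.
have -> : g t * sin (t * (y + h)) - g t * sin (t * y) - h * (mulX g t * cos (t * y)) =
  g t * (sin (t * y + t * h) - sin (t * y) - t * h * cos (t * y)).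
  by rewrite /mulX mulrDr; ring.
rewrite normrM mulrC; apply: ler_wpM2r => //; apply: (le_trans (sin_quad _ _)).
rewrite exprMn; apply: ler_wpM2r; first exact: sqr_ge0.
by rewrite -(real_normK (num_real t)) ler_pXn2r// ?nnegrE ?(ltW T0)// in_I.
Qed.

(** Modulating a function by [cos (t * w)] or [sin (t * w)] shifts its transforms
    by [w] in both directions. *)
Lemma ctr_modc g w y : L2 g -> ctr (fun t => g t * cos (t * w)) y =
  2^-1 * (ctr g (y - w) + ctr g (y + w)).
Proof.
move=> Lg; have i1 := intg_cosM T0 (y - w) Lg; have i2 := intg_cosM T0 (y + w) Lg.
rewrite -(RintegralD mI i1 i2) -(RintegralZl _ mI (intgD mI i1 i2)).
by apply: eq_Rintegral => t _; rewrite (mulrBr t) (mulrDr t) cosB cosD; field.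
Qed.

Lemma str_modc g w y : L2 g -> str (fun t => g t * cos (t * w)) y =
  2^-1 * (str g (y - w) + str g (y + w)).
Proof.
move=> Lg; have i1 := intg_sinM T0 (y - w) Lg; have i2 := intg_sinM T0 (y + w) Lg.
rewrite -(RintegralD mI i1 i2) -(RintegralZl _ mI (intgD mI i1 i2)).
by apply: eq_Rintegral => t _; rewrite (mulrBr t) (mulrDr t) sinB sinD; field.
Qed.

Lemma ctr_mods g w y : L2 g -> ctr (fun t => g t * sin (t * w)) y =
  2^-1 * (str g (y + w) - str g (y - w)).
Proof.
move=> Lg; have i1 := intg_sinM T0 (y + w) Lg; have i2 := intg_sinM T0 (y - w) Lg.
rewrite -(RintegralB mI i1 i2) -(RintegralZl _ mI (intgB mI i1 i2)).
by apply: eq_Rintegral => t _; rewrite (mulrBr t) (mulrDr t) sinB sinD; field.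
Qed.

Lemma str_mods g w y : L2 g -> str (fun t => g t * sin (t * w)) y =
  2^-1 * (ctr g (y - w) - ctr g (y + w)).
Proof.
move=> Lg; have i1 := intg_cosM T0 (y - w) Lg; have i2 := intg_cosM T0 (y + w) Lg.
rewrite -(RintegralB mI i1 i2) -(RintegralZl _ mI (intgB mI i1 i2)).
by apply: eq_Rintegral => t _; rewrite (mulrBr t) (mulrDr t) cosB cosD; field.
Qed.

Lemma FTC_I (F f : R -> R) : (forall x : R, is_derive x 1 F (f x)) -> continuous f ->
  \int[mu]_(t in I) f t = F T - F (- T).
Proof.
move=> dF cf; have TT : - T <= T by rewrite ge0_cp// ltW.
have ic : intg `[- T, T] f by exact: intg_itv_cont.
rewrite -(Rintegral_FTC TT dF cf) /sym_itv.
rewrite Rintegral_itv_bndo_bndc; last first.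
  apply: integrableS ic; [exact: measurable_itv|exact: measurable_itv|].
  by apply: subset_itv; rewrite bnd_simp.
rewrite Rintegral_itv_obnd_cbnd//; apply: integrableS ic.
- exact: measurable_itv.
- exact: measurable_itv.
- by apply: subset_itv; rewrite bnd_simp.
Qed.

Definition unitf (t : R) : R := 1.

Lemma L2_one : L2 unitf. Proof. exact: L2_cst. Qed.

Definition fa (l : R) := ctr unitf l.
Definition fp (l : R) := str (mulX unitf) l.

Lemma mul_fa l : l * fa l = 2 * sin (l * T).
Proof.
have i1 := intg_cosM T0 l L2_one; rewrite -(RintegralZl l mI i1).
have d (x : R) : is_derive x 1 (fun t => sin (t * l)) (l * (unitf x * cos (x * l))).
  by apply: is_derive_eq; rewrite /GRing.scale/= /unitf; ring.
have d' (x : R) : is_derive x 1 (fun t => l * (unitf t * cos (t * l))) (- l ^+ 2 * sin (x * l)).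
  by apply: is_derive_eq; rewrite /GRing.scale/= /unitf; ring.
rewrite (FTC_I d (continuous_is_derive d')) mulNr sinN opprK [T * l]mulrC; ring.
Qed.

Lemma str_one l : str unitf l = 0.
Proof.
have [->|l0] := eqVneq l 0.
  apply: (@etrans _ _ (\int[mu]_(t in I) (0 : R))); last by rewrite /Rintegral integral0.
  by apply: eq_Rintegral => t _; rewrite mulr0 sin0 mulr0.
apply: (mulfI l0); rewrite mulr0.
have i1 := intg_sinM T0 l L2_one; rewrite -(RintegralZl l mI i1).
have d (x : R) : is_derive x 1 (fun t => - cos (t * l)) (l * (unitf x * sin (x * l))).
  by apply: is_derive_eq; rewrite /GRing.scale/= /unitf; ring.
have d' (x : R) : is_derive x 1 (fun t => l * (unitf t * sin (t * l))) (l ^+ 2 * cos (x * l)).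
  by apply: is_derive_eq; rewrite /GRing.scale/= /unitf; ring.
by rewrite (FTC_I d (continuous_is_derive d')) mulNr cosN subrr.
Qed.

(** Derivative of the identically vanishing sine transform of an even function. *)
Lemma ctr_X1 l : ctr (mulX unitf) l = 0.
Proof.
have [_ <-] := is_derive_str l L2_one.
have -> : str unitf = cst 0 by apply/funext => x; exact: str_one.
by have [_ ->] := is_derive_cst (0 : R) l (1 : R).
Qed.

Lemma is_derive_fa (l : R) : is_derive l 1 fa (- fp l).
Proof. exact: is_derive_ctr L2_one. Qed.

Lemma is_derive_fp (l : R) : is_derive l 1 fp (ctr (mulX (mulX unitf)) l).
Proof. exact: is_derive_str (L2X L2_one). Qed.

Lemma fa_le l : `|fa l| <= 2 * T.
Proof.
apply: (le_trans (ctr_bounded T0 l L2_one)).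
have -> : nrm1 T unitf = \int[mu]_(t in I) (1 : R).
  by apply: eq_Rintegral => t _; rewrite /unitf normr1.
have d (x : R) : is_derive x 1 (fun t : R => t) (1 : R) by exact: is_derive_id.
rewrite (FTC_I d); last by move=> x; exact: cvg_cst.
by rewrite opprK -mulr2n mulr_natl.
Qed.

(** Differentiate the product [l * fa l = 2 * sin (l * T)]. *)
Lemma mul_fp l : l * fp l = fa l - 2 * T * cos (l * T).
Proof.
have d1 : is_derive l 1 (fun x => x * fa x) (fa l - l * fp l).
  have := is_derive_fa l => d; apply: is_derive_eq; rewrite /GRing.scale/=; ring.
have d2 : is_derive l 1 (fun x => x * fa x) (2 * T * cos (l * T)).
  have -> : (fun x => x * fa x) = (fun x => 2 * sin (x * T)).
    by apply/funext => x; exact: mul_fa.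
  by apply: is_derive_eq; rewrite /GRing.scale/=; ring.
have e : fa l - l * fp l = 2 * T * cos (l * T) by rewrite -(@derive_val _ _ _ _ _ _ _ d1) (@derive_val _ _ _ _ _ _ _ d2).
by rewrite -e; ring.
Qed.

End transforms.

(** * Compactness tested on characters *)

Section characters.
Context (R : realType) (T : R).
Hypothesis T0 : 0 < T.
Notation mu := (@lebesgue_measure R).
Local Notation muI := (mrestr (@lebesgue_measure R) (measurable_sym_itv T)).
Local Notation I := (sym_itv T).
Local Notation H := (`[0, +oo[%classic : set (measurableTypeR R)).
Local Notation L2 := (L2 T).
Local Notation sqn := (sqn T).
Local Notation ip := (ip T).
Local Notation mI := (measurable_I T).
Local Notation mH := (@measurable_H R).
Local Notation ctr := (ctr T).
Local Notation str := (str T).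
Local Notation fa := (fa T).
Local Notation fp := (fp T).
Local Notation unitf := (@unitf R).

(** Along the points where the norm stays above [d], compactness gives a cluster
    point; it is orthogonal to itself, hence zero, which contradicts the bound [d]. *)
Lemma weak_to_strong (f : R -> cL2 muI) : precompact (f @` setT) ->
  (forall h, rip (f w) h @[w --> +oo] --> (0 : R)) ->
  forall d, 0 < d -> \forall w \near +oo, rnorm (f w) <= d.
Proof.
move=> cf wf d d0; apply: contrapT => nB.
pose F := within [set w | d < rnorm (f w)] (pinfty_nbhs R).
have PF : ProperFilter F.
  split; last exact: within_filter.
  move=> h; apply: nB; have h' : \forall w \near +oo, d < rnorm (f w) -> False := h.
  by apply: filterS h' => w hw; rewrite leNgt; apply/negP.
have PG : ProperFilter (f @ F) by exact: fmap_proper_filter.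
have hcl w : closure (f @` setT) (f w) by apply: subset_closure; exists w.
have GC : (f @ F) (closure (f @` setT)).
  by apply: (@filterS _ F _ setT) => [w _|]; [exact: hcl|exact: filterT].
move: cf; rewrite precompactE => /(_ (f @ F) PG GC) [p [_ clp]].
have key (e : R) : 0 < e -> exists v, [/\ d < rnorm v, `|rip v p| <= e & rnorm (p - v) < e].
  move=> e0; pose S := [set v | d < rnorm v /\ `|rip v p| <= e].
  have GS : (f @ F) S.
    have h : \forall w \near +oo, `|rip (f w) p| <= e by move/cvgr0Pnorm_le : (wf p); apply.
    by rewrite /= /F /within /=; apply: filterS h => w h wd; split.
  by have [v [[v1 v2] v3]] := clp S _ GS (near_cL2P p e0); exists v.
have N0 : rip p p <= 0.
  rewrite leNgt; apply/negP => N0; pose e := Num.min 1 (rip p p / 4).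
  have e0 : 0 < e by rewrite lt_min ltr01 divr_gt0.
  have e1 : e <= 1 by rewrite ge_min lexx.
  have e4 : e <= rip p p / 4 by rewrite ge_min lexx orbT.
  have [v [_ v2 v3]] := key e e0.
  have q : p - v = (-1)%:C *: v + p by rewrite rmorphN1 scaleN1r addrC.
  have h : rip (p - v) p = - rip v p + rip p p by rewrite q rip_comb mulN1r.
  have := rip_le (p - v) p (ltr01 : 0 < 1 :> R); rewrite h invr1 !mul1r (rnorm_sq p) => h1.
  have h2 : rnorm (p - v) ^+ 2 <= e.
    rewrite expr2; apply: (@le_trans _ _ (e * 1)); last by rewrite mulr1.
    by apply: ler_pM; rewrite ?rnorm_ge0 ?(ltW v3)// (le_trans (ltW v3)).
  have h3 := ler_norm (rip v p); have h4 := ler_norm (- rip v p + rip p p).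
  move: (rip p p) (rip v p) (rnorm (p - v) ^+ 2) h1 h2 h3 h4 e4 v2 N0.
  by move=> *; lra.
have p0 : p = 0.
  apply: rnorm_eq0; apply/eqP; rewrite -sqrf_eq0 rnorm_sq; apply/eqP/le_anti.
  by rewrite N0 -rnorm_sq sqr_ge0.
have [v [v1 _ v3]] := key d d0.
by move: v3; rewrite p0 rnorm_subC subr0 ltNge (ltW v1).
Qed.

Definition mc (w : R) := fun t : R => unitf t * cos (t * w).
Definition ms (w : R) := fun t : R => unitf t * sin (t * w).

Lemma L2_mc w : L2 (mc w).
Proof.
by have := L2_pc T0 w; congr L2; apply/funext => t; rewrite /mc /Submission.unitf mul1r.
Qed.

Lemma L2_ms w : L2 (ms w).
Proof.
by have := L2_ps T0 w; congr L2; apply/funext => t; rewrite /ms /Submission.unitf mul1r.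
Qed.

(** The character [t |-> exp (i w t)]. *)
Definition ev (w : R) : cL2 muI := cL2_pi (mkcL2 (L2_mc w) (L2_ms w)).

Lemma ip_rre_ev w h : L2 h -> ip (rre (ev w)) h = ip (mc w) h.
Proof.
move=> Lh; have e : {ae mu, forall t, I t -> rre (ev w) t = mc w t} by exact: rre_pi.
by rewrite (eq_ip (L2_rre _) (L2_mc w) Lh Lh e (ae_all (fun t _ => erefl))).
Qed.

Lemma ip_rim_ev w h : L2 h -> ip (rim (ev w)) h = ip (ms w) h.
Proof.
move=> Lh; have e : {ae mu, forall t, I t -> rim (ev w) t = ms w t} by exact: rim_pi.
by rewrite (eq_ip (L2_rim _) (L2_ms w) Lh Lh e (ae_all (fun t _ => erefl))).
Qed.

Lemma ip_mc w h : ip (mc w) h = ctr h w.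
Proof.
by apply: eq_Rintegral => t _; rewrite /mc /Submission.unitf mul1r mulrC.
Qed.

Lemma ip_ms w h : ip (ms w) h = str h w.
Proof.
by apply: eq_Rintegral => t _; rewrite /ms /Submission.unitf mul1r mulrC.
Qed.

Lemma rip_ev w h : rip (ev w) h = ctr (rre h) w + str (rim h) w.
Proof.
by rewrite /rip (ip_rre_ev _ (L2_rre h)) (ip_rim_ev _ (L2_rim h)) ip_mc ip_ms.
Qed.

Lemma rnorm_ev w : rnorm (ev w) ^+ 2 <= 2 * T.
Proof.
have e : rnorm (ev w) ^+ 2 = fa 0.
  rewrite rnorm_sq /rip (ip_rre_ev _ (L2_rre _)) (ip_rim_ev _ (L2_rim _)).
  rewrite ipC [ip (ms w) _]ipC (ip_rre_ev _ (L2_mc w)) (ip_rim_ev _ (L2_ms w)).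
  rewrite -(RintegralD mI (L2_mul (L2_mc w) (L2_mc w)) (L2_mul (L2_ms w) (L2_ms w))).
  apply: eq_Rintegral => t _; rewrite /mc /ms /Submission.unitf mulr0 cos0 !mul1r -!expr2.
  exact: cos2Dsin2.
by rewrite e; apply: (le_trans (ler_norm _)); exact: fa_le.
Qed.

Section values.
Variables (w y : R).
Let L1 : L2 unitf := L2_one T0.
Let X1 : L2 (mulX unitf) := L2X L1.

Let mulX_mc : mulX (mc w) = (fun t => mulX unitf t * cos (t * w)).
Proof.
by apply/funext => t; rewrite /mulX /mc mulrA.
Qed.

Let mulX_ms : mulX (ms w) = (fun t => mulX unitf t * sin (t * w)).
Proof.
by apply/funext => t; rewrite /mulX /ms mulrA.
Qed.

Lemma ev_rre_c : ip (rre (ev w)) (pc y) = 2^-1 * (fa (y - w) + fa (y + w)).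
Proof.
by rewrite (ip_rre_ev _ (L2_pc T0 y)); exact: (ctr_modc T0 w y L1).
Qed.

Lemma ev_rre_s : ip (rre (ev w)) (ps y) = 0.
Proof.
rewrite (ip_rre_ev _ (L2_ps T0 y)); apply: (etrans (str_modc T0 w y L1)).
by rewrite !(str_one T0) addr0 mulr0.
Qed.

Lemma ev_rre_Xc : ip (rre (ev w)) (mulX (pc y)) = 0.
Proof.
rewrite (ip_rre_ev _ (L2X (L2_pc T0 y))) -ip_mulX mulX_mc.
apply: (etrans (ctr_modc T0 w y X1)).
by rewrite !(ctr_X1 T0) addr0 mulr0.
Qed.

Lemma ev_rre_Xs : ip (rre (ev w)) (mulX (ps y)) = 2^-1 * (fp (y - w) + fp (y + w)).
Proof.
rewrite (ip_rre_ev _ (L2X (L2_ps T0 y))) -ip_mulX mulX_mc.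
exact: (str_modc T0 w y X1).
Qed.

Lemma ev_rim_c : ip (rim (ev w)) (pc y) = 0.
Proof.
rewrite (ip_rim_ev _ (L2_pc T0 y)); apply: (etrans (ctr_mods T0 w y L1)).
by rewrite !(str_one T0) subr0 mulr0.
Qed.

Lemma ev_rim_s : ip (rim (ev w)) (ps y) = 2^-1 * (fa (y - w) - fa (y + w)).
Proof.
by rewrite (ip_rim_ev _ (L2_ps T0 y)); exact: (str_mods T0 w y L1).
Qed.

Lemma ev_rim_Xc : ip (rim (ev w)) (mulX (pc y)) = 2^-1 * (fp (y + w) - fp (y - w)).
Proof.
rewrite (ip_rim_ev _ (L2X (L2_pc T0 y))) -ip_mulX mulX_ms.
exact: (ctr_mods T0 w y X1).
Qed.

Lemma ev_rim_Xs : ip (rim (ev w)) (mulX (ps y)) = 0.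
Proof.
rewrite (ip_rim_ev _ (L2X (L2_ps T0 y))) -ip_mulX mulX_ms.
apply: (etrans (str_mods T0 w y X1)).
by rewrite !(ctr_X1 T0) subr0 mulr0.
Qed.

End values.

(** The Fejer kernel [2 * (sin (l * T) / l) ^+ 2]. Since [fp] is minus the derivative
    of [fa], the next definition is [fej] minus its derivative. *)
Definition fej (l : R) := 2^-1 * fa l ^+ 2.
Definition fejG (l : R) := fej l + fa l * fp l.

(** Real and imaginary parts of the character combine so that the products of
    transforms shifted by [w] and by [- w] cancel. *)
Lemma cform_ev (E : R -> R) w y :
  cform E (ev w) (ev w) y = E y * (fejG (y - w) + fejG (y + w)).
Proof.
rewrite /cform !wformE ev_rre_c ev_rre_s ev_rre_Xc ev_rre_Xs.
rewrite ev_rim_c ev_rim_s ev_rim_Xc ev_rim_Xs /fejG /fej.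
move: (fa (y - w)) (fa (y + w)) (fp (y - w)) (fp (y + w)) (E y) => a b p q e.
by field.
Qed.

Lemma mform_ev w : mform (ev w) (ev w) = fa w ^+ 2.
Proof.
have L1 := L2_cst T0 1; rewrite /mform !int_ip (ip_rre_ev _ L1) (ip_rim_ev _ L1).
have -> : ip (ms w) (fun=> 1) = 0 by rewrite ip_ms; exact: (str_one T0).
by rewrite ip_mc mulr0 addr0 expr2.
Qed.

Definition decay_cst := 2 * T ^+ 2 + 2 * T * nrm1 T (mulX unitf) + 2 + 8 * T.

Lemma mul_fa_le l : `|l * fa l| <= 2.
Proof.
by rewrite (mul_fa T0) normrM ger0_norm// ler_piMr// sin_max.
Qed.

Lemma mul_fp_le l : `|l * fp l| <= 4 * T.
Proof.
rewrite (mul_fp T0); apply: (le_trans (ler_normB _ _)).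
have h1 := fa_le T0 l.
have h2 : `|2 * T * cos (l * T)| <= 2 * T.
  have T2 : 0 <= 2 * T by rewrite mulr_ge0// ltW.
  by rewrite normrM (ger0_norm T2) ler_piMr// cos_max.
have -> : 4 * T = 2 * T + 2 * T by ring.
exact: lerD.
Qed.

Lemma fej_ge0 l : 0 <= fej l.
Proof.
by rewrite mulr_ge0 ?invr_ge0// sqr_ge0.
Qed.

Lemma fej_tail l : l ^+ 2 * fej l <= 2.
Proof.
have h := mul_fa_le l; rewrite /fej mulrCA -exprMn -(real_normK (num_real (l * fa l))).
have h2 : `|l * fa l| ^+ 2 <= 2 ^+ 2 by rewrite ler_pXn2r// nnegrE.
by rewrite ler_pdivrMl//; move: h2; rewrite [2 ^+ 2]expr2.
Qed.

Lemma fej_le l : fej l <= (2 * T ^+ 2 + 2) * lorentz 0 l.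
Proof.
have h1 := fej_tail l.
have h2 : fej l <= 2 * T ^+ 2.
  have h : `|fa l| ^+ 2 <= (2 * T) ^+ 2.
    by rewrite ler_pXn2r// ?nnegrE ?(fa_le T0)// mulr_ge0// ltW.
  move: h; rewrite real_normK ?num_real// /fej exprMn => h.
  by rewrite ler_pdivrMl// mulrA -expr2.
rewrite /lorentz subr0 ler_pdivlMr; last by rewrite ltr_wpDr// sqr_ge0.
by rewrite mulrDr mulr1 [fej l * _]mulrC lerD.
Qed.

Lemma fejG_le l : `|fejG l| <= decay_cst * lorentz 0 l.
Proof.
have h0 := fej_le l; have h1 := fa_le T0 l; have h2 := mul_fa_le l; have h3 := mul_fp_le l.
have h4 : `|fp l| <= nrm1 T (mulX unitf).
  exact (str_bounded T0 l (L2X (L2_one T0))).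
have c0 := lorentz_gt0 0 l.
have h5 : `|fa l * fp l| <= (2 * T * nrm1 T (mulX unitf) + 8 * T) * lorentz 0 l.
  rewrite /lorentz subr0 ler_pdivlMr; last by rewrite ltr_wpDr// sqr_ge0.
  rewrite mulrDr mulr1; apply: lerD.
    by rewrite normrM; apply: ler_pM.
  have -> : `|fa l * fp l| * l ^+ 2 = `|l * fa l| * `|l * fp l|.
    by rewrite -(real_normK (num_real l)) !normrM; ring.
  by rewrite (_ : 8 * T = 2 * (4 * T)); [exact: ler_pM|ring].
apply: (le_trans (ler_normD _ _)); rewrite (ger0_norm (fej_ge0 l)).
apply: (le_trans (lerD h0 h5)); rewrite -mulrDl ler_pM2r// /decay_cst.
by rewrite le_eqVlt; apply/orP; left; apply/eqP; ring.
Qed.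

Lemma continuous_fa : continuous fa.
Proof.
exact: continuous_is_derive (is_derive_fa T0).
Qed.

Lemma continuous_fp : continuous fp.
Proof.
exact: continuous_is_derive (is_derive_fp T0).
Qed.

Lemma continuous_fej : continuous fej.
Proof.
move=> l; apply: cvgM; first exact: cvg_cst.
by apply: cvgM; exact: continuous_fa.
Qed.

Lemma continuous_fejG : continuous fejG.
Proof.
move=> l; apply: cvgD; first exact: continuous_fej.
by apply: cvgM; [exact: continuous_fa|exact: continuous_fp].
Qed.

Lemma lorentz_shift (w y : R) : lorentz 0 (y - w) = lorentz w y.
Proof.
by rewrite /lorentz subr0.
Qed.

Variable (K : set nat) (A : R).
Hypothesis hK : K `<=` [set n | (0 < n)%N].
Hypothesis hA : 0 <= A.
Local Notation Psi := (Psi_op K A T).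
Local Notation dev := (dev K A).

(** The deviation is bounded, so quadratic decay of the kernel suffices. *)
Lemma dev_kernel (k : R -> R) (C w : R) : continuous k ->
  (forall l, `|k l| <= C * lorentz 0 l) ->
  intg H (fun y => dev y * k (y - w)) /\
  `|\int[mu]_(y in H) (dev y * k (y - w))| <= (1 + A) * C * (pi / 2 - atan (- w)).
Proof.
move=> ck kC; have [ic ec] := lorentz_integral w 0.
have b y : H y -> `|dev y * k (y - w)| <= (1 + A) * C * lorentz w y.
  move=> _; rewrite normrM -mulrA; apply: ler_pM => //; first exact: dev_le.
  by rewrite -lorentz_shift.
have m : measurable_fun H (fun y => dev y * k (y - w)).
  apply: measurable_funTS; apply: measurable_funM; first exact: measurable_dev.
  apply: (measurableT_comp (continuous_measurable_fun ck)).
  by apply: measurable_funB => //; exact: measurable_cst.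
have i2 := intgZ ((1 + A) * C) mH ic.
have i1 := intg_le mH i2 m b; split => //.
apply: (le_trans (le_Rintegral_norm mH i1 i2 b)).
by rewrite (RintegralZl _ mH ic) ec sub0r.
Qed.

Lemma Psi_ev_form w : pi * rip (Psi (ev w)) (ev w) =
  A * fa w ^+ 2 + (\int[mu]_(y in H) (dev y * fejG (y - w)) +
                   \int[mu]_(y in H) (dev y * fejG (y - - w))).
Proof.
have [_ ->] := Psi_weak T0 A hK (ev w) (ev w); rewrite mform_ev.
have [i1 _] := dev_kernel w continuous_fejG fejG_le.
have [i2 _] := dev_kernel (- w) continuous_fejG fejG_le.
rewrite -(RintegralD mH i1 i2); congr (_ + _); apply: eq_Rintegral => y _.
by rewrite cform_ev opprK mulrDr.
Qed.

Lemma bounded_ev : bounded_set (ev @` setT).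
Proof.
exists (2 * T + 1)%:C; split.
  by apply: ger0_real; rewrite (_ : 0 = 0%:C)// lecR addr_ge0// mulr_ge0// ltW.
move=> z zlt v [w _ <-]; apply: le_trans (ltW zlt); rewrite normE lecR.
have h := rnorm_ev w; have := sqr_ge0 (rnorm (ev w) - 1); rewrite sqrrB1 => h'.
have := rnorm_ge0 (ev w).
move: (rnorm (ev w)) (rnorm (ev w) ^+ 2) h h' => *; lra.
Qed.

Hypothesis cPsi : compact_operator Psi.

(** By symmetry the images of characters pair with a fixed vector as its Fourier
    transform, which tends to [0]; compactness makes the convergence strong. *)
Lemma Psi_ev_cvg0 : rip (Psi (ev w)) (ev w) @[w --> +oo] --> (0 : R).
Proof.
have [_ /(_ _ bounded_ev) pc] := cPsi.
have pc' : precompact ((fun w => Psi (ev w)) @` setT).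
  apply: precompact_subset pc => v [w _ <-]; exists (ev w) => //; by exists w.
have wk h : rip (Psi (ev w)) h @[w --> +oo] --> (0 : R).
  have e : (fun w => rip (Psi (ev w)) h) = (fun w => ctr (rre (Psi h)) w + str (rim (Psi h)) w).
    apply/funext => w; rewrite (Psi_sym T0 A hK) -rip_ev /rip.
    by rewrite ipC [X in _ + X]ipC.
  rewrite e -[X in _ --> X]addr0; apply: cvgD.
    by have [] := riemann_lebesgue T0 (L2_rre (Psi h)).
  by have [] := riemann_lebesgue T0 (L2_rim (Psi h)).
have st := weak_to_strong pc' wk.
apply/cvgr0Pnorm_le => e e0; pose d := e / (1 + 2 * T).
have T1 : 0 < 1 + 2 * T by rewrite addr_gt0// mulr_gt0.
have d0 : 0 < d by rewrite divr_gt0.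
apply: filterS (st d d0) => w wd.
have di : 0 < d^-1 by rewrite invr_gt0.
apply: (le_trans (rip_le _ _ di)).
have h1 : d^-1 * rnorm (Psi (ev w)) ^+ 2 <= d.
  by rewrite ler_pdivrMl// -expr2 ler_pXn2r// ?nnegrE ?rnorm_ge0// ltW.
have h2 : d^-1^-1 * rnorm (ev w) ^+ 2 <= d * (2 * T).
  by rewrite invrK ler_pM2l// rnorm_ev.
have h3 : d + d * (2 * T) = e by rewrite -[X in X + _]mulr1 -mulrDr /d divfK// gt_eqF.
rewrite ler_pdivrMl//; apply: (le_trans (lerD h1 h2)).
by rewrite h3 ler_peMl ?(ltW e0)// ler1n.
Qed.

Lemma dev_fejG_cvg0 : \int[mu]_(y in H) (dev y * fejG (y - w)) @[w --> +oo] --> (0 : R).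
Proof.
have c1 := Psi_ev_cvg0.
have c2 : fa w @[w --> +oo] --> (0 : R) by have [] := riemann_lebesgue T0 (L2_one T0).
have c3 : \int[mu]_(y in H) (dev y * fejG (y - - w)) @[w --> +oo] --> (0 : R).
  have cb : (1 + A) * decay_cst * (pi / 2 - atan w) @[w --> +oo] --> (0 : R).
    rewrite -[X in _ --> X](mulr0 ((1 + A) * decay_cst)); apply: cvgM; first exact: cvg_cst.
    rewrite -[X in _ --> X](subrr (pi / 2)); apply: cvgB; first exact: cvg_cst.
    exact: cvgy_atan.
  apply/cvgr0Pnorm_le => e e0.
  have ne : \forall w \near +oo, (1 + A) * decay_cst * (pi / 2 - atan w) <= e.
    exact: cvgr_le cb _ e0.
  apply: filterS ne => w we; apply: le_trans we.
  have [_ h] := dev_kernel (- w) continuous_fejG fejG_le.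
  by rewrite [X in atan X]opprK in h.
have e : (fun w => \int[mu]_(y in H) (dev y * fejG (y - w))) =
    (fun w => pi * rip (Psi (ev w)) (ev w) - A * fa w ^+ 2 -
      \int[mu]_(y in H) (dev y * fejG (y - - w))).
  apply/funext => w; rewrite Psi_ev_form.
  by rewrite [A * _ + _]addrC addrK addrK.
rewrite e -[X in _ --> X](subr0 0); apply: cvgB => //.
rewrite -[X in _ --> X](subr0 0); apply: cvgB.
  by rewrite -[X in _ --> X](mulr0 pi); apply: cvgM => //; exact: cvg_cst.
rewrite -[X in _ --> X](mulr0 A); apply: cvgM; first exact: cvg_cst.
by rewrite -[X in _ --> X](mulr0 0); exact: cvgM.
Qed.

End characters.

(** * The Tauberian argument *)

Section averaging.
Context (R : realType) (T : R).
Hypothesis T0 : 0 < T.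
Notation mu := (@lebesgue_measure R).
Local Notation I := (sym_itv T).
Local Notation H := (`[0, +oo[%classic : set (measurableTypeR R)).
Local Notation mI := (measurable_I T).
Local Notation mH := (@measurable_H R).
Local Notation fa := (fa T).
Local Notation fp := (fp T).
Local Notation fej := (fej T).
Local Notation fejG := (fejG T).
Variable (K : set nat) (A : R).
Hypothesis hK : K `<=` [set n | (0 < n)%N].
Hypothesis hA : 0 <= A.
Local Notation Psi := (Psi_op K A T).
Local Notation dev := (dev K A).

Lemma lorentzK (u : R) : (1 + u ^+ 2) * lorentz 0 u = 1.
Proof.
by rewrite /lorentz subr0 divff// gt_eqF// ltr_wpDr// sqr_ge0.
Qed.

Lemma is_derive_fej (l : R) : is_derive l 1 fej (- (fa l * fp l)).
Proof.
have d := is_derive_fa T0 l.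
have -> : fej = (fun x => 2^-1 * (fa x * fa x)) by apply/funext => x; rewrite /Submission.fej expr2.
apply: is_derive_eq; rewrite /GRing.scale/=.
first [by field | by lra | by ring].
Qed.

Lemma is_derive_expfej (c y w u : R) :
  is_derive u 1 (fun u => c * (expR (u - w) * fej (y - u))) (c * (expR (u - w) * fejG (y - u))).
Proof.
have d0 : is_derive u 1 (fun u => y - u) (- 1).
  by apply: is_derive_eq; rewrite /GRing.scale/=; ring.
have d1 : is_derive u 1 (fej \o (fun u => y - u)) ((- 1) * - (fa (y - u) * fp (y - u))).
  have d := is_derive_fej (y - u); apply: is_derive_eq; by rewrite /GRing.scale/=; ring.
have d2 : is_derive u 1 (fun u => fej (y - u)) (fa (y - u) * fp (y - u)).
  by move: d1; rewrite mulN1r opprK.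
have d3 : is_derive u 1 (fun u => expR (u - w)) (expR (u - w)).
  by apply: is_derive_eq; rewrite /GRing.scale/=; ring.
by apply: is_derive_eq; rewrite /GRing.scale/= /Submission.fejG; ring.
Qed.

(** Peetre's inequality: shifting by [u] costs at most a factor [2 * (1 + u ^+ 2)]. *)
Lemma peetre (y u : R) : (1 + y ^+ 2) * lorentz 0 (y - u) * lorentz 0 u <= 2.
Proof.
rewrite /lorentz !subr0 ler_pdivrMr; last by rewrite ltr_wpDr// sqr_ge0.
rewrite ler_pdivrMr; last by rewrite ltr_wpDr// sqr_ge0.
have := sqr_ge0 (y - u - u); have := mulr_ge0 (sqr_ge0 (y - u)) (sqr_ge0 u).
have -> : y ^+ 2 = (y - u) ^+ 2 + 2 * (y - u) * u + u ^+ 2 by ring.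
have -> : (y - u - u) ^+ 2 = (y - u) ^+ 2 - 2 * (y - u) * u + u ^+ 2 by ring.
move: ((y - u) ^+ 2) (u ^+ 2) (2 * (y - u) * u) => a b c h1 h2.
have -> : 2 * (1 + b) * (1 + a) = 2 + 2 * a + 2 * b + 2 * (a * b) by ring.
lra.
Qed.

Lemma intg_dev_fej w : intg H (fun y => dev y * fej (y - w)).
Proof.
have b l : `|fej l| <= (2 * T ^+ 2 + 2) * lorentz 0 l by rewrite (ger0_norm (fej_ge0 _ _)) fej_le.
by have [] := dev_kernel hK hA w (continuous_fej T0) b.
Qed.

Lemma intg_dev_fejG w : intg H (fun y => dev y * fejG (y - w)).
Proof.
by have [] := dev_kernel hK hA w (continuous_fejG T0) (fejG_le T0).
Qed.

(** Exponential averaging turns [fej - fej'] into [fej]: a Fubini argument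
    and the fundamental theorem of calculus in the shift. *)
Lemma averaging w : 0 <= w ->
  intg `[0, w] (fun u => expR (u - w) * \int[mu]_(y in H) (dev y * fejG (y - u))) /\
  \int[mu]_(y in H) (dev y * fej (y - w)) =
  \int[mu]_(u in `[0, w]) (expR (u - w) * \int[mu]_(y in H) (dev y * fejG (y - u))) +
  expR (- w) * \int[mu]_(y in H) (dev y * fej (y - 0)).
Proof.
move=> w0; pose J := (`[0, w]%classic : set (measurableTypeR R)).
have mJ : measurable J by exact: measurable_itv.
pose f (u : R) := expR (u - w) * (1 + u ^+ 2).
pose om (y : R) := dev y * lorentz 0 y.
pose c (u y : R) := fejG (y - u) * (1 + y ^+ 2) * lorentz 0 u.
have if_ : intg J f.
  apply: intg_itv_cont.
  have d (u : R) : is_derive u 1 f (expR (u - w) * (1 + u ^+ 2 + 2 * u)).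
    by apply: is_derive_eq; rewrite /GRing.scale/=; ring.
  exact: continuous_is_derive d.
have iom : intg H om.
  have [il _] := lorentz_integral (0 : R) 0.
  have mdev : measurable_fun H dev by apply: measurable_funTS; exact: measurable_dev.
  have := intgM_bounded mH il mdev (fun y _ => dev_le hK hA y).
  by congr (_.-integrable _ (_ \o _)); apply/funext => y; rewrite /om mulrC.
have mc : measurable_fun setT (fun p : measurableTypeR R * measurableTypeR R => c p.1 p.2).
  have m1 : measurable_fun setT (fun p : measurableTypeR R * measurableTypeR R => p.2 - p.1).
    by apply: measurable_funB; [exact: measurable_snd|exact: measurable_fst].
  have m0 : measurable_fun setT (fun p : measurableTypeR R * measurableTypeR R => p.1).
    exact: measurable_fst.
  apply: measurable_funM; first apply: measurable_funM.
  - exact: (measurableT_comp (continuous_measurable_fun (continuous_fejG T0)) m1).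
  - apply: measurable_funD; first exact: measurable_cst.
    by apply: measurable_funX; exact: measurable_snd.
  - have ml : measurable_fun setT (lorentz (0 : R)).
      by apply: continuous_measurable_fun; exact: continuous_lorentz.
    first [exact: (measurableT_comp ml m0) | by apply: (measurableT_comp (f := lorentz 0)) | by apply: measurableT_comp].
have cB u y : J u -> H y -> `|c u y| <= decay_cst T * 2.
  move=> _ _; have h := fejG_le T0 (y - u).
  have y1 : 0 <= 1 + y ^+ 2 by rewrite addr_ge0// sqr_ge0.
  have l0 := ltW (lorentz_gt0 0 u).
  rewrite /c !normrM (ger0_norm y1) (ger0_norm l0).
  have h1 : `|fejG (y - u)| * (1 + y ^+ 2) * lorentz 0 u <=
     decay_cst T * lorentz 0 (y - u) * (1 + y ^+ 2) * lorentz 0 u.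
    by apply: ler_wpM2r => //; exact: ler_wpM2r.
  apply: (le_trans h1).
  have D0 : 0 <= decay_cst T.
    have := fejG_le T0 0; rewrite /lorentz subr0 expr0n/= addr0 invr1 mulr1; exact: le_trans.
  have -> : decay_cst T * lorentz 0 (y - u) * (1 + y ^+ 2) * lorentz 0 u =
    decay_cst T * ((1 + y ^+ 2) * lorentz 0 (y - u) * lorentz 0 u) by ring.
  by apply: ler_wpM2l => //; exact: peetre.
have [s1 s2 s3] := @swap _ _ _ _ R mu mu J H f om c (decay_cst T * 2) mJ mH if_ iom mc cB.
have e1 u : f u * \int[mu]_(y in H) (om y * c u y) =
    expR (u - w) * \int[mu]_(y in H) (dev y * fejG (y - u)).
  have -> : \int[mu]_(y in H) (om y * c u y) =
      lorentz 0 u * \int[mu]_(y in H) (dev y * fejG (y - u)).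
    rewrite -(RintegralZl (lorentz 0 u) mH (intg_dev_fejG u)).
    apply: eq_Rintegral => y _; rewrite /om /c.
    have -> : dev y * lorentz 0 y * (fejG (y - u) * (1 + y ^+ 2) * lorentz 0 u) =
      ((1 + y ^+ 2) * lorentz 0 y) * (lorentz 0 u * (dev y * fejG (y - u))) by ring.
    by rewrite lorentzK mul1r.
  by rewrite /f -mulrA [(1 + _) * _]mulrA lorentzK mul1r.
have e2 y : om y * \int[mu]_(u in J) (f u * c u y) =
    dev y * fej (y - w) - expR (- w) * (dev y * fej (y - 0)).
  have -> : \int[mu]_(u in J) (f u * c u y) =
      (1 + y ^+ 2) * (expR (w - w) * fej (y - w)) - (1 + y ^+ 2) * (expR (0 - w) * fej (y - 0)).
    have cont : continuous (fun u => (1 + y ^+ 2) * (expR (u - w) * fejG (y - u))).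
      move=> u; apply: cvgM; first exact: cvg_cst.
      have d3 (v : R) : is_derive v 1 (fun u => expR (u - w)) (expR (v - w)).
        by apply: is_derive_eq; rewrite /GRing.scale/=; ring.
      have d0 (v : R) : is_derive v 1 (fun u => y - u) (- 1).
        by apply: is_derive_eq; rewrite /GRing.scale/=; ring.
      have P3 : continuous (fun u => expR (u - w)) by exact: continuous_is_derive d3.
      have P0 : continuous (fun u => y - u) by exact: continuous_is_derive d0.
      apply: cvgM; first exact: P3.
      apply: (@continuous_comp _ _ _ (fun u => y - u) fejG); last exact: continuous_fejG.
      exact: P0.
    rewrite -(Rintegral_FTC w0 (is_derive_expfej (1 + y ^+ 2) y w) cont).
    apply: eq_Rintegral => u _; rewrite /f /c.
    have -> : expR (u - w) * (1 + u ^+ 2) * (fejG (y - u) * (1 + y ^+ 2) * lorentz 0 u) =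
      ((1 + u ^+ 2) * lorentz 0 u) * ((1 + y ^+ 2) * (expR (u - w) * fejG (y - u))) by ring.
    by rewrite lorentzK mul1r.
  rewrite subrr expR0 mul1r sub0r /om.
  have -> : dev y * lorentz 0 y * ((1 + y ^+ 2) * fej (y - w) - (1 + y ^+ 2) * (expR (- w) * fej (y - 0)))
    = ((1 + y ^+ 2) * lorentz 0 y) * (dev y * fej (y - w) - expR (- w) * (dev y * fej (y - 0))) by ring.
  by rewrite lorentzK mul1r.
split.
  by move: s1; congr (_.-integrable _ (_ \o _)); apply/funext => u; exact: e1.
have <- : \int[mu]_(u in J) (f u * \int[mu]_(y in H) (om y * c u y)) =
   \int[mu]_(u in `[0, w]) (expR (u - w) * \int[mu]_(y in H) (dev y * fejG (y - u))).
  by apply: eq_Rintegral => u _; exact: e1.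
rewrite s3 -(RintegralZl (expR (- w)) mH (intg_dev_fej 0)).
have -> : \int[mu]_(y in H) (om y * \int[mu]_(u in J) (f u * c u y)) =
  \int[mu]_(y in H) (dev y * fej (y - w) - expR (- w) * (dev y * fej (y - 0))).
  by apply: eq_Rintegral => y _; exact: e2.
have i0 := intgZ (expR (- w)) mH (intg_dev_fej 0).
by rewrite (RintegralB mH (intg_dev_fej w) i0) subrK.
Qed.

(** The past before [U] is damped exponentially: [b] is there at most
    [Bm * expR (2 * (U - u))]. *)
Lemma exp_average_le (b : R -> R) (e Bm U w : R) : 0 <= e -> 0 <= Bm -> 0 <= w ->
  (forall u, `|b u| <= Bm) -> (forall u, U <= u -> `|b u| <= e) ->
  intg `[0, w] (fun u => expR (u - w) * b u) ->
  `|\int[mu]_(u in `[0, w]) (expR (u - w) * b u)| <= e + Bm * expR (2 * U) * expR (- w).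
Proof.
move=> e0 B0 w0 bB be ib; have mJ : measurable (`[0, w]%classic : set (measurableTypeR R)) by exact: measurable_itv.
pose C := Bm * expR (2 * U) * expR (- w).
have C0 : 0 <= C by rewrite !mulr_ge0// expR_ge0.
have dF (u : R) : is_derive u 1 (fun u => e * expR (u - w) - C * expR (- u)) (e * expR (u - w) + C * expR (- u)).
  by apply: is_derive_eq; rewrite /GRing.scale/=; ring.
have dG (u : R) : is_derive u 1 (fun u => e * expR (u - w) + C * expR (- u)) (e * expR (u - w) - C * expR (- u)).
  by apply: is_derive_eq; rewrite /GRing.scale/=; ring.
have cG := continuous_is_derive dG.
apply: (@le_trans _ _ (\int[mu]_(u in `[0, w]) (e * expR (u - w) + C * expR (- u)))).
  apply: (le_Rintegral_norm mJ ib (intg_itv_cont _ _ cG)) => u _.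
  rewrite normrM (ger0_norm (expR_ge0 _)).
  have [Uu|uU] := leP U u.
    apply: (@le_trans _ _ (e * expR (u - w))).
      by rewrite mulrC; apply: ler_wpM2r; [exact: expR_ge0|exact: be].
    by rewrite lerDl mulr_ge0// expR_ge0.
  apply: (@le_trans _ _ (C * expR (- u))); last by rewrite lerDr mulr_ge0// expR_ge0.
  rewrite /C -!mulrA mulrC; apply: ler_pM; [exact: normr_ge0|exact: expR_ge0|exact: bB|].
  rewrite -!expRD ler_expR; lra.
rewrite (Rintegral_FTC w0 dF cG) subrr expR0 mulr1 oppr0 expR0 mulr1 sub0r.
have h1 : 0 <= C * expR (- w) by rewrite mulr_ge0// expR_ge0.
have h2 : 0 <= e * expR (- w) by rewrite mulr_ge0// expR_ge0.
by rewrite -/C; lra.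
Qed.

Hypothesis cPsi : compact_operator Psi.

Lemma dev_fej_cvg0 : \int[mu]_(y in H) (dev y * fej (y - w)) @[w --> +oo] --> (0 : R).
Proof.
pose b (u : R) := \int[mu]_(y in H) (dev y * fejG (y - u)).
have D0 : 0 <= decay_cst T.
  have := fejG_le T0 0; rewrite /lorentz subr0 expr0n/= addr0 invr1 mulr1; exact: le_trans.
pose Bm := (1 + A) * decay_cst T * pi.
have A0 : 0 <= (1 + A) * decay_cst T by rewrite mulr_ge0// addr_ge0.
have B0 : 0 <= Bm by rewrite mulr_ge0// pi_ge0.
have bB u : `|b u| <= Bm.
  have [_ h] := dev_kernel hK hA u (continuous_fejG T0) (fejG_le T0).
  apply: (le_trans h); apply: ler_wpM2l => //.
  have := atan_gtNpi2 (- u); lra.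
have cb := dev_fejG_cvg0 T0 hK hA cPsi.
apply/cvgr0Pnorm_le => e e0; have e2 : 0 < e / 2 by rewrite divr_gt0.
have [U [_ HU]] : \forall u \near +oo, `|b u| <= e / 2 by move/cvgr0Pnorm_le : cb; apply.
pose J0 := `|\int[mu]_(y in H) (dev y * fej (y - 0))|.
pose C := Bm * expR (2 * (U + 1)) + J0.
have C0 : 0 <= C.
  by apply: addr_ge0; [apply: mulr_ge0 => //; exact: expR_ge0|exact: normr_ge0].
have cE : C * expR (- w) @[w --> +oo] --> (0 : R).
  rewrite -[X in _ --> X](mulr0 C); apply: cvgM; first exact: cvg_cst.
  have h := @cvg_expRN R 1 ltr01.
  have ee : (fun x : R => expR (- (1 * x))) = (fun x => expR (- x)).
    by apply/funext => x; rewrite mul1r.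
  by rewrite ee in h.
have nE : \forall w \near +oo, C * expR (- w) <= e / 2 by exact: cvgr_le cE _ e2.
near=> w.
have w0 : 0 <= w by near: w; exact: nbhs_pinfty_ge (num_real _).
have wE : C * expR (- w) <= e / 2 by near: w; exact: nE.
have [ia ea] := averaging w0.
have h := exp_average_le (ltW e2) B0 w0 bB (U := U + 1) (fun u Uu => HU u (lt_le_trans (ltr_pwDr ltr01 (lexx U)) Uu)) ia.
rewrite ea; apply: (le_trans (ler_normD _ _)).
rewrite [`|expR _ * _|]normrM (ger0_norm (expR_ge0 _)) -/J0.
move: wE; rewrite /C mulrDl => wE; move: h wE; rewrite [expR (- w) * J0]mulrC; lra.
Unshelve. all: by end_near. Qed.

Lemma fej_ge l : `|l| <= (2 * T)^-1 -> 2^-1 * T ^+ 2 <= fej l.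
Proof.
move=> lT; have h (t : R) : I t -> 2^-1 <= unitf t * cos (t * l).
  move=> /in_I tT; rewrite /unitf mul1r.
  have : `|t * l| <= 2^-1.
    rewrite normrM; apply: (le_trans (ler_pM _ _ tT lT)) => //.
    by rewrite le_eqVlt; apply/orP; left; apply/eqP; field; rewrite gt_eqF.
  have := cos_lipschitz (t * l) 0; rewrite cos0 subr0 ler_norml => /andP[h1 _] h2; lra.
have faT : T <= fa l.
  have ic := intg_cst T0 (2^-1); have i1 := intg_cosM T0 l (L2_one T0).
  have e : \int[mu]_(t in I) (2^-1 : R) = T.
    rewrite Rintegral_cst; last exact: mI.
    have -> : fine (mu I) = 2 * T by exact: (congr1 fine (mu_I T0)).
    by rewrite mulrA mulVf ?mul1r// pnatr_eq0.
  by rewrite -[leLHS]e; exact: (le_Rintegral mI ic i1 h).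
rewrite /Submission.fej ler_pM2l ?invr_gt0//; rewrite ler_pXn2r// ?nnegrE ?(ltW T0)//.
exact: le_trans (ltW T0) faT.
Qed.

Definition tail_cst (eta : R) := (1 + A) * (2 + 8 / eta ^+ 2) * pi.

(** The Fejer kernel has mass of order [T] near its centre, while its mass
    outside any fixed neighbourhood is bounded independently of [T]. *)
Lemma tauber_lower (e eta w s : R) : 0 < e -> 0 < eta -> (2 * T)^-1 <= eta / 2 ->
  eta / 2 <= w -> `|s| <= 1 ->
  (forall y, `|y - w| <= eta / 2 -> e / 2 <= s * dev y) ->
  e * T / 4 <= s * \int[mu]_(y in H) (dev y * fej (y - w)) + tail_cst eta.
Proof.
move=> e0 n0 Tn nw s1 he; pose c := (1 + A) * (2 + 8 / eta ^+ 2).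
have A1 : 0 <= 1 + A by rewrite addr_ge0.
have n2 : 0 < eta ^+ 2 by rewrite exprn_gt0.
have c8 : 0 <= 8 / eta ^+ 2 by rewrite divr_ge0// ltW.
have c0 : 0 <= c by rewrite mulr_ge0// addr_ge0.
have [il _] := lorentz_integral w 0.
pose k y := s * (dev y * fej (y - w)) + c * lorentz w y.
have i1 := intgZ s mH (intg_dev_fej w); have i2 := intgZ c mH il.
have ik : intg H k by exact: (intgD mH i1 i2).
have near_ y : `|y - w| <= eta / 2 -> e / 2 * fej (y - w) <= k y.
  move=> yw; apply: ler_wpDr; first by rewrite mulr_ge0// ltW// lorentz_gt0.
  by rewrite mulrA; apply: ler_wpM2r; [exact: fej_ge0|exact: he].
have k0 y : H y -> 0 <= k y.
  move=> _; have [yw|yw] := leP `|y - w| (eta / 2).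
    apply: le_trans (near_ y yw); rewrite mulr_ge0 ?fej_ge0// ltW// divr_gt0//.
  have h1 : - ((1 + A) * fej (y - w)) <= s * (dev y * fej (y - w)).
    have h : `|s * (dev y * fej (y - w))| <= (1 + A) * fej (y - w).
      rewrite mulrA normrM (ger0_norm (fej_ge0 _ _)); apply: ler_wpM2r; first exact: fej_ge0.
      by rewrite normrM -[leRHS]mul1r; apply: ler_pM => //; exact: dev_le.
    by move: h; rewrite ler_norml => /andP[].
  have t := fej_tail T0 (y - w); set l := y - w in yw h1 t *.
  have l2 : eta ^+ 2 / 4 <= l ^+ 2.
    have -> : eta ^+ 2 / 4 = (eta / 2) ^+ 2 by field.
    by rewrite -(real_normK (num_real l)) ler_pXn2r ?nnegrE ?(ltW yw)// ltW// divr_gt0.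
  have f8 : fej l <= 8 / eta ^+ 2.
    rewrite ler_pdivlMr//; have := ler_wpM2r (fej_ge0 T l) l2.
    rewrite [eta ^+ 2 / 4 * _]mulrAC => h2.
    have h3 : eta ^+ 2 * fej l / 4 <= 2 by exact: le_trans h2 t.
    by move: h3; rewrite ler_pdivrMr// mulrC -natrM.
  have fl : fej l <= (2 + 8 / eta ^+ 2) * lorentz w y.
    rewrite /lorentz -/l ler_pdivlMr; last by rewrite ltr_wpDr// sqr_ge0.
    by rewrite mulrDr mulr1 [fej l * _]mulrC addrC; exact: lerD.
  rewrite /k -/l; apply: le_trans (lerD h1 (lexx _)).
  by rewrite addrC subr_ge0 /c -mulrA; exact: ler_wpM2l.
pose d := (2 * T)^-1; have d0 : 0 < d by rewrite invr_gt0 mulr_gt0.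
have mJ : measurable (`[w - d, w + d]%classic : set (measurableTypeR R)) by exact: measurable_itv.
have JH : (`[w - d, w + d]%classic : set (measurableTypeR R)) `<=` H.
  move=> y /=; rewrite !in_itv/= andbT => /andP[h _].
  by apply: le_trans h; rewrite subr_ge0; exact: le_trans Tn nw.
have wd : w - d <= w + d by lra.
have ic : intg `[w - d, w + d] (fun=> e / 2 * (2^-1 * T ^+ 2)).
  by apply: intg_itv_cont => x; exact: cvg_cst.
have ikJ : intg `[w - d, w + d] k by exact: integrableS ik.
have low : e / 2 * (2^-1 * T ^+ 2) * (w + d - (w - d)) <= \int[mu]_(y in H) k y.
  rewrite -(Rintegral_cst_itv _ wd).
  apply: le_trans (Rintegral_subset mJ mH JH ik k0).
  apply: (le_Rintegral mJ ic ikJ) => y /=; rewrite in_itv/= => /andP[y1 y2].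
  have yd : `|y - w| <= d by rewrite ler_norml; apply/andP; split; lra.
  apply: le_trans (near_ y (le_trans yd Tn)).
  by apply: ler_wpM2l; [rewrite ltW// divr_gt0|exact: fej_ge].
have e1 : e / 2 * (2^-1 * T ^+ 2) * (w + d - (w - d)) = e * T / 4.
  by rewrite /d; field; rewrite gt_eqF.
have e3 : \int[mu]_(y in H) k y = s * \int[mu]_(y in H) (dev y * fej (y - w)) +
    c * \int[mu]_(y in H) lorentz w y.
  by rewrite (RintegralD mH i1 i2) (RintegralZl _ mH (intg_dev_fej w)) (RintegralZl _ mH il).
rewrite -e1; apply: (le_trans low); rewrite e3 lerD2l /tail_cst -/c.
by apply: ler_wpM2l => //; exact: lorentz_integral_le.
Qed.

End averaging.

Section tauberian.
Context (R : realType) (K : set nat) (A : R).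
Hypothesis hK : K `<=` [set n | (0 < n)%N].
Hypothesis hA : 0 <= A.
Local Notation dev := (dev K A).

Lemma set_count_le (x y : R) : x <= y -> (set_count K x)%:R <= (set_count K y)%:R :> R.
Proof.
move=> xy; pose N := (Num.truncn y).+1.
have yN : y < N%:R by exact: truncnS_gt.
rewrite -(pcount_stable hK yN) -(pcount_stable hK (le_lt_trans xy yN)).
apply: ler_sum => n _; rewrite ler_nat.
by case: (leP n%:R x) => // nx; rewrite (le_trans nx xy).
Qed.

(** The deviation decreases at most linearly: the density is a nondecreasing
    function times [expR (- y)]. *)
Lemma dev_slow (y z : R) : y <= z -> dev y - (z - y) <= dev z.
Proof.
move=> yz; rewrite /Submission.dev; have d1 := dens_le1 hK y; have d0 := dens_ge0 K y.
have h : dens K y * expR (- (z - y)) <= dens K z.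
  rewrite /dens -mulrA -expRD (_ : - y + - (z - y) = - z); last by ring.
  by apply: ler_wpM2r; [exact: expR_ge0|apply: set_count_le; rewrite ler_expR].
have h2 : dens K y * (1 - (z - y)) <= dens K y * expR (- (z - y)).
  by apply: ler_wpM2l => //; exact: expR_ge1Dx.
have h3 : dens K y * (z - y) <= 1 * (z - y) by apply: ler_wpM2r => //; rewrite subr_ge0.
move: h h2 h3; rewrite [_ * (1 - _)]mulrBr mulr1 mul1r.
by move: (dens K y) (dens K z) (z - y) => *; lra.
Qed.

(** A value of [dev] larger than [e] persists to the right, one smaller than [- e]
    to the left, on an interval of length [e / 2]; with [T] large, this
    contradicts the vanishing of the Fejer averages centred on it. *)
Lemma dev_cvg0 : (forall T : R, 0 < T -> compact_operator (Psi_op K A T)) ->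
  dev y @[y --> +oo] --> (0 : R).
Proof.
move=> cK; apply/cvgr0Pnorm_le => e e0; pose n := e / 2.
have n0 : 0 < n by rewrite divr_gt0.
have tc0 : 0 <= tail_cst A n.
  by rewrite !mulr_ge0 ?pi_ge0 ?addr_ge0 ?divr_ge0 ?sqr_ge0.
pose T := n^-1 + 4 * (tail_cst A n + 1) / e.
have T1 : 0 < 4 * (tail_cst A n + 1) / e by rewrite divr_gt0// mulr_gt0// ltr_wpDl.
have T0 : 0 < T by rewrite addr_gt0// invr_gt0.
have Tn : (2 * T)^-1 <= n / 2.
  rewrite invfM mulrC ler_pM2r ?invr_gt0// -[leRHS]invrK lef_pV2 ?posrE ?invr_gt0//.
  by rewrite lerDl ltW.
have big : tail_cst A n + 1 <= e * T / 4.
  have -> : e * T / 4 = e * n^-1 / 4 + (tail_cst A n + 1).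
    by rewrite /T; field; rewrite !gt_eqF.
  by rewrite lerDr !mulr_ge0 ?invr_ge0// ltW.
have [W [_ HW]] : \forall w \near +oo, `|\int[@lebesgue_measure R]_(y in `[0, +oo[) (dev y * fej T (y - w))| <= 2^-1.
  have := dev_fej_cvg0 T0 hK hA (cK T T0); move/cvgr0Pnorm_le; apply; by rewrite invr_gt0.
have key (w s : R) : n / 2 <= w -> W < w -> `|s| <= 1 ->
    (forall y, `|y - w| <= n / 2 -> e / 2 <= s * dev y) -> False.
  move=> nw Ww s1 hs; have h := tauber_lower T0 hK hA e0 n0 Tn nw s1 hs.
  have h1 := HW w Ww; move: h; set J := \int[_]_(_ in _) _ in h1 *.
  have : s * J <= 2^-1.
    apply: (le_trans (ler_norm _)); rewrite normrM -[leRHS]mul1r; exact: ler_pM.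
  by move: big => *; lra.
near=> z.
have zW : W + n < z by near: z; exact: nbhs_pinfty_gt (num_real _).
have zn : n <= z by near: z; exact: nbhs_pinfty_ge (num_real _).
have ne : n = e / 2 by [].
rewrite leNgt; apply/negP; rewrite lter_normr => /orP[hz|hz].
  apply: (key (z + n / 2) 1) => [|||y yw]; [lra|lra|by rewrite normr1|].
  move: yw; rewrite ler_norml mul1r => /andP[y1 y2].
  have yz : z <= y by lra.
  have := dev_slow yz; lra.
apply: (key (z - n / 2) (-1)) => [|||y yw]; [lra|lra|by rewrite normrN normr1|].
move: yw; rewrite ler_norml mulN1r => /andP[y1 y2].
have yz : y <= z by lra.
have := dev_slow yz; lra.
Unshelve. all: by end_near. Qed.

Lemma dev_cvgP : dev y @[y --> +oo] --> (0 : R) <->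
  (set_count K x)%:R / x @[x --> +oo] --> A.
Proof.
split=> h.
- have hl : (@ln R x) @[x --> +oo] --> +oo.
    apply/cvgryPge => M; near=> x.
    have x0 : expR M <= x by near: x; exact: nbhs_pinfty_ge (num_real _).
    by rewrite -ler_expR lnK// posrE (lt_le_trans _ x0)// expR_gt0.
  have c := cvg_comp _ _ hl h.
  have c2 : dev (ln x) + A @[x --> +oo] --> A.
    by rewrite -[X in _ --> X]add0r; apply: cvgD; [exact: c|exact: cvg_cst].
  apply: cvg_trans c2; apply: near_eq_cvg; near=> x.
  have x0 : 0 < x by near: x; exact: nbhs_pinfty_gt (num_real _).
  by rewrite /Submission.dev subrK /dens expRN lnK// posrE.
- have he : (@expR R y) @[y --> +oo] --> +oo.
    apply/cvgryPge => M; near=> y; apply: le_trans (expR_ge1Dx y).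
    have yM : M <= y by near: y; exact: nbhs_pinfty_ge (num_real _).
    by rewrite (le_trans yM)// lerDr.
  have c := cvg_comp _ _ he h.
  rewrite -[X in _ --> X](subrr A); apply: cvgB; last exact: cvg_cst.
  have -> : dens K = (fun y => (set_count K (expR y))%:R / expR y :> R).
    by apply/funext => y; rewrite /dens expRN.
  exact: c.
Unshelve. all: by end_near. Qed.

End tauberian.

Theorem theorem3 (R : realType) (K : set nat) (A : R)
    (hK : K `<=` [set n | (0 < n)%N]) (hA : 0 <= A) :
  (forall T : R, 0 < T -> compact_operator (Psi_op K A T)) <->
  (set_count K x)%:R / x @[x --> +oo] --> A.
Proof.
have e : dev K A y @[y --> +oo] --> (0 : R) <->
    (set_count K x)%:R / x @[x --> +oo] --> A by exact: dev_cvgP.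
split=> [h|h T T0]; first by apply/e; exact: dev_cvg0.
by apply: Psi_compact => //; exact/e.
Qed.
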